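(* Assume the parameter conditions, the regularity assumption, and the notation given in the context. Let $r\in(0,r_0)$ and $W_r:=\{(w,\phi)\in\mathbf H:\ \|(w,\phi)\|_{\mathbf H}\le r\}$, and assume that the data satisfy $$ r\,C_{\mathcal A}(1+r\,C_{\mathcal B})\,|\alpha|\,|g|+C_{\mathcal B}\,\|\varphi_D\|_{1/2,\Gamma_D}\ \le\ r \qquad\text{and}\qquad L_{\mathrm{Lip}}<1 .$$ Then the problem: find $(\vec\xi,\varphi)\in\mathbb H\times[H^1(\Omega)]^n$, $\vec\xi=(t,\sigma,u)$, with $\varphi|_{\Gamma_D}=\varphi_D$, such that $$\mathbf A_\varphi(\vec\xi,\vec\eta)+\mathbf B_u(\vec\xi,\vec\eta)=F_\varphi(\vec\eta)\quad\forall\,\vec\eta\in\mathbb H,\qquad \mathbf C(\varphi,\psi)=G_{u,\varphi}(\psi)\quad\forall\,\psi\in \mathbf H^1_{\Gamma_D}(\Omega),$$ has a unique solution $(\vec\xi,\varphi)$ with $(u,\varphi)\in W_r$, and there hold $$\|\vec\xi\|_{\mathbb H}\le C_{\mathcal A}\,r\,|\alpha|\,|g|\qquad\text{and}\qquad \|\varphi\|_{1,\Omega}\le C_{\mathcal B}\big\{r\,\|u\|_{1,\Omega}+\|\varphi_D\|_{1/2,\Gamma_D}\big\}.$$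
   Context: Domain and notation. $n\in\{2,3\}$; $\Omega\subset\mathbb R^n$ is a bounded domain with polygonal/polyhedral boundary $\Gamma$; $\Gamma_D,\Gamma_N\subseteq\Gamma$, $\Gamma_D\cap\Gamma_N=\varnothing$, $|\Gamma_D|>0$, $\Gamma=\overline\Gamma_D\cup\overline\Gamma_N$. $\|\cdot\|_{s,\Omega}$, $|\cdot|_{s,\Omega}$ are the norm and seminorm of $H^s(\Omega)$ and $\|\cdot\|_{0,p,\Omega}$ the norm of $L^p(\Omega)$ (also for vectors/tensors). $(\nabla v)_{ij}=\partial v_i/\partial x_j$, $e(v)=\frac12(\nabla v+(\nabla v)^{\mathrm t})$, $\omega(v)=\frac12(\nabla v-(\nabla v)^{\mathrm t})$, $(v\otimes w)_{ij}=v_iw_j$, $\tau^{\mathrm d}=\tau-\frac1n\mathrm{tr}(\tau)\mathbb I$, $\mathbf{div}$ is the row-wise divergence, $\|\tau\|_{\mathbf{div},\Omega}^2=\|\tau\|_{0,\Omega}^2+\|\mathbf{div}\,\tau\|_{0,\Omega}^2$. Spaces. $\mathbb L^2_{\mathrm{tr}}(\Omega)=\{r\in[L^2(\Omega)]^{n\times n}: r^{\mathrm t}=r,\ \mathrm{tr}\,r=0\}$; $\mathbb H_0(\mathbf{div};\Omega)=\{\tau\in[L^2(\Omega)]^{n\times n}:\mathbf{div}\,\tau\in[L^2(\Omega)]^n,\ \int_\Omega\mathrm{tr}\,\tau=0\}$; $\mathbf H_0^1(\Omega)=[H_0^1(\Omega)]^n$; $\mathbf H^1_{\Gamma_D}(\Omega)=\{\psi\in[H^1(\Omega)]^n:\psi|_{\Gamma_D}=0\}$;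 $\mathbb H=\mathbb L^2_{\mathrm{tr}}(\Omega)\times\mathbb H_0(\mathbf{div};\Omega)\times\mathbf H^1_0(\Omega)$ with $\|(r,\tau,v)\|_{\mathbb H}^2=\|r\|_{0,\Omega}^2+\|\tau\|_{\mathbf{div},\Omega}^2+\|v\|_{1,\Omega}^2$; $\mathbf H=\mathbf H_0^1(\Omega)\times[H^1(\Omega)]^n$ with $\|(w,\phi)\|_{\mathbf H}=\|w\|_{1,\Omega}+\|\phi\|_{1,\Omega}$. Data. $\gamma>0$; constant vectors $\alpha,g\in\mathbb R^n$; a diagonal $\mathbb K\in[L^\infty(\Omega)]^{n\times n}$ with $(\mathbb Kx)\cdot x\ge k_0|x|^2$ for all $x\in\mathbb R^n$, $k_0>0$; $\nu:\mathbb R^2\to\mathbb R$ with $0<\nu_1\le\nu\le\nu_2$ and Lipschitz with constant $L_\nu$, where $\nu(\phi):=\nu(\phi_1,\phi_2)$ for a vector function $\phi$; $\varphi_D\in[H^{1/2}(\Gamma_D)]^n$, with $\|\varphi_D\|_{1/2,\Gamma_D}=\inf\{\|\chi\|_{1,\Omega}:\chi\in[H^1(\Omega)]^n,\chi|_{\Gamma_D}=\varphi_D\}$. Forms. For $\phi\in[H^1(\Omega)]^n$, $w\in\mathbf H_0^1(\Omega)$, $\vec\xi=(t,\sigma,u)$, $\vec\eta=(r,\tau,v)$ in $\mathbb H$: $$\begin{aligned}\mathbf A_\phi(\vec\xi,\vec\eta)=&\,2\int_\Omega\nu(\phi)t:\{r-\kappa_3\tau^{\mathrm d}\}+\int_\Omega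 t:\{\tau^{\mathrm d}-\kappa_1e(v)\}-\int_\Omega\sigma^{\mathrm d}:\{r-\kappa_3\tau^{\mathrm d}\}+(1-\kappa_2\gamma)\int_\Omega u\cdot\mathbf{div}\,\tau\\&-\int_\Omega v\cdot\mathbf{div}\,\sigma+\int_\Omega\omega(u):\tau-\int_\Omega\sigma:\omega(v)+\gamma\int_\Omega u\cdot v+\kappa_2\int_\Omega\mathbf{div}\,\sigma\cdot\mathbf{div}\,\tau+\kappa_1\int_\Omega e(u):e(v),\end{aligned}$$ $\mathbf B_w(\vec\xi,\vec\eta)=\int_\Omega(u\otimes w)^{\mathrm d}:\{\kappa_3\tau^{\mathrm d}-r\}$, $F_\phi(\vec\eta)=\int_\Omega(\alpha\cdot\phi)\,g\cdot\{v-\kappa_2\mathbf{div}\,\tau\}$, $\mathbf C(\chi,\psi)=\int_\Omega\mathbb K\nabla\chi:\nabla\psi$, $G_{w,\phi}(\psi)=-\int_\Omega(\nabla\phi)w\cdot\psi$. Parameter conditions. $\delta_1\in(0,1/\nu_2)$, $\delta_2\in(0,2/\gamma)$, $\delta_3\in(0,1)$, $\kappa_3\in(0,2\nu_1\delta_1/\nu_2)$, $\kappa_2\in(0,2\delta_2)$, $\kappa_1\in\big(0,2\delta_3(2\nu_1-\kappa_3\nu_2/\delta_1)\big)$. Constants. $c_1(\Omega)=\|i\|^2$ with $i:[H^1(\Omega)]^n\to[L^4(\Omega)]^n$ the Sobolev embedding; $\alpha(\Omega)>0$ is a constant with $\mathbf A_\phi(\vec\xi,\vec\xi)\ge\alpha(\Omega)\|\vec\xi\|_{\mathbb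 H}^2$ for all $\vec\xi\in\mathbb H$ and $\phi\in[H^1(\Omega)]^n$ (it exists under the parameter conditions); $r_0=\alpha(\Omega)/(2c_1(\Omega)(2+\kappa_3^2)^{1/2})$; $C_{\mathcal A}=2\sqrt2(2+\kappa_2^2)^{1/2}/\alpha(\Omega)$; $c_{\rm gp}$ is the Poincaré constant, $\|\psi\|_{1,\Omega}\le c_{\rm gp}|\psi|_{1,\Omega}$ on $\mathbf H^1_{\Gamma_D}(\Omega)$; $\widetilde\alpha=k_0c_{\rm gp}^{-2}$; $C_{\mathcal B}=\max\{\widetilde\alpha^{-1}c_1(\Omega),\widetilde\alpha^{-1}\|\mathbb K\|_{\infty,\Omega}+1\}$; $L_{\mathcal B}=r\,c_1(\Omega)/\widetilde\alpha$. For $(w,\phi)\in\mathbf H$ with $\|w\|_{1,\Omega}<r_0$, $\mathcal A(w,\phi)\in\mathbb H$ denotes the unique $\vec\xi$ with $\mathbf A_\phi(\vec\xi,\vec\eta)+\mathbf B_w(\vec\xi,\vec\eta)=F_\phi(\vec\eta)$ for all $\vec\eta\in\mathbb H$. Regularity assumption. For some $\varepsilon\in(0,1)$ if $n=2$, or $\varepsilon\in[\frac12,1)$ if $n=3$, every $(w,\phi)\in\mathbf H$ with $\|w\|_{1,\Omega}+\|\phi\|_{1,\Omega}\le r$ is such that $(\bar r,\bar\tau,\bar v)=\mathcal A(w,\phi)$ satisfies $\bar r,\bar\tau\in[H^\varepsilon(\Omega)]^{n\times n}$, $\bar v\in[H^{1+\varepsilon}(\Omega)]^n$ and $\|\bar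 r\|_{\varepsilon,\Omega}+\|\bar\tau\|_{\varepsilon,\Omega}+\|\bar v\|_{1+\varepsilon,\Omega}\le\widehat C(r)|\alpha||g|\|\phi\|_{0,\Omega}$, with $\widehat C(r)>0$ independent of $(w,\phi)$. $C_\varepsilon$ is the norm of the embedding $H^\varepsilon(\Omega)\to L^{2p}(\Omega)$ (for tensors), $2p=2/(1-\varepsilon)$ if $n=2$, $2p=6/(3-2\varepsilon)$ if $n=3$; $\widetilde C_\varepsilon$ is the norm of $[H^1(\Omega)]^n\to[L^{n/\varepsilon}(\Omega)]^n$; $$L_{\mathcal A}=\tfrac{2}{\alpha(\Omega)}\max\{c_1(\Omega)(2+\kappa_3^2)^{1/2},\,2L_\nu(2+\kappa_3^2)^{1/2}C_\varepsilon,\,\sqrt2(2+\kappa_2^2)^{1/2}\},$$ $$L_{\mathrm{Lip}}=r\,C_{\mathcal A}(1+L_{\mathcal B})L_{\mathcal A}|\alpha||g|+(1+L_{\mathcal B})L_{\mathcal A}|\alpha||g|\,(r\,\widetilde C_\varepsilon\widehat C(r)+1)+L_{\mathcal B}.$$ *)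

(* Defs.v *)
From HB Require Import structures.
From mathcomp Require Import all_boot all_order all_algebra.
From mathcomp Require Import all_classical all_reals all_analysis.
From mathcomp Require Import ess_sup_inf.

Set Implicit Arguments.
Unset Strict Implicit.
Unset Printing Implicit Defensive.
Import Order.TTheory GRing.Theory Num.Theory.
Import numFieldNormedType.Exports.

Local Open Scope classical_set_scope.
Local Open Scope ring_scope.

(** Points of R^n and vectors are row vectors; 'M[R]_n is used for tensors.
    Fields are total functions on R^n, only their values on the relevant
    domain matter. *)

Definition vfield (R : realType) n := 'rV[R]_n -> 'rV[R]_n.
Definition tfield (R : realType) n := 'rV[R]_n -> 'M[R]_n.

Definition vdot (R : realType) n (x y : 'rV[R]_n) : R :=
  \sum_i x ord0 i * y ord0 i.

Definition tdot (R : realType) n (A B : 'M[R]_n) : R :=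
  \sum_i \sum_j A i j * B i j.

(* The norm of 'rV[R]_n provided by the library is the maximum norm. *)
Definition enorm (R : realType) n (x : 'rV[R]_n) : R := Num.sqrt (vdot x x).

Definition fnorm (R : realType) n (A : 'M[R]_n) : R := Num.sqrt (tdot A A).

Definition dev (R : realType) n (A : 'M[R]_n) : 'M[R]_n :=
  A - (\tr A / n%:R)%:M.

Definition tsym (R : realType) n (A : 'M[R]_n) : 'M[R]_n :=
  2^-1 *: (A + A^T).

Definition tskew (R : realType) n (A : 'M[R]_n) : 'M[R]_n :=
  2^-1 *: (A - A^T).

Definition otimes (R : realType) n (v w : 'rV[R]_n) : 'M[R]_n := v^T *m w.

(* The matrix-vector product A w, as a row vector. *)
Definition mxapp (R : realType) n (A : 'M[R]_n) (w : 'rV[R]_n) : 'rV[R]_n :=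
  w *m A^T.

(* k-th component, counted from 0 (junk value 0 when n <= k). *)
Definition vcomp (R : realType) n (k : nat) (x : 'rV[R]_n) : R :=
  if insub k is Some i then x ord0 i else 0.

(** Lebesgue measure on R^n and Hausdorff measure are obtained from a weight on
    arbitrary subsets by countable covers: over [g_sigma_algebraType setT] every
    subset is measurable, so that [mu_ext] ranges over all covers.  The measures
    live on the Caratheodory sigma-algebras. *)

Section CoverOuterMeasure.
Context (R : realType) (T : pointedType).
Local Open Scope ereal_scope.

Definition cover_outer (w : set T -> \bar R) (A : set T) : \bar R :=
  @mu_ext _ (g_sigma_algebraType [set: set T]) R w A.

Context (w : set T -> \bar R).
Hypotheses (w0 : w set0 = 0) (w_ge0 : forall A, 0 <= w A).

Lemma cover_outer0 : cover_outer w set0 = 0.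
Proof. exact: (@mu_ext0 _ (g_sigma_algebraType _)). Qed.

Lemma cover_outer_ge0 A : 0 <= cover_outer w A.
Proof. exact: (@mu_ext_ge0 _ (g_sigma_algebraType _)). Qed.

Lemma le_cover_outer : {homo cover_outer w : A B / A `<=` B >-> A <= B}.
Proof. exact: (@le_mu_ext _ (g_sigma_algebraType _)). Qed.

Lemma cover_outer_sigma_subadditive : sigma_subadditive (cover_outer w).
Proof. exact: (@mu_ext_sigma_subadditive _ (g_sigma_algebraType _)). Qed.

End CoverOuterMeasure.

(* The least volume of a box containing U.  Setting the weight of set0 apart is
   only needed for n = 0. *)
Definition box_weight (R : realType) n (U : set 'rV[R]_n) : \bar R :=
  if `[< U = set0 >] then 0%E else
  ereal_inf [set v | exists a b : 'rV[R]_n,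
    [/\ forall i, a ord0 i <= b ord0 i,
        U `<=` [set x | forall i, a ord0 i <= x ord0 i <= b ord0 i] &
        v = (\prod_i (b ord0 i - a ord0 i))%:E]].

Lemma box_weight0 (R : realType) n : box_weight (set0 : set 'rV[R]_n) = 0%E.
Proof. by rewrite /box_weight; case: asboolP. Qed.

Lemma box_weight_ge0 (R : realType) n (U : set 'rV[R]_n) :
  (0 <= box_weight U)%E.
Proof.
rewrite /box_weight; case: ifP => // _; apply: le_ereal_inf_tmp.
move=> _ [a [b [ab _ ->]]]; rewrite lee_fin; apply: prodr_ge0 => i _.
by rewrite subr_ge0.
Qed.

Definition lebesgue_outer (R : realType) n : set 'rV[R]_n -> \bar R :=
  cover_outer (@box_weight R n).

HB.instance Definition _ (R : realType) n :=
  isOuterMeasure.Build R 'rV[R]_n (@lebesgue_outer R n)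
    (cover_outer0 (@box_weight0 R n) (@box_weight_ge0 R n))
    (cover_outer_ge0 (@box_weight_ge0 R n))
    (@le_cover_outer R 'rV[R]_n (@box_weight R n))
    (cover_outer_sigma_subadditive (@box_weight_ge0 R n)).

Definition leb_om (R : realType) n
  : {outer_measure set 'rV[R]_n -> \bar R} := @lebesgue_outer R n.

Definition lebR (R : realType) n
  : {measure set (caratheodory_type (leb_om R n)) -> \bar R} := leb_om R n.

Definition diam (R : realType) n (U : set 'rV[R]_n) : \bar R :=
  ereal_sup [set d | exists x y, [/\ U x, U y & d = (enorm (x - y))%:E]].

Definition diam_weight (R : realType) n (s : nat) (delta : R)
    (U : set 'rV[R]_n) : \bar R :=
  if `[< U = set0 >] then 0%E else
  if (diam U <= delta%:E)%E then (diam U ^+ s)%E else +oo%E.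

Lemma diam_weight0 (R : realType) n s (delta : R) :
  diam_weight s delta (set0 : set 'rV[R]_n) = 0%E.
Proof. by rewrite /diam_weight; case: asboolP. Qed.

Lemma diam_weight_ge0 (R : realType) n s (delta : R) (U : set 'rV[R]_n) :
  (0 <= diam_weight s delta U)%E.
Proof.
rewrite /diam_weight; case: asboolP => // /eqP/set0P[x Ux].
case: ifP => // _; apply: expe_ge0; apply: (@le_trans _ _ (enorm (x - x))%:E).
  by rewrite lee_fin sqrtr_ge0.
by apply: ereal_sup_ubound; exists x, x.
Qed.

(* s-dimensional Hausdorff measure, without a normalising constant: it is used
   only for null sets and for convergence in L^2, which do not depend on it. *)
Definition hausdorff_outer (R : realType) n (s : nat) (A : set 'rV[R]_n)
    : \bar R :=
  ereal_sup [set cover_outer (diam_weight s delta) A | delta in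
               [set delta : R | 0 < delta]].

Section HausdorffOuter.
Context (R : realType) (n s : nat).
Local Open Scope ereal_scope.
Local Notation H := (@hausdorff_outer R n s).

Let w0 delta := @diam_weight0 R n s delta.
Let wge0 delta := @diam_weight_ge0 R n s delta.

Lemma hausdorff_outer0 : H set0 = 0.
Proof.
apply/eqP; rewrite eq_le; apply/andP; split.
  apply: ge_ereal_sup => _ [d _ <-].
  by rewrite (cover_outer0 (w0 d) (@wge0 d)).
apply: (@le_trans _ _ (cover_outer (@diam_weight R n s 1%R) set0)).
  exact: (cover_outer_ge0 (@wge0 _)).
by apply: ereal_sup_ubound; exists 1%R => //=.
Qed.

Lemma hausdorff_outer_ge0 A : 0 <= H A.
Proof.
apply: (@le_trans _ _ (cover_outer (@diam_weight R n s 1%R) A)).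
  exact: (cover_outer_ge0 (@wge0 _)).
by apply: ereal_sup_ubound; exists 1%R => //=.
Qed.

Lemma le_hausdorff_outer : {homo H : A B / A `<=` B >-> A <= B}.
Proof.
move=> A B AB; apply: ge_ereal_sup => _ [d d0 <-].
apply: (@le_trans _ _ (cover_outer (@diam_weight R n s d) B)).
  exact: le_cover_outer.
by apply: ereal_sup_ubound; exists d.
Qed.

Lemma hausdorff_outer_sigma_subadditive : sigma_subadditive H.
Proof.
move=> F; apply: ge_ereal_sup => _ [d d0 <-].
apply: (le_trans (cover_outer_sigma_subadditive (@wge0 d) F)).
apply: lee_nneseries => [k _ _|k _]; first exact: (cover_outer_ge0 (@wge0 _)).
by apply: ereal_sup_ubound; exists d.
Qed.

HB.instance Definition _ := isOuterMeasure.Build R 'rV[R]_n H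
  hausdorff_outer0 hausdorff_outer_ge0 le_hausdorff_outer
  hausdorff_outer_sigma_subadditive.

End HausdorffOuter.

Definition haus_om (R : realType) n (s : nat)
  : {outer_measure set 'rV[R]_n -> \bar R} := @hausdorff_outer R n s.

Definition hausR (R : realType) n (s : nat)
  : {measure set (caratheodory_type (haus_om R n s)) -> \bar R} :=
  haus_om R n s.

Definition intO (R : realType) n (Omega : set 'rV[R]_n) (f : 'rV[R]_n -> R)
    : R :=
  \int[@lebR R n]_(x in Omega) f x.

Definition eintO (R : realType) n (Omega : set 'rV[R]_n)
    (f : 'rV[R]_n -> \bar R) : \bar R :=
  (\int[@lebR R n]_(x in Omega) f x)%E.

Definition aeO (R : realType) n (Omega : set 'rV[R]_n) (P : 'rV[R]_n -> Prop)
    : Prop :=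
  {ae @lebR R n, forall x, Omega x -> P x}.

Definition sq_integrable d (T : measurableType d) (R : realType)
    (mu : {measure set T -> \bar R}) (D : set T) (f : T -> R) : Prop :=
  measurable_fun D f /\ mu.-integrable D (fun x => (f x ^+ 2)%:E).

Definition L2v (R : realType) n (Omega : set 'rV[R]_n) (u : vfield R n) :=
  forall i, sq_integrable (@lebR R n) Omega (fun x => u x ord0 i).

Definition L2t (R : realType) n (Omega : set 'rV[R]_n) (A : tfield R n) :=
  forall i j, sq_integrable (@lebR R n) Omega (fun x => A x i j).

Definition Linft (R : realType) n (Omega : set 'rV[R]_n) (A : tfield R n) :=
  (forall i j, measurable_fun
     (Omega : set (caratheodory_type (leb_om R n)))
     (fun x => A x i j)) /\
  exists M : R, aeO Omega (fun x => `|A x| <= M).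

(* Here `|A x| is the largest modulus of an entry; for a diagonal matrix this is
   its Euclidean operator norm. *)
Definition normInf (R : realType) n (Omega : set 'rV[R]_n) (A : tfield R n)
    : R :=
  fine (ess_sup (@lebR R n) ((fun x => (`|A x|)%:E) \_ Omega)).

Definition norm0v (R : realType) n (Omega : set 'rV[R]_n) (u : vfield R n) :=
  Num.sqrt (intO Omega (fun x => vdot (u x) (u x))).

Definition norm0t (R : realType) n (Omega : set 'rV[R]_n) (A : tfield R n) :=
  Num.sqrt (intO Omega (fun x => tdot (A x) (A x))).

Definition normLpv (R : realType) n (Omega : set 'rV[R]_n) (p : R)
    (u : vfield R n) : \bar R :=
  (eintO Omega (fun x => (enorm (u x) `^ p)%:E) `^ p^-1)%E.

Definition normLpt (R : realType) n (Omega : set 'rV[R]_n) (p : R)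
    (A : tfield R n) : \bar R :=
  (eintO Omega (fun x => (fnorm (A x) `^ p)%:E) `^ p^-1)%E.

Definition pderiv (R : realType) n (j : 'I_n) (f : 'rV[R]_n -> R)
    : 'rV[R]_n -> R :=
  fun x => 'D_(delta_mx ord0 j) f x.

Definition pderivs (R : realType) n (s : seq 'I_n) (f : 'rV[R]_n -> R) :=
  foldr (@pderiv R n) f s.

Definition smooth (R : realType) n (f : 'rV[R]_n -> R) : Prop :=
  forall s : seq 'I_n, continuous (pderivs s f) /\
    forall j x, derivable (pderivs s f) x (delta_mx ord0 j).

Definition test_function (R : realType) n (Omega : set 'rV[R]_n)
    (f : 'rV[R]_n -> R) : Prop :=
  [/\ smooth f, compact (closure [set x | f x != 0]) &
      closure [set x | f x != 0] `<=` Omega].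

Definition cgrad (R : realType) n (u : vfield R n) : tfield R n :=
  fun x => \matrix_(i, j) pderiv j (fun y => u y ord0 i) x.

(* (weak gradient)_ij is the weak derivative of u_i with respect to x_j *)
Definition weak_grad (R : realType) n (Omega : set 'rV[R]_n)
    (u : vfield R n) (G : tfield R n) : Prop :=
  forall (f : 'rV[R]_n -> R) (i j : 'I_n), test_function Omega f ->
    intO Omega (fun x => u x ord0 i * pderiv j f x) =
    - intO Omega (fun x => G x i j * f x).

Definition weak_div (R : realType) n (Omega : set 'rV[R]_n)
    (A : tfield R n) (d : vfield R n) : Prop :=
  forall (f : 'rV[R]_n -> R) (i : 'I_n), test_function Omega f ->
    intO Omega (fun x => \sum_j A x i j * pderiv j f x) =
    - intO Omega (fun x => d x ord0 i * f x).

(** An element of a Sobolev space is a function bundled with its weak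
    derivative, which is determined by the function almost everywhere. *)

(* [H^1(Omega)]^n *)
Record H1 (R : realType) n (Omega : set 'rV[R]_n) := {
  h1_fun :> 'rV[R]_n -> 'rV[R]_n;
  grad : tfield R n;
  h1_L2 : L2v Omega h1_fun;
  grad_L2 : L2t Omega grad;
  gradP : weak_grad Omega h1_fun grad }.

Definition semi1 (R : realType) n (Omega : set 'rV[R]_n) (u : H1 Omega) : R :=
  norm0t Omega (grad u).

Definition norm1 (R : realType) n (Omega : set 'rV[R]_n) (u : H1 Omega) : R :=
  Num.sqrt (norm0v Omega u ^+ 2 + semi1 u ^+ 2).

(* squared H^1(Omega) distance from u to a classically differentiable field *)
Definition dist1sq (R : realType) n (Omega : set 'rV[R]_n) (u : H1 Omega)
    (f : vfield R n) : \bar R :=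
  (eintO Omega (fun x => (vdot (u x - f x) (u x - f x))%:E) +
   eintO Omega (fun x => (tdot (grad u x - cgrad f x)
                               (grad u x - cgrad f x))%:E))%E.

(* [H^1_0(Omega)]^n is the closure of the test functions in [H^1(Omega)]^n *)
Definition inH10 (R : realType) n (Omega : set 'rV[R]_n) (u : H1 Omega) : Prop :=
  exists f : nat -> vfield R n,
    (forall k i, test_function Omega (fun x => f k x ord0 i)) /\
    dist1sq u (f k) @[k --> \oo] --> 0%E.

(* psi has the trace g on Gamma, a part of the boundary of Omega: both are limits
   (in H^1(Omega), resp. in L^2(Gamma)) of the same sequence of functions that
   are smooth up to the boundary. *)
Definition has_trace (R : realType) n (Omega Gamma : set 'rV[R]_n)
    (psi : H1 Omega) (g : vfield R n) : Prop :=
  (forall i, sq_integrable (@hausR R n n.-1) Gamma (fun x => g x ord0 i)) /\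
  exists f : nat -> vfield R n,
    [/\ forall k i, smooth (fun x => f k x ord0 i),
        dist1sq psi (f k) @[k --> \oo] --> 0%E &
        (\int[@hausR R n n.-1]_(x in Gamma)
           (vdot (g x - f k x) (g x - f k x))%:E)%E @[k --> \oo] --> 0%E].

(* psi is in H^1_{Gamma_D}(Omega) when inH1D GammaD psi *)
Definition inH1D (R : realType) n (Omega GammaD : set 'rV[R]_n)
    (psi : H1 Omega) : Prop :=
  has_trace GammaD psi (fun=> 0).

(* g is in [H^{1/2}(Gamma)]^n: the restrictions to Gamma of traces *)
Definition inHhalf (R : realType) n (Omega Gamma : set 'rV[R]_n)
    (g : vfield R n) : Prop :=
  exists psi : H1 Omega, has_trace Gamma psi g.

Definition normHhalf (R : realType) n (Omega Gamma : set 'rV[R]_n)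
    (g : vfield R n) : R :=
  inf [set norm1 psi | psi in [set psi : H1 Omega | has_trace Gamma psi g]].

Record Hdiv0 (R : realType) n (Omega : set 'rV[R]_n) := {
  hd_fun :> 'rV[R]_n -> 'M[R]_n;
  hdiv : vfield R n;
  hd_L2 : L2t Omega hd_fun;
  hdiv_L2 : L2v Omega hdiv;
  hdivP : weak_div Omega hd_fun hdiv;
  hd_tr : intO Omega (fun x => \tr (hd_fun x)) = 0 }.

Record L2tr (R : realType) n (Omega : set 'rV[R]_n) := {
  l2_fun :> 'rV[R]_n -> 'M[R]_n;
  l2_L2 : L2t Omega l2_fun;
  l2_sym : aeO Omega (fun x => (l2_fun x)^T = l2_fun x);
  l2_tr : aeO Omega (fun x => \tr (l2_fun x) = 0) }.

(* the product space of the triples (t, sigma, u) *)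
Record HH (R : realType) n (Omega : set 'rV[R]_n) := {
  ht : L2tr Omega;
  hs : Hdiv0 Omega;
  hu : H1 Omega;
  hu0 : inH10 hu }.

Definition normHH (R : realType) n (Omega : set 'rV[R]_n) (xi : HH Omega) : R :=
  Num.sqrt (norm0t Omega (ht xi) ^+ 2 +
            (norm0t Omega (hs xi) ^+ 2 + norm0v Omega (hdiv (hs xi)) ^+ 2) +
            norm1 (hu xi) ^+ 2).

(* squared Sobolev-Slobodeckij seminorm of order s, 0 < s < 1; the value of the
   integrand on the diagonal is 0 / 0 = 0 *)
Definition slobt (R : realType) n (Omega : set 'rV[R]_n) (s : R)
    (A : tfield R n) : \bar R :=
  eintO Omega (fun x => eintO Omega (fun y =>
    (fnorm (A x - A y) ^+ 2 / enorm (x - y) `^ (n%:R + 2 * s))%:E)).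

(* H^s(Omega) norm of an L^2 tensor field; it is +oo outside H^s(Omega) *)
Definition normst (R : realType) n (Omega : set 'rV[R]_n) (s : R)
    (A : tfield R n) : \bar R :=
  (((norm0t Omega A ^+ 2)%:E + slobt Omega s A) `^ 2^-1)%E.

Definition norm1s (R : realType) n (Omega : set 'rV[R]_n) (s : R)
    (u : H1 Omega) : \bar R :=
  (((norm1 u ^+ 2)%:E + slobt Omega s (grad u)) `^ 2^-1)%E.

(* c is the (finite) operator norm of the inclusion of {x | D x}, normed by NX,
   into the space normed by NY *)
Definition embedding_norm (R : realType) (X : Type) (D : set X)
    (NX NY : X -> \bar R) (c : R) : Prop :=
  [/\ 0 <= c,
      forall x, D x -> (NY x <= c%:E * NX x)%E &
      forall c' : R, 0 <= c' ->
        (forall x, D x -> (NY x <= c'%:E * NX x)%E) -> c <= c'].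

Definition convex_hull (R : realType) n (s : seq 'rV[R]_n) : set 'rV[R]_n :=
  [set x | exists a : 'I_(size s) -> R,
    [/\ forall i, 0 <= a i, \sum_i a i = 1 & x = \sum_i a i *: s`_i]].

Definition flat (R : realType) n (s : seq 'rV[R]_n) : Prop :=
  exists (v : 'rV[R]_n) (c : R), v != 0 /\ forall x, x \in s -> vdot v x = c.

Definition bdry (R : realType) n (Omega : set 'rV[R]_n) : set 'rV[R]_n :=
  closure Omega `\` Omega°.

Definition polyhedral (R : realType) n (Gamma : set 'rV[R]_n) : Prop :=
  exists faces : seq (seq 'rV[R]_n),
    (forall s, s \in faces -> flat s) /\
    Gamma = [set x | exists2 s, s \in faces & convex_hull s x].

Definition polyhedral_domain (R : realType) n (Omega : set 'rV[R]_n) : Prop :=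
  [/\ open Omega, connected Omega, Omega !=set0, bounded_set Omega &
      polyhedral (bdry Omega)].

Section Forms.
Context (R : realType) (n : nat) (Omega : set 'rV[R]_n).
Implicit Types (xi eta : HH Omega) (w phi psi chi : H1 Omega).

Definition visc (nu : R -> R -> R) (phi : vfield R n) (x : 'rV[R]_n) : R :=
  nu (vcomp 0 (phi x)) (vcomp 1 (phi x)).

Definition formA (nu : R -> R -> R) (gamma k1 k2 k3 : R) phi xi eta : R :=
  let t := ht xi in let sigma := hs xi in let u := hu xi in
  let r := ht eta in let tau := hs eta in let v := hu eta in
  2 * intO Omega (fun x =>
        visc nu phi x * tdot (t x) (r x - k3 *: dev (tau x)))
  + intO Omega (fun x => tdot (t x) (dev (tau x) - k1 *: tsym (grad v x)))
  - intO Omega (fun x => tdot (dev (sigma x)) (r x - k3 *: dev (tau x)))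
  + (1 - k2 * gamma) * intO Omega (fun x => vdot (u x) (hdiv tau x))
  - intO Omega (fun x => vdot (v x) (hdiv sigma x))
  + intO Omega (fun x => tdot (tskew (grad u x)) (tau x))
  - intO Omega (fun x => tdot (sigma x) (tskew (grad v x)))
  + gamma * intO Omega (fun x => vdot (u x) (v x))
  + k2 * intO Omega (fun x => vdot (hdiv sigma x) (hdiv tau x))
  + k1 * intO Omega (fun x => tdot (tsym (grad u x)) (tsym (grad v x))).

Definition formB (k3 : R) w xi eta : R :=
  intO Omega (fun x => tdot (dev (otimes (hu xi x) (w x)))
                            (k3 *: dev (hs eta x) - ht eta x)).

Definition funF (alpha g : 'rV[R]_n) (k2 : R) phi eta : R :=
  intO Omega (fun x => vdot alpha (phi x) *
                       vdot g (hu eta x - k2 *: hdiv (hs eta) x)).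

Definition formC (K : tfield R n) chi psi : R :=
  intO Omega (fun x => tdot (K x *m grad chi x) (grad psi x)).

Definition funG w phi psi : R :=
  - intO Omega (fun x => vdot (mxapp (grad phi x) (w x)) (psi x)).

(* xi = A(w, phi) *)
Definition flow_sol (nu : R -> R -> R) (gamma k1 k2 k3 : R)
    (alpha g : 'rV[R]_n) w phi xi : Prop :=
  forall eta, formA nu gamma k1 k2 k3 phi xi eta + formB k3 w xi eta =
              funF alpha g k2 phi eta.

Definition coupled_sol (nu : R -> R -> R) (gamma k1 k2 k3 : R)
    (alpha g : 'rV[R]_n) (K : tfield R n) (GammaD : set 'rV[R]_n)
    (phiD : vfield R n) xi phi : Prop :=
  [/\ has_trace GammaD phi phiD,
      flow_sol nu gamma k1 k2 k3 alpha g (hu xi) phi xi &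
      forall psi, inH1D GammaD psi -> formC K phi psi = funG (hu xi) phi psi].

End Forms.

(* Main.v *)
Require Import Defs.
From HB Require Import structures.
From mathcomp Require Import all_boot all_order all_algebra.
From mathcomp Require Import all_classical all_reals all_analysis.
From mathcomp Require Import measurable_realfun ess_sup_inf hoelder ring lra.

Set Implicit Arguments.
Unset Strict Implicit.
Unset Printing Implicit Defensive.
Import Order.TTheory GRing.Theory Num.Theory.
Import numFieldNormedType.Exports.

Local Open Scope classical_set_scope.
Local Open Scope ring_scope.

(** The flow problem with frozen [(w, phi)], [norm1 w <= r < r0], is coercive with
    constant [alphaO / 2], because [formB] is bounded by [c1 sqrt(2 + k3^2) norm1 w];
    the heat problem with a frozen convective term is coercive on the fields with
    zero trace on [GammaD], by Poincare's inequality.  Lax-Milgram solves both, and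
    [(w, phi) |-> (u, heat u phi)], with [u] the velocity of the flow solution, maps
    the ball [W_r] into itself by the first data hypothesis.  It is a contraction
    with factor [LLip]: in the difference of two flow problems, the term
    [(nu(phi) - nu(phi')) t] is controlled by Hoelder's inequality with exponents
    [p/2] and [q/2], which is where the regularity assumption enters.  Banach's
    theorem gives the solution.

    Elements of the spaces are representatives, so everything is done with
    pseudo-metrics, and equality is recovered almost everywhere at the end. *)

(** The heat step evaluates convection at the old temperature: [heat w phi phi1] only inverts
    [formC], which is coercive without any smallness of [w]. Pairs are compared by the sum of the
    two [H^1] distances. If [A1], [A2] are the Lipschitz constants of the flow in [w] and in [phi],
    and [LB] that of the heat problem, one step multiplies the two distances by at most
    [(1 + LB) A1] and [(1 + LB) A2 + LB]; [LLip] is the sum of these two numbers, so it dominates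
    both.

    Testing the difference of two flow problems with the difference of their solutions leaves a
    viscous term with the second solution [t'] only. There [nu(phi) - nu(phi')] is small merely in
    [L^q], so an [L^2] bound on [t'] does not suffice, whereas the [L^p] bound given by the
    regularity assumption does.

    Two obstacles lie below this argument. The measures come from outer measures, so measurability
    of smooth functions has to be obtained by showing that half-spaces satisfy the Caratheodory
    condition, which for the Hausdorff measure needs a genuine argument. And the constraints
    defining the spaces must be shown to survive limits, so that completeness reduces to that of
    scalar [L^2]. *)

Lemma le_of_eq (d : Order.disp_t) (T : porderType d) (x y : T) :
  x = y -> (x <= y)%O.
Proof. by move->. Qed.

(** * Cauchy sequences and contractions for a pseudo-metric *)

Section PseudoMetric.
Context (R : realType) (X : Type) (d : X -> X -> R).
Hypotheses (d_ge0 : forall x y, 0 <= d x y) (dC : forall x y, d x y = d y x)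
  (d_tri : forall x y z, d x z <= d x y + d y z).

Definition cauchy_for (u : nat -> X) :=
  forall e : R, 0 < e ->
    exists N, forall m k, (N <= m)%N -> (N <= k)%N -> d (u m) (u k) <= e.

Definition complete_for (P : X -> Prop) :=
  forall u : nat -> X, (forall k, P (u k)) -> cauchy_for u ->
    exists2 x, P x & d (u k) x @[k --> \oo] --> 0.

(** The steps sum to a geometric tail. As [d x x = 0] is not assumed, self-distances enter the
    estimate and have to be bounded too. *)
Lemma geom_cauchy (u : nat -> X) (c q : R) : 0 <= q < 1 ->
  (forall k, d (u k) (u k.+1) <= c * q ^+ k) -> cauchy_for u.
Proof.
move=> /andP[q0 q1] uq.
have d0 x : d x x <= 0 -> d x x = 0 by move=> dx; apply/le_anti; rewrite dx d_ge0.
have c0 : 0 <= c by have := uq 0%N; rewrite expr0 mulr1; apply: le_trans.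
have q10 : 0 < 1 - q by rewrite subr_gt0.
have far m j : d (u m) (u (m + j)%N) <= c * q ^+ m * (1 - q)^-1 + d (u m) (u m).
  have H : d (u m) (u (m + j)%N) <=
      c * q ^+ m * ((1 - q ^+ j) / (1 - q)) + d (u m) (u m).
    elim: j => [|j IH]; first by rewrite expr0 subrr mul0r mulr0 add0r addn0.
    rewrite addnS; apply: (le_trans (d_tri _ (u (m + j)%N) _)).
    apply: (le_trans (lerD IH (uq _))); rewrite addrAC lerD2r exprD mulrA -mulrDr.
    rewrite ler_wpM2l ?mulr_ge0 ?exprn_ge0 //.
    rewrite -[X in _ + X <= _](mulfK (lt0r_neq0 q10)) -mulrDl ler_wpM2r ?invr_ge0 ?(ltW q10) //.
    by rewrite exprS; lra.
  apply: (le_trans H); rewrite lerD2r ler_wpM2l ?mulr_ge0 ?exprn_ge0 //.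
  rewrite ler_piMl ?invr_ge0 ?(ltW q10) //.
  by have := exprn_ge0 j q0; lra.
(* Go to the next term and come back. *)
have d00 m : d (u m) (u m) <= 2 * (c * q ^+ m).
  apply: (le_trans (d_tri _ (u m.+1) _)); rewrite (dC (u m.+1)).
  by have := uq m; lra.
(* [C / 2 * q ^ m] bounds the distance from [u m] to any later term; the factor 2 is for comparing
   two terms through [u N]. *)
pose C := (c / (1 - q) + 2 * c) * 2.
have C0 : 0 <= C by rewrite !mulr_ge0 // addr_ge0 // ?divr_ge0 ?mulr_ge0 // ltW.
have key m j : d (u m) (u (m + j)%N) <= C / 2 * q ^+ m.
  apply: (le_trans (far m j)); apply: (le_trans (lerD (lexx _) (d00 m))).
  by rewrite /C mulfK // mulrDl; apply: le_of_eq; ring.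
move=> e e0.
have cv : C * q ^+ n @[n --> \oo] --> 0.
  rewrite -[X in _ --> X](mulr0 C); apply: cvgMr; apply: cvg_expr.
  by rewrite ger0_norm.
have /cvgrPdist_le/(_ _ e0)[N _ HN] := cv.
exists N => m k Nm Nk.
have hN : C * q ^+ N <= e.
  have := HN N (leqnn _); rewrite sub0r normrN ger0_norm //.
  by rewrite mulr_ge0 // exprn_ge0.
have := key N (m - N)%N; have := key N (k - N)%N; rewrite !subnKC // => k1 k2.
apply: (le_trans (d_tri _ (u N) _)); rewrite (dC (u m)).
by lra.
Qed.

Lemma cauchy_fast_subseq (u : nat -> X) : cauchy_for u ->
  exists phi : nat -> nat, (forall k, (k <= phi k)%N) /\
    forall k m, (phi k <= m)%N -> d (u (phi k)) (u m) <= 2^-1 ^+ k.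
Proof.
move=> cu.
have h2 : 0 < 2^-1 :> R by rewrite invr_gt0.
have /choice[f Hf] : forall k, exists N, (k <= N)%N /\
    forall m, (N <= m)%N -> d (u N) (u m) <= 2^-1 ^+ k.
  move=> k; have [N HN] := cu (2^-1 ^+ k) (exprn_gt0 _ h2).
  exists (maxn k N); split; first exact: leq_maxl.
  by move=> m Hm; apply: HN; rewrite ?leq_maxr // (leq_trans _ Hm) // leq_maxr.
by exists f; split => k; [have [] := Hf k | move=> m; have [_] := Hf k; apply].
Qed.

(* A Cauchy sequence converges as soon as its geometrically fast subsequences
   do. *)
Lemma fast_complete (P : X -> Prop) :
  (forall u : nat -> X, (forall k, P (u k)) ->
     (forall k, d (u k) (u k.+1) <= 2^-1 ^+ k) ->
     exists2 x, P x & d (u k) x @[k --> \oo] --> 0) ->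
  complete_for P.
Proof.
move=> H u Pu cu.
have [f [fk Hf]] := cauchy_fast_subseq cu.
(* [f] need not be monotone; its running maximum is. Both [g k] and [g k.+1] lie beyond [f k], so
   their terms are within [2^-k] of [u (f k)]. *)
pose g := fix g k := if k is j.+1 then maxn (f j.+1) (g j) else f 0%N.
have gf k : (f k <= g k)%N by case: k => //= k; exact: leq_maxl.
have gg k : (g k <= g k.+1)%N by exact: leq_maxr.
have near_g k : d (u (g k)) (u (g k.+1)) <= 2 * 2^-1 ^+ k.
  apply: (le_trans (d_tri _ (u (f k)) _)); rewrite (dC (u (g k))).
  have := Hf k (g k) (gf k).
  have := Hf k (g k.+1) (leq_trans (gf k) (gg k)).
  by lra.
(* Shifting the index by one absorbs the factor 2 of [near_g]. *)
have [] := H (fun k => u (g k.+1)) (fun k => Pu _).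
  by move=> k; have := near_g k.+1; rewrite exprS; lra.
move=> x Px cx; exists x => //.
apply/cvgrPdist_le => e e0.
have e20 : 0 < e / 2 by rewrite divr_gt0.
have [N HN] := cu _ e20.
have /cvgrPdist_le/(_ _ e20)[M _ HM] := cx.
near=> k; rewrite sub0r normrN ger0_norm //.
have Nk : (N <= k)%N by near: k; exists N.
have Mk : (M <= k)%N by near: k; exists M.
have hk := HM k Mk; rewrite /= sub0r normrN ger0_norm // in hk.
apply: (le_trans (d_tri _ (u (g k.+1)) _)).
have kg : (N <= g k.+1)%N.
  by rewrite (leq_trans _ (gf _)) // (leq_trans _ (fk _)) // leqW.
by have := HN k (g k.+1) Nk kg; lra.
Unshelve. all: by end_near.
Qed.

(** Picard iteration from [x0]. The limit is fixed only up to distance zero, which is all a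
    pseudo-metric can give. *)
Lemma contraction_fixpoint (P : X -> Prop) (S : X -> X) (q : R) (x0 : X) :
  complete_for P -> P x0 -> (forall x, P x -> P (S x)) -> 0 <= q < 1 ->
  (forall x y, P x -> P y -> d (S x) (S y) <= q * d x y) ->
  exists2 x, P x & d x (S x) = 0.
Proof.
move=> cP Px0 PS qq hS.
pose u k := iter k S x0.
have Pu k : P (u k) by elim: k => //= k IH; exact: PS.
have cu : cauchy_for u.
  apply: (@geom_cauchy _ (d x0 (S x0)) q) => //; elim => [|k IH].
    by rewrite expr0 mulr1.
  apply: (le_trans (hS (u k) (u k.+1) (Pu _) (Pu _))).
  have [q0 _] := andP qq.
  by rewrite exprS mulrCA ler_wpM2l.
have [x Px cx] := cP u Pu cu.
exists x => //; apply/le_anti; rewrite d_ge0 andbT.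
apply/ler_addgt0Pr => e e0; rewrite add0r.
have e20 : 0 < e / 2 by rewrite divr_gt0.
have /cvgrPdist_le/(_ _ e20)[N _ HN] := cx.
have hN k : (N <= k)%N -> d (u k) x <= e / 2.
  by move=> Nk; have := HN k Nk; rewrite /= sub0r normrN ger0_norm.
apply: (le_trans (d_tri _ (u N.+1) _)); rewrite (dC x).
have h1 := hN N.+1 (leqnSn _); have h0 := hN N (leqnn _).
have h2 := hS (u N) x (Pu _) Px.
have h3 : q * d (u N) x <= d (u N) x.
  by rewrite ler_piMl // ltW; case/andP: qq.
have -> : u N.+1 = S (u N) by [].
by rewrite /= in h1 *; lra.
Qed.
End PseudoMetric.

(* [lin a x y] stands for [a x + y].  No module axiom is imposed: all identities
   between elements are only needed after pairing with [ip]. *)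
Record preip (R : realType) (X : Type) := PreIp {
  ip :> X -> X -> R;
  lin : R -> X -> X -> X;
  ipC : forall x y, ip x y = ip y x;
  ip_linl : forall a x y z, ip (lin a x y) z = a * ip x z + ip y z;
  ip_ge0 : forall x, 0 <= ip x x }.

(** * Semi-inner products, Riesz representation and Lax-Milgram *)

Section PreIpTheory.
Context (R : realType) (X : Type) (H : preip R X).
Implicit Types (x y z : X) (a : R).
Local Notation lin := (lin H).

Definition nrm x := Num.sqrt (H x x).
Definition dist x y := nrm (lin (-1) y x).

Lemma ip_linr a x y z : H z (lin a x y) = a * H z x + H z y.
Proof. by rewrite ipC ip_linl !(ipC H _ z). Qed.

Lemma nrm_ge0 x : 0 <= nrm x. Proof. exact: sqrtr_ge0. Qed.

Lemma sqr_nrm x : nrm x ^+ 2 = H x x.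
Proof. by rewrite sqr_sqrtr // ip_ge0. Qed.

Lemma dist_ge0 x y : 0 <= dist x y. Proof. exact: nrm_ge0. Qed.

Lemma distC x y : dist x y = dist y x.
Proof.
by rewrite /dist /nrm !ip_linl !ip_linr (ipC H x y); congr Num.sqrt; ring.
Qed.

Lemma sqr_nrm_lin a x y :
  nrm (lin a x y) ^+ 2 = a ^+ 2 * nrm x ^+ 2 + 2 * a * H x y + nrm y ^+ 2.
Proof. by rewrite !sqr_nrm !ip_linl !ip_linr (ipC H y x); ring. Qed.

(** The polynomial [t |-> nrm (lin t x y) ^+ 2] is nonnegative. Since [ip] is only semidefinite,
    [H x x = 0] does not make [x] zero and is treated apart. *)
Lemma ip_cauchy_schwarz x y : `|H x y| <= nrm x * nrm y.
Proof.
have key (t : R) : 0 <= t ^+ 2 * H x x + 2 * t * H x y + H y y.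
  by rewrite -!sqr_nrm -sqr_nrm_lin sqr_ge0.
rewrite -ler_sqr ?nnegrE ?mulr_ge0 ?nrm_ge0 //.
rewrite exprMn !sqr_nrm real_normK ?num_real //.
have := ip_ge0 H x; rewrite le_eqVlt => /orP[/eqP x0|xx].
  rewrite -x0 mul0r; have [->|xy] := eqVneq (H x y) 0; first by rewrite expr0n.
  (* With [H x x = 0] the polynomial is affine in [t]; at this [t] it would equal [-1]. *)
  have := key (- (H y y + 1) / (2 * H x y)).
  rewrite -x0 mulr0 add0r.
  have -> : 2 * (- (H y y + 1) / (2 * H x y)) * H x y = - (H y y + 1) by field.
  by lra.
(* The minimizer of the quadratic. *)
have := key (- H x y / H x x).
have -> : (- H x y / H x x) ^+ 2 * H x x + 2 * (- H x y / H x x) * H x y + H y y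
   = (H x x * H y y - H x y ^+ 2) / H x x by field; rewrite gt_eqF.
by rewrite pmulr_lge0 ?invr_gt0 // subr_ge0.
Qed.

Lemma nrm_lin a x y : nrm (lin a x y) <= `|a| * nrm x + nrm y.
Proof.
rewrite -ler_sqr ?nnegrE ?addr_ge0 ?mulr_ge0 ?nrm_ge0 //.
rewrite sqr_nrm_lin sqrrD exprMn real_normK ?num_real //.
have : a * H x y <= `|a| * (nrm x * nrm y).
  apply: (le_trans (ler_norm _)); rewrite normrM ler_wpM2l //.
  exact: ip_cauchy_schwarz.
by lra.
Qed.

Lemma dist_tri x y z : dist x z <= dist x y + dist y z.
Proof.
have -> : dist x z = nrm (lin 1 (lin (-1) y x) (lin (-1) z y)).
  rewrite /dist /nrm; congr Num.sqrt; rewrite !ip_linl !ip_linr.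
  by rewrite (ipC H z x) (ipC H y x) (ipC H z y); ring.
by apply: (le_trans (nrm_lin _ _ _)); rewrite normr1 mul1r.
Qed.

Lemma nrm_dist x y : nrm x <= nrm y + dist x y.
Proof.
have -> : nrm x = nrm (lin 1 y (lin (-1) y x)).
  rewrite /nrm; congr Num.sqrt; rewrite !ip_linl !ip_linr.
  by rewrite (ipC H y x); ring.
by apply: (le_trans (nrm_lin _ _ _)); rewrite normr1 mul1r.
Qed.

Lemma dist_ip x y z : H x z - H y z <= dist x y * nrm z.
Proof.
have -> : H x z - H y z = H (lin (-1) y x) z by rewrite ip_linl; ring.
by apply: (le_trans (ler_norm _)); exact: ip_cauchy_schwarz.
Qed.

Definition ip_complete := complete_for dist.

Section Riesz.
Variable P : X -> Prop.
Variable x0 : X.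
Hypotheses (Px0 : P x0) (Plin : forall a x y, P x -> P y -> P (lin a x y))
  (Pc : ip_complete P).
Variables (F : X -> R) (M : R).
Hypotheses (M0 : 0 <= M)
  (Flin : forall a x y, P x -> P y -> F (lin a x y) = a * F x + F y)
  (FM : forall x, P x -> `|F x| <= M * nrm x).

Let J x := nrm x ^+ 2 - 2 * F x.

Let J_lb x : P x -> - M ^+ 2 <= J x.
Proof.
move=> Px; have h := FM Px; have := le_trans (ler_norm _) h.
by have := sqr_ge0 (nrm x - M); rewrite /J sqrrB; lra.
Qed.

(* The representative minimizes [J]; minimizing sequences are Cauchy by the
   parallelogram identity. *)
Lemma riesz_representation : exists2 x, P x & forall y, P y -> H x y = F y.
Proof.
pose E := [set J x | x in P].
have Einf : has_inf E.
  split; first by exists (J x0), x0.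
  by exists (- M ^+ 2) => _ [x Px <-]; exact: J_lb.
pose m := inf E.
have mJ x : P x -> m <= J x.
  by move=> Px; apply: ge_inf; [case: Einf | exists x].
have [eta [eta0 eta_lim]] : exists eta : nat -> R, (forall k, 0 < eta k) /\
    forall e, 0 < e -> exists N, forall k, (N <= k)%N -> eta k < e.
  exists (fun k => k.+1%:R^-1); split => [k|e e0]; first by rewrite invr_gt0.
  by have [N _ HN] := near_infty_natSinv_lt (PosNum e0); exists N.
have /choice[u Hu] : forall k : nat, exists x, P x /\ J x <= m + eta k.
  move=> k; have k0 := eta0 k.
  have [_ [x Px <-] Jx] := inf_adherent k0 Einf.
  by exists x; split => //; exact: ltW.
have Pu k : P (u k) by have [] := Hu k.
have Ju k : J (u k) <= m + eta k by have [] := Hu k.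
have par x y : P x -> P y -> dist x y ^+ 2 <= 2 * (J x - m) + 2 * (J y - m).
  move=> Px Py.
  (* [lin] offers no plain scaling, so the midpoint of [x] and [y] is written [z - z / 2] with
     [z = x + y]. *)
  pose z := lin 1 x y; pose hz := lin (- 2^-1) z z.
  have Pz : P z by exact: Plin.
  have Phz : P hz by exact: Plin.
  have := mJ _ Phz.
  rewrite /J /hz sqr_nrm_lin (Flin _ Pz Pz) -[H z z]sqr_nrm.
  rewrite /z sqr_nrm_lin (Flin _ Px Py).
  rewrite /dist sqr_nrm_lin (ipC H y x) => h.
  by nra.
have cu : cauchy_for dist u.
  move=> e e0.
  have e2 : 0 < e ^+ 2 / 4 by rewrite divr_gt0 // exprn_gt0.
  have [N HN] := eta_lim _ e2.
  exists N => j k Nj Nk.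
  rewrite -ler_sqr ?nnegrE ?dist_ge0 ?(ltW e0) //.
  apply: (le_trans (par _ _ (Pu _) (Pu _))).
  have := HN _ Nj; have := HN _ Nk.
  by have := Ju j; have := Ju k; lra.
have [x Px cx] := Pc Pu cu.
exists x => // y Py.
(* Variation of [J] at the limit [x] in the direction [y]. *)
have Jx t : m <= J x + t ^+ 2 * nrm y ^+ 2 + 2 * t * (H x y - F y).
  have := mJ _ (Plin t Py Px); rewrite /J sqr_nrm_lin (Flin _ Py Px).
  by rewrite (ipC H y x); lra.
have Jxm : J x <= m.
  apply/ler_addgt0Pr => e e0.
  (* A Lipschitz constant of [J] at [x] on the unit ball around it; it carries the infimum from the
     minimizing sequence over to its limit. *)
  pose C := 2 * nrm x + 1 + 2 * M.
  have C0 : 0 < C by rewrite /C; have := nrm_ge0 x; move: M0; lra.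
  have d0 : 0 < Num.min 1 (e / 2 / C) by rewrite lt_min ltr01 !divr_gt0.
  have e2 : 0 < e / 2 by rewrite divr_gt0.
  have /cvgrPdist_le/(_ _ d0)[N1 _ HN1] := cx.
  have [N2 HN2] := eta_lim _ e2.
  pose k := maxn N1 N2.
  have hk1 := HN1 k (leq_maxl _ _); have hk2 := HN2 k (leq_maxr _ _).
  rewrite /= sub0r normrN ger0_norm ?dist_ge0 // le_min in hk1.
  have /andP[hd1 hd2] := hk1.
  have hn : `|F x - F (u k)| <= M * dist (u k) x.
    have -> : F x - F (u k) = F (lin (-1) (u k) x) by rewrite Flin //; ring.
    by rewrite distC; apply: FM; exact: Plin.
  have hnx : nrm x ^+ 2 - nrm (u k) ^+ 2 <= dist (u k) x * (2 * nrm x + 1).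
    have h1 := nrm_dist x (u k); rewrite distC in h1.
    have h2 := nrm_dist (u k) x; have p1 := nrm_ge0 x; have p2 := nrm_ge0 (u k).
    have p3 := dist_ge0 (u k) x.
    have -> : nrm x ^+ 2 - nrm (u k) ^+ 2 = (nrm x - nrm (u k)) * (nrm x + nrm (u k)) by ring.
    apply: (@le_trans _ _ (dist (u k) x * (nrm x + nrm (u k)))).
      by rewrite ler_wpM2r ?addr_ge0 //; lra.
    by rewrite ler_wpM2l //; lra.
  have hJ : J x - J (u k) <= dist (u k) x * C.
    have := le_trans (ler_norm _) (_ : `|F (u k) - F x| <= _).
    by rewrite distrC => /(_ _ hn); rewrite /J /C; lra.
  have hdC : dist (u k) x * C <= e / 2 by rewrite -ler_pdivlMr.
  by have := Ju k; lra.
have key t : 0 <= t ^+ 2 * nrm y ^+ 2 + 2 * t * (H x y - F y) by have := Jx t; lra.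
set c := H x y - F y in key.
apply/eqP; rewrite -subr_eq0 -/c; apply/eqP.
(* The added 1 keeps [s] positive even if [nrm y = 0]; at [t = - c / s] the quadratic is a negative
   multiple of [c ^+ 2]. *)
pose s := nrm y ^+ 2 + 1.
have s0 : 0 < s by have := sqr_ge0 (nrm y); rewrite /s; lra.
have := key (- c / s).
have -> : (- c / s) ^+ 2 * nrm y ^+ 2 + 2 * (- c / s) * c =
   - (c ^+ 2 * (s + 1) / s ^+ 2) by rewrite /s; field; rewrite gt_eqF.
rewrite oppr_ge0 pmulr_lle0 ?invr_gt0 ?exprn_gt0 // pmulr_lle0; last by lra.
by move=> c2; apply/eqP; rewrite -sqrf_eq0 eq_le c2 sqr_ge0.
Qed.

End Riesz.
End PreIpTheory.

Section LaxMilgram.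
Context (R : realType) (X : Type) (H : preip R X).
Local Notation lin := (lin H).
Local Notation nrm := (nrm H).
Local Notation dist := (dist H).
Variable P : X -> Prop.
Variable x0 : X.
Hypotheses (Px0 : P x0) (Plin : forall a x y, P x -> P y -> P (lin a x y))
  (Pc : ip_complete H P).
Variables (a : X -> X -> R) (M c : R).
Hypotheses (M0 : 0 <= M) (c0 : 0 < c)
  (alinl : forall t x y z, P x -> P y -> P z ->
     a (lin t x y) z = t * a x z + a y z)
  (alinr : forall t x y z, P x -> P y -> P z ->
     a z (lin t x y) = t * a z x + a z y)
  (abound : forall x y, P x -> P y -> `|a x y| <= M * nrm x * nrm y)
  (acoercive : forall x, P x -> c * nrm x ^+ 2 <= a x x).
Variables (F : X -> R) (N : R).
Hypotheses (N0 : 0 <= N)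
  (Flin : forall t x y, P x -> P y -> F (lin t x y) = t * F x + F y)
  (FN : forall x, P x -> `|F x| <= N * nrm x).

(* Banach's fixed point theorem for [x |-> x - rho (A x - f)], where [A] and [f]
   represent [a] and [F] and [rho = c / (M^2 + c^2)]. *)
Theorem lax_milgram : exists2 x, P x & forall y, P y -> a x y = F y.
Proof.
have [f Pf Hf] := riesz_representation Px0 Plin Pc N0 Flin FN.
(* Choice requires a value everywhere; outside [P] it is [x] itself. *)
have /choice[A HA] : forall x, exists z, P x -> P z /\
    forall y, P y -> H z y = a x y.
  move=> x; have [Px|nPx] := pselect (P x); last by exists x.
  have := @riesz_representation _ _ H P x0 Px0 Plin Pc (a x) (M * nrm x).
  move=> /(_ (mulr_ge0 M0 (nrm_ge0 _ _))).
  move=> /(_ (fun t y z Py Pz => alinr t Py Pz Px)).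
  by move=> /(_ (fun y Py => abound Px Py))[z Pz Hz]; exists z.
have PA x : P x -> P (A x) by move=> /HA[].
have EA x y : P x -> P y -> H (A x) y = a x y by move=> /HA[_]; apply.
pose D := M ^+ 2 + c ^+ 2.
have D0 : 0 < D by rewrite ltr_wpDl ?sqr_ge0 ?exprn_gt0.
pose rho := c / D.
have rho0 : 0 < rho by rewrite divr_gt0.
pose S x := lin (- rho) (A x) (lin rho f x).
have PS x : P x -> P (S x) by move=> Px; do ?apply: Plin => //; exact: PA.
have rhoD : rho * D = c by rewrite /rho mulfVK // gt_eqF.
(* On a difference [z] the map has squared norm at most [(1 - 2 rho c + rho^2 M^2) |z|^2], and
   [rho^2 M^2 <= rho c] because [rho * D = c]. *)
pose q := Num.sqrt (1 - c * rho).
have q1 : c * rho <= 1.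
  by rewrite /rho mulrA ler_pdivrMr // mul1r -expr2 lerDr sqr_ge0.
have hq : 0 <= q < 1.
  rewrite sqrtr_ge0 /= -[ltRHS]sqrtr1 ltr_sqrt //.
  by have := mulr_gt0 c0 rho0; lra.
have hS x y : P x -> P y -> dist (S x) (S y) <= q * dist x y.
  move=> Px Py.
  have PAx := PA x Px; have PAy := PA y Py.
  pose z := lin (-1) y x; pose Az := lin (-1) (A y) (A x).
  have Pz : P z by exact: Plin.
  have PAz : P Az by exact: Plin.
  have EAz v : P v -> H Az v = a z v.
    by move=> Pv; rewrite ip_linl alinl // !EA.
  have -> : dist (S x) (S y) = nrm (lin (- rho) Az z).
    rewrite /dist /nrm; congr Num.sqrt.
    (* The two elements need not be equal; agreeing in all pairings suffices for equal norms. *)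
    have E v : H (lin (-1) (S y) (S x)) v = H (lin (- rho) Az z) v.
      by rewrite /S /z /Az !ip_linl; ring.
    by rewrite E ipC E.
  rewrite -ler_sqr ?nnegrE ?mulr_ge0 ?nrm_ge0 ?dist_ge0 //; last first.
    by case/andP: hq.
  rewrite sqr_nrm_lin EAz // exprMn [q ^+ 2]sqr_sqrtr ?subr_ge0 //.
  have nAz : nrm Az ^+ 2 <= M ^+ 2 * nrm z ^+ 2.
    have := abound Pz PAz; rewrite -(EAz _ PAz) -(sqr_nrm H Az).
    rewrite ger0_norm ?sqr_ge0 // expr2.
    have := nrm_ge0 H Az; rewrite le_eqVlt => /orP[/eqP<- _|p].
      by rewrite mul0r -exprMn sqr_ge0.
    rewrite ler_pM2r // => h.
    rewrite -exprMn -expr2 ler_pXn2r ?nnegrE ?mulr_ge0 ?nrm_ge0 //.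
  have co := acoercive Pz.
  rewrite -/(dist x y) -/z in co *.
  have r2 : rho ^+ 2 * nrm Az ^+ 2 <= rho * c * nrm z ^+ 2.
    apply: (@le_trans _ _ (rho ^+ 2 * (M ^+ 2 * nrm z ^+ 2))).
      by rewrite ler_wpM2l ?sqr_ge0.
    rewrite -rhoD mulrA ler_wpM2r ?sqr_ge0 // mulrA -expr2 ler_wpM2l ?sqr_ge0 //.
    by rewrite lerDl sqr_ge0.
  have r1 : rho * (c * nrm z ^+ 2) <= rho * a z z by rewrite ler_wpM2l // ltW.
  by rewrite /dist -/z; lra.
have [x Px xS] := contraction_fixpoint (@dist_ge0 _ _ H) (@distC _ _ H)
  (@dist_tri _ _ H) Pc Px0 PS hq hS.
exists x => // y Py.
have := dist_ip H (S x) x y; have := dist_ip H x (S x) y.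
rewrite (distC _ (S x)) xS mul0r /S !ip_linl EA // Hf // => h1 h2.
have /eqP : rho * (a x y - F y) = 0 by lra.
by rewrite mulf_eq0 gt_eqF //= subr_eq0 => /eqP.
Qed.
End LaxMilgram.

(** * Completeness of L^2 *)

Section ScalarL2.
Context d (T : measurableType d) (R : realType) (mu : {measure set T -> \bar R}).
Context (D : set T) (mD : measurable D).
Implicit Types f g : T -> R.
Local Notation sq f := (sq_integrable mu D f).

Lemma sq_integrableM f g : sq f -> sq g ->
  mu.-integrable D (fun x => (f x * g x)%:E).
Proof.
move=> [mf f2] [mg g2].
apply: (@le_integrable _ _ _ mu D mD _
    (fun x => (f x ^+ 2)%:E + (g x ^+ 2)%:E)%E); last exact: integrableD.
  by apply/measurable_EFinP; exact: measurable_funM.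
move=> x Dx; rewrite -EFinD !abse_EFin lee_fin.
rewrite [leRHS]ger0_norm ?addr_ge0 ?sqr_ge0 // ler_norml.
by have := sqr_ge0 (f x - g x); have := sqr_ge0 (f x + g x);
  rewrite sqrrB sqrrD; have := sqr_ge0 (f x); have := sqr_ge0 (g x); lra.
Qed.

Lemma sq_integrable_lin a f g : sq f -> sq g -> sq (fun x => a * f x + g x).
Proof.
move=> sf sg; have fg := sq_integrableM sf sg.
have [mf f2] := sf; have [mg g2] := sg; split.
  apply: measurable_funD => //; exact: measurable_funM.
have -> : (fun x => ((a * f x + g x) ^+ 2)%:E) =
    (fun x => ((a ^+ 2)%:E * (f x ^+ 2)%:E +
      ((2 * a)%:E * (f x * g x)%:E + (g x ^+ 2)%:E))%E).
  by apply/funext => x; rewrite -!EFinM -!EFinD; congr EFin; ring.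
apply: integrableD => //; first exact: integrableZl.
by apply: integrableD => //; exact: integrableZl.
Qed.

Lemma sq_integrable0 : sq (fun=> 0).
Proof.
split; first exact: measurable_cst.
by rewrite expr0n /=; exact: integrable0.
Qed.

Lemma sq_integrableZ a f : sq f -> sq (fun x => a * f x).
Proof.
move=> sf; have := sq_integrable_lin a sf sq_integrable0.
by under eq_fun do rewrite addr0.
Qed.

Lemma sq_integrableD f g : sq f -> sq g -> sq (fun x => f x + g x).
Proof.
move=> sf sg; have := sq_integrable_lin 1 sf sg.
by under eq_fun do rewrite mul1r.
Qed.

Lemma sq_integrable_sum (I : Type) (s : seq I) (F : I -> T -> R) :
  (forall i, sq (F i)) -> sq (fun x => \sum_(i <- s) F i x).
Proof.
move=> sF; elim: s => [|i s IH].
  by under eq_fun do rewrite big_nil; exact: sq_integrable0.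
by under eq_fun do rewrite big_cons; exact: sq_integrableD.
Qed.

Lemma sq_integrable_bounded_mul (c : T -> R) (M : R) f : measurable_fun D c ->
  {ae mu, forall x, D x -> `|c x| <= M} -> sq f -> sq (fun x => c x * f x).
Proof.
move=> mc cM [mf f2].
have mcf : measurable_fun D (fun x => ((c x * f x) ^+ 2)%:E).
  by apply/measurable_EFinP; apply: measurable_funX; exact: measurable_funM.
have If : mu.-integrable D (fun x => ((M ^+ 2)%:E * (f x ^+ 2)%:E)%E).
  exact: (@integrableZl _ _ _ mu D mD (M ^+ 2) (fun x => (f x ^+ 2)%:E)).
split; first exact: measurable_funM.
apply/integrableP; split => //.
apply: le_lt_trans (integrable_lty mD If).
under eq_integral do rewrite gee0_abs ?lee_fin ?sqr_ge0 //.
apply: ae_ge0_le_integral => //.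
- by move=> x _; rewrite lee_fin sqr_ge0.
- by move=> x _; rewrite -EFinM lee_fin mulr_ge0 ?sqr_ge0.
- exact: measurable_int If.
apply: filterS cM => x H Dx; have {}H := H Dx.
rewrite -EFinM lee_fin exprMn; apply: ler_wpM2r; first exact: sqr_ge0.
rewrite -real_normK ?num_real // ler_pXn2r ?nnegrE //.
exact: le_trans H.
Qed.

Definition L2 := {f : T -> R | sq f}.

Definition L2ip (f g : L2) : R := \int[mu]_(x in D) (sval f x * sval g x).

Definition L2lin a (f g : L2) : L2 :=
  exist _ _ (sq_integrable_lin a (svalP f) (svalP g)).

Lemma L2ip_lin a (f g h : L2) :
  L2ip (L2lin a f g) h = a * L2ip f h + L2ip g h.
Proof.
rewrite /L2ip -RintegralZl //; last exact: sq_integrableM (svalP f) (svalP h).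
rewrite -RintegralD //.
- by apply: eq_Rintegral => x _ /=; ring.
- under [X in integrable _ _ X]eq_fun do rewrite /= EFinM.
  by apply: integrableZl => //; exact: sq_integrableM (svalP f) (svalP h).
- exact: sq_integrableM (svalP g) (svalP h).
Qed.

Definition L2preip : preip R L2.
Proof.
refine (@PreIp R L2 L2ip L2lin _ L2ip_lin _).
- by move=> f g; apply: eq_Rintegral => x _; rewrite mulrC.
- by move=> f; apply: Rintegral_ge0 => x _; rewrite -expr2 sqr_ge0.
Defined.

Lemma L2ipE (f : L2) : (L2ip f f)%:E = (\int[mu]_(x in D) (sval f x ^+ 2)%:E)%E.
Proof.
rewrite /L2ip /Rintegral fineK.
  by apply: eq_integral => x _; rewrite expr2.
apply: integrable_fin_num => //; exact: sq_integrableM (svalP f) (svalP f).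
Qed.

Lemma einf_ge0 (a : nat -> \bar R) : (forall j, 0 <= a j)%E -> (0 <= limn_einf a)%E.
Proof.
move=> a0; rewrite limn_einf_lim; apply: lime_ge; first exact: is_cvg_einfs.
by apply: nearW => j; apply: le_ereal_inf_tmp => _ [k _ <-].
Qed.

(* Riesz-Fischer: if the steps [f_k - f_(k+1)] have L2 norm at most [2^-k], then
   [sum_k 2^k (f_k - f_(k+1))^2] is integrable, hence finite almost everywhere,
   and [f_k] converges geometrically where it is finite. *)
Lemma L2_fast_ae_cvg (u : nat -> L2) :
  (forall k, dist L2preip (u k) (u k.+1) <= 2^-1 ^+ k) ->
  {ae mu, forall x, D x -> cvgn (fun k => sval (u k) x)}.
Proof.
move=> hu; pose f k := sval (u k).
have sf k : sq (f k) by exact: svalP.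
pose dd k x := f k.+1 x - f k x.
have sd k : sq (dd k).
  by have := sq_integrable_lin (-1) (sf k) (sf k.+1);
    under eq_fun do rewrite mulN1r addrC.
pose h k x := (2 ^+ k * dd k x ^+ 2)%:E.
have h0 k x : (0 <= h k x)%E by rewrite /h lee_fin mulr_ge0 ?sqr_ge0 ?exprn_ge0 ?ler0n.
have mh k : measurable_fun D (h k).
  apply/measurable_EFinP; apply: measurable_funM => //.
  by apply: measurable_funX; have [] := sd k.
have Ih k : (\int[mu]_(x in D) h k x <= (2^-1 ^+ k)%:E)%E.
  rewrite /h; under eq_integral do rewrite EFinM.
  rewrite integralZl //; last by have [] := sd k.
  have -> : (\int[mu]_(x in D) (dd k x ^+ 2)%:E =
      (dist L2preip (u k) (u k.+1) ^+ 2)%:E)%E.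
    rewrite sqr_nrm L2ipE; apply: eq_integral => x _.
    by congr EFin; rewrite /dd /f /=; ring.
  rewrite -EFinM lee_fin.
  apply: (@le_trans _ _ (2 ^+ k * (2^-1 ^+ k) ^+ 2)).
    by rewrite ler_wpM2l ?exprn_ge0 // ler_pXn2r ?nnegrE ?dist_ge0 ?exprn_ge0.
  by rewrite expr2 mulrA -exprMn divff // expr1n mul1r.
pose S x := (\sum_(0 <= k <oo) h k x)%E.
have IS : mu.-integrable D S.
  apply/integrableP; split.
    exact: (@ge0_emeasurable_sum _ _ _ D h xpredT).
  under eq_integral do rewrite gee0_abs ?nneseries_ge0 //.
  rewrite integral_nneseries //.
  apply: (@le_lt_trans _ _ (\sum_(0 <= k <oo) (2^-1 ^+ k)%:E)%E).
    by apply: lee_nneseries => [k _ _|k _]; [exact: integral_ge0|exact: Ih].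
  apply: (@le_lt_trans _ _ 2%:E); last exact: ltry.
  apply: lime_le; first by apply: is_cvg_nneseries => k _ _; rewrite lee_fin exprn_ge0.
  rewrite (_ : 2%:E = (1 / (1 - 2^-1))%:E); last by congr EFin; field.
  apply: nearW => k; rewrite sumEFin lee_fin.
  have h20 : 0 < 2^-1 :> R by rewrite invr_gt0.
  have h21 : `|2^-1| < 1 :> R by rewrite gtr0_norm // invf_lt1 // ltr1n.
  apply: le_trans (geometric_le_lim k ler01 h20 h21).
  by apply: ler_sum => i _; rewrite /= mul1r.
apply: filterS (integrable_ae mD IS) => x Sx Dx.
have {Sx} := Sx Dx.
have Sx0 : (0 <= S x)%E by apply: nneseries_ge0.
move=> /fineK Sx.
pose s := fine (S x).
have s0 : 0 <= s by exact: fine_ge0.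
have hs k : 2 ^+ k * dd k x ^+ 2 <= s.
  rewrite -lee_fin Sx; apply: le_trans (nneseries_lim_ge k.+1 _) => //.
  rewrite big_nat_recr //= -[leLHS]add0e; apply: leeD => //.
  by apply: sume_ge0.
(* Each term of the series is at most its sum [s], so the steps at [x] are at most
   [sqrt s * q ^ k]. *)
pose q : R := Num.sqrt 2^-1.
have cf : cauchy_for (fun a b : R => `|a - b|) (fun k => f k x).
  apply: (@geom_cauchy _ _ _ _ _ _ _ (Num.sqrt s) q) => //.
  - exact: distrC.
  - by move=> a b c; rewrite (le_trans _ (ler_normD _ _)) // addrA subrK.
  - by rewrite sqrtr_ge0 -[ltRHS]sqrtr1 ltr_sqrt // invf_lt1 // ltr1n.
  move=> k; rewrite -ler_sqr ?nnegrE ?mulr_ge0 ?exprn_ge0 ?sqrtr_ge0 //.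
  rewrite exprMn sqr_sqrtr // exprAC sqr_sqrtr // real_normK ?num_real //.
  have := hs k; rewrite /dd -[X in _ -> X <= _]mulr1.
  rewrite exprVn ler_pdivlMr ?exprn_gt0 // mulrC => h2; apply: le_trans h2.
  by rewrite mulr1 -sqrrN opprB.
apply: cauchy_cvg; apply/cauchy_exP => e e0.
have e20 : 0 < e / 2 by rewrite divr_gt0.
have [N HN] := cf _ e20.
exists (f N x); exists N => // k Nk; rewrite /ball_ /=.
apply: (@le_lt_trans _ _ (e / 2)); first exact: HN.
by rewrite ltr_pdivrMr // ltr_pMr // ltr1n.
Qed.

(** By [fast_complete] only geometrically fast sequences matter. The upper limit is a candidate that
    is measurable without any exceptional set, and Fatou's lemma turns almost everywhere convergence
    into [L^2] convergence. *)
Lemma L2_complete : ip_complete L2preip (fun=> True).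
Proof.
apply: fast_complete => //; [exact: dist_ge0|exact: distC|exact: dist_tri|].
move=> u _ hu.
pose f k := sval (u k).
have sf k : sq (f k) by exact: svalP.
have mf k : measurable_fun D (f k) by have [] := sf k.
pose F x := fine (limn_esup (fun k => (f k x)%:E)).
have mF : measurable_fun D F.
  apply: (measurableT_comp (fine_measurable measurableT)).
  by apply: measurable_fun_limn_esup => k; exact/measurable_EFinP.
have aeF : {ae mu, forall x, D x -> f k x @[k --> \oo] --> F x}.
  apply: filterS (L2_fast_ae_cvg hu) => x H Dx; have {}H := H Dx.
  have H2 : (f k x)%:E @[k --> \oo] --> (limn (fun k => f k x))%:E.
    by apply: cvg_EFin => //; exact: nearW.
  by rewrite /F (cvg_limn_einf_sup H2).2.
have cu : cauchy_for (dist L2preip) u.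
  apply: (@geom_cauchy _ _ _ _ _ _ _ 1 2^-1) => //.
  - exact: dist_ge0.
  - exact: distC.
  - exact: dist_tri.
  - by rewrite invr_ge0 ler0n /= invf_lt1 // ltr1n.
  - by move=> k; rewrite mul1r.
(* Almost everywhere [(F - f k)^2] is the limit of [g j], whose integrals are at most [e ^+ 2];
   Fatou passes this bound to the limit. *)
have key e : 0 < e -> exists N, forall k, (N <= k)%N ->
    (\int[mu]_(x in D) ((F x - f k x) ^+ 2)%:E <= (e ^+ 2)%:E)%E.
  move=> e0; have [N HN] := cu e e0; exists N => k Nk.
  pose g j x := ((f (N + j)%N x - f k x) ^+ 2)%:E.
  have mg j : measurable_fun D (g j).
    by apply/measurable_EFinP/measurable_funX/measurable_funB.
  have g0 j x : D x -> (0 <= g j x)%E by rewrite lee_fin sqr_ge0.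
  apply: (@le_trans _ _ (\int[mu]_(x in D) limn_einf (g^~ x))%E).
    apply: ae_ge0_le_integral => //.
    - by move=> x _; rewrite lee_fin sqr_ge0.
    - by apply/measurable_EFinP/measurable_funX/measurable_funB.
    - by move=> x Dx; exact: einf_ge0 (fun j => g0 j x Dx).
    - apply: measurableT_comp => //; apply: measurable_fun_limn_esup => j.
      exact: measurableT_comp.
    apply: filterS aeF => x H Dx; have {}H := H Dx.
    have H2 : g j x @[j --> \oo] --> ((F x - f k x) ^+ 2)%:E.
      apply: cvg_EFin; first exact: nearW.
      have H3 : f (N + j)%N x - f k x @[j --> \oo] --> F x - f k x.
        apply: cvgB; last exact: cvg_cst.
        have H4 := H; rewrite -(cvg_shiftn N) in H4.
        by under eq_cvg do rewrite addnC; exact: H4.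
      by rewrite expr2; under eq_cvg do rewrite /= expr2; exact: cvgM.
    by rewrite (cvg_limn_einf_sup H2).1.
  apply: (le_trans (fatou mu mD mg g0)).
  rewrite limn_einf_lim; apply: lime_le; first exact: is_cvg_einfs.
  apply: nearW => j; apply: (@le_trans _ _ (\int[mu]_(x in D) g j x)%E).
    by apply: ereal_inf_lbound; exists j => /=.
  have -> : (\int[mu]_(x in D) g j x =
      (dist L2preip (u k) (u (N + j)%N) ^+ 2)%:E)%E.
    rewrite sqr_nrm L2ipE; apply: eq_integral => x _.
    by congr EFin; rewrite /f /=; ring.
  rewrite lee_fin ler_pXn2r ?nnegrE ?dist_ge0 ?(ltW e0) //.
  by apply: HN => //; exact: leq_addr.
have sF : sq F.
  (* [F] is a square integrable difference [F - f N] plus [f N]. *)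
  have [N HN] := key 1 ltr01.
  have sd : sq (fun x => F x - f N x).
    split; first exact: measurable_funB.
    apply/integrableP; split.
      by apply/measurable_EFinP/measurable_funX/measurable_funB.
    under eq_integral do rewrite gee0_abs ?lee_fin ?sqr_ge0 //.
    by apply: (le_lt_trans (HN N (leqnn _))); exact: ltry.
  have := sq_integrableD sd (sf N).
  by under eq_fun do rewrite subrK.
exists (exist _ F sF) => //.
apply/cvgrPdist_le => e e0; have [N HN] := key e e0.
exists N => // k Nk; rewrite /= sub0r normrN ger0_norm ?dist_ge0 //.
rewrite -ler_sqr ?nnegrE ?dist_ge0 ?(ltW e0) //.
rewrite -lee_fin sqr_nrm L2ipE; apply: le_trans (HN k Nk).
apply: le_of_eq.
by apply: eq_integral => x _; congr EFin; rewrite /f /=; ring.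
Qed.

End ScalarL2.

(** * Borel sets are Lebesgue and Hausdorff measurable *)

Section CoverSplit.
Context (R : realType) (T : pointedType) (w : set T -> \bar R).
Hypothesis w_ge0 : forall A, (0 <= w A)%E.

Lemma measurable_every_set (A : set (g_sigma_algebraType [set: set T])) :
  measurable A.
Proof. exact: sub_sigma_algebra. Qed.

(** Cutting every set of a cover of the union by [P] and by [Q] produces covers of [A] and of [B]
    with no larger total weight. *)
Lemma cover_outer_split (P Q A B : set T) :
  A `<=` P -> B `<=` Q ->
  (forall U, w (U `&` P) + w (U `&` Q) <= w U)%E ->
  (cover_outer w A + cover_outer w B <= cover_outer w (A `|` B))%E.
Proof.
move=> AP BQ wPQ; apply: le_ereal_inf_tmp => _ [F [_ covF] <-].
apply: (@le_trans _ _ (\sum_(0 <= k <oo) (w (F k `&` P) + w (F k `&` Q)))%E);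
  last first.
  by apply: lee_nneseries => [k _ _|k _]; [exact: adde_ge0|exact: wPQ].
rewrite nneseriesD; [|by move=> *; exact: w_ge0..].
apply: leeD; apply: ereal_inf_lbound.
- exists (fun k => F k `&` P) => //.
  split => [k|x Ax]; first exact: measurable_every_set.
  by have [k _ Fkx] := covF x (or_introl Ax); exists k => //; split => //; exact: AP.
- exists (fun k => F k `&` Q) => //.
  split => [k|x Bx]; first exact: measurable_every_set.
  by have [k _ Fkx] := covF x (or_intror Bx); exists k => //; split => //; exact: BQ.
Qed.

Lemma cover_outer_le_weight (A : set T) : w set0 = 0%E ->
  (cover_outer w A <= w A)%E.
Proof.
move=> w0; apply: ereal_inf_lbound.
exists (fun k => if k == 0%N then A else set0).
  by split => [k|x Ax]; [exact: measurable_every_set|exists 0%N].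
rewrite (@nneseries_split _ _ 0%N 1%N) //= big_nat1 eseries0 ?adde0 //.
by move=> k k1 _; case: k k1.
Qed.

End CoverSplit.

Section LebesgueHalfSpace.
Context (R : realType) (n : nat).
Implicit Types U V : set 'rV[R]_n.

Lemma box_weight_le U (a b : 'rV[R]_n) : (forall i, a ord0 i <= b ord0 i) ->
  U `<=` [set x | forall i, a ord0 i <= x ord0 i <= b ord0 i] ->
  (box_weight U <= (\prod_i (b ord0 i - a ord0 i))%:E)%E.
Proof.
move=> ab Uab; rewrite /box_weight; case: asboolP => _.
  by rewrite lee_fin; apply: prodr_ge0 => i _; rewrite subr_ge0.
by apply: ereal_inf_lbound; exists a, b.
Qed.

(** A hyperplane [x_i = c] cuts a box into two boxes whose volumes add up; if it misses the box, one
    of the pieces is empty and has weight 0. *)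
Lemma box_weight_half_space (i : 'I_n) (c : R) U :
  (box_weight (U `&` [set x | (x ord0 i < c)%R]) +
   box_weight (U `&` ~` [set x | (x ord0 i < c)%R]) <= box_weight U)%E.
Proof.
set H := [set x | _].
rewrite [leRHS]/box_weight; case: asboolP => [->|_].
  by rewrite !set0I !box_weight0 adde0.
apply: le_ereal_inf_tmp => _ [a [b [ab Uab ->]]].
have [cai|aic] := leP c (a ord0 i).
  have -> : U `&` H = set0.
    rewrite -subset0 => x [/Uab/(_ i)/andP[h _]] /=.
    by rewrite /H /= ltNge (le_trans cai h).
  rewrite box_weight0 add0e; apply: box_weight_le => // x [Ux _]; exact: Uab.
have [cbi|bic] := leP c (b ord0 i); last first.
  have -> : U `&` ~` H = set0.
    rewrite -subset0 => x [/Uab/(_ i)/andP[_ h]] /=.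
    by rewrite /H /= (le_lt_trans h bic).
  rewrite box_weight0 adde0; apply: box_weight_le => // x [Ux _]; exact: Uab.
(* Opposite corners of the two half boxes, with coordinate [i] replaced by [c]. *)
pose b' : 'rV[R]_n := \row_j (if j == i then c else b ord0 j).
pose a' : 'rV[R]_n := \row_j (if j == i then c else a ord0 j).
apply: (@le_trans _ _ ((\prod_j (b' ord0 j - a ord0 j))%:E +
   (\prod_j (b ord0 j - a' ord0 j))%:E)%E).
  apply: leeD; apply: box_weight_le.
  - by move=> j; rewrite mxE; case: eqP => [->|_] //; exact: ltW.
  - move=> x [/Uab h Hx] j; rewrite mxE; have /andP[h1 h2] := h j.
    by rewrite h1 /=; case: eqP => [->|_] //; exact: ltW.
  - by move=> j; rewrite mxE; case: eqP => [->|_].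
  - move=> x [/Uab h Hx] j; rewrite mxE; have /andP[h1 h2] := h j.
    by rewrite h2 andbT; case: eqP => [->|_] //; rewrite leNgt; apply/negP.
rewrite -EFinD lee_fin (bigD1 i) //= [X in _ + X](bigD1 i) //= [leRHS](bigD1 i) //=.
rewrite !mxE eqxx.
have -> : \prod_(j < n | j != i) (b' ord0 j - a ord0 j) =
   \prod_(j < n | j != i) (b ord0 j - a ord0 j).
  by apply: eq_bigr => j /negPf ji; rewrite mxE ji.
have -> : \prod_(j < n | j != i) (b ord0 j - a' ord0 j) =
   \prod_(j < n | j != i) (b ord0 j - a ord0 j).
  by apply: eq_bigr => j /negPf ji; rewrite mxE ji.
by rewrite -mulrDl addrC subrKA.
Qed.

Lemma lebesgue_half_space (i : 'I_n) (c : R) :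
  (leb_om R n).-caratheodory [set x | x ord0 i < c].
Proof.
apply: le_caratheodory_measurable => X.
rewrite -[in leRHS](setIT X) -(setUv [set x : 'rV[R]_n | x ord0 i < c]) setIUr.
apply: (cover_outer_split (@box_weight_ge0 R n)
  (P := [set x | x ord0 i < c]) (Q := ~` [set x | x ord0 i < c])).
- by move=> x [].
- by move=> x [].
- exact: box_weight_half_space.
Qed.

Lemma entry_le_norm (m p : nat) (A : 'M[R]_(m, p)) i j : `|A i j| <= `|A|.
Proof. by rewrite [leRHS]/Num.norm /= mx_normrE; exact: (le_bigmax _ _ (i, j)). Qed.

Lemma lebesgue_bounded (A : set 'rV[R]_n) : bounded_set A ->
  (leb_om R n A < +oo)%E.
Proof.
move=> [M [_ AM]].
apply: (le_lt_trans (cover_outer_le_weight (@box_weight_ge0 R n) A (@box_weight0 R n))).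
(* [bounded_set] bounds by every number above [M], hence [M + 1]; the maximum with 0 keeps the
   corners ordered. *)
pose M1 := Num.max (M + 1) 0.
apply: (@le_lt_trans _ _ (\prod_i ((const_mx M1 : 'rV[R]_n) ord0 i -
   (const_mx (- M1) : 'rV[R]_n) ord0 i))%:E); last exact: ltry.
apply: box_weight_le => [i|x Ax i]; rewrite !mxE.
  by rewrite ge0_cp // /M1 le_max lexx orbT.
rewrite -ler_norml (le_trans (entry_le_norm x ord0 i)) // /M1 le_max.
by apply/orP; left; apply: AM => //; rewrite ltrDl.
Qed.

End LebesgueHalfSpace.

Lemma lee_expe (R : realDomainType) (x y : \bar R) (k : nat) :
  (0 <= x)%E -> (x <= y)%E -> (x ^+ k <= y ^+ k)%E.
Proof.
move=> x0 xy; elim: k => [|k IH]; first by rewrite !expe0.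
by rewrite !expeS lee_pmul // expe_ge0.
Qed.

Section HausdorffHalfSpace.
Context (R : realType) (n s : nat).
Local Notation H := (haus_om R n s).
Variable i : 'I_n.

Lemma coord_le_enorm (x : 'rV[R]_n) : `|x ord0 i| <= enorm x.
Proof.
rewrite -sqrtr_sqr ler_sqrt; last by apply: sumr_ge0 => j _; rewrite -expr2 sqr_ge0.
rewrite /vdot (bigD1 i) //= -expr2 lerDl.
by apply: sumr_ge0 => j _; rewrite -expr2 sqr_ge0.
Qed.

Lemma le_diam (U V : set 'rV[R]_n) : U `<=` V -> (diam U <= diam V)%E.
Proof.
move=> UV; apply: ereal_sup_le => _ [x [y [Ux Uy ->]]].
by exists x, y; split => //; exact: UV.
Qed.

Lemma diam_ge0 (U : set 'rV[R]_n) x : U x -> (0 <= diam U)%E.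
Proof.
move=> Ux; apply: (@le_trans _ _ (enorm (x - x))%:E); first by rewrite lee_fin sqrtr_ge0.
by apply: ereal_sup_ubound; exists x, x.
Qed.

Lemma le_diam_weight (delta : R) (U V : set 'rV[R]_n) : U `<=` V ->
  (diam_weight s delta U <= diam_weight s delta V)%E.
Proof.
move=> UV; rewrite {1}/diam_weight; case: asboolP => [_|U0].
  exact: diam_weight_ge0.
rewrite /diam_weight; case: asboolP => [V0|_].
  by move: U0; rewrite -subset0 -V0.
have dUV := le_diam UV.
case: (leP (diam V)) => [dV|_]; last exact: leey.
rewrite (le_trans dUV dV).
have /eqP/set0P[x Ux] := U0.
by apply: lee_expe => //; exact: diam_ge0 Ux.
Qed.

Lemma cover_outer_anti (A : set 'rV[R]_n) (d1 d2 : R) : d1 <= d2 ->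
  (cover_outer (diam_weight s d2) A <= cover_outer (diam_weight s d1) A)%E.
Proof.
move=> d12; apply: le_ereal_inf_tmp => _ [F covF <-].
apply: (@le_trans _ _ (\sum_(0 <= k <oo) diam_weight s d2 (F k))%E).
  by apply: ereal_inf_lbound; exists F.
apply: lee_nneseries => [k _ _|k _]; first exact: diam_weight_ge0.
rewrite /diam_weight; case: asboolP => // _.
have [d1F|] := leP (diam (F k)) d1%:E; last by rewrite leey.
by rewrite (le_trans d1F) // lee_fin.
Qed.

Lemma hausdorff_separated (a c : R) (A B : set 'rV[R]_n) : a < c ->
  (forall x, A x -> x ord0 i <= a) -> (forall x, B x -> c <= x ord0 i) ->
  (H A + H B <= H (A `|` B))%E.
Proof.
move=> ac Aa Bc.
have key (d1 d2 : R) : 0 < d1 -> 0 < d2 ->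
    (cover_outer (diam_weight s d1) A + cover_outer (diam_weight s d2) B
     <= H (A `|` B))%E.
  move=> d10 d20.
  (* Below [d1] and [d2], since refining the mesh only increases the outer measure, and below the
     gap. *)
  pose e := Num.min ((c - a) / 2) (Num.min d1 d2).
  have ca0 : 0 < (c - a) / 2 by rewrite divr_gt0 // subr_gt0.
  have e0 : 0 < e by rewrite !lt_min ca0 d10 d20.
  have ed1 : e <= d1 by rewrite !ge_min lexx orbT.
  have ed2 : e <= d2 by rewrite !ge_min lexx !orbT.
  have eca : e < c - a.
    apply: (@le_lt_trans _ _ ((c - a) / 2)); first by rewrite ge_min lexx.
    by rewrite ltr_pdivrMr // ltr_pMr ?ltr1n // subr_gt0.
  apply: (le_trans (leeD (cover_outer_anti A ed1) (cover_outer_anti B ed2))).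
  apply: (@le_trans _ _ (cover_outer (diam_weight s e) (A `|` B))); last first.
    by apply: ereal_sup_ubound; exists e.
  apply: (cover_outer_split (@diam_weight_ge0 R n s e)
    (P := [set x | x ord0 i <= a]) (Q := [set x | c <= x ord0 i])) => // U.
  (* Nonempty sets of larger diameter have infinite weight, so the inequality is trivial for
     them. *)
  have [dU|dU] := leP (diam U) e%:E; last first.
    rewrite [leRHS]/diam_weight; case: asboolP => [->|_].
      by rewrite !set0I !diam_weight0 adde0.
    by rewrite [(diam U <= _)%E]leNgt dU /= leey.
  have [->|/set0P[x [Ux xa]]] := eqVneq (U `&` [set x | x ord0 i <= a]) set0.
    by rewrite diam_weight0 add0e; exact: le_diam_weight.
  have [->|/set0P[y [Uy yc]]] := eqVneq (U `&` [set x | c <= x ord0 i]) set0.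
    by rewrite diam_weight0 adde0; exact: le_diam_weight.
  suff : ((c - a)%:E <= diam U)%E.
    by move=> /le_trans/(_ dU); rewrite lee_fin leNgt eca.
  apply: (@le_trans _ _ (enorm (y - x))%:E); last first.
    by apply: ereal_sup_ubound; exists y, x.
  rewrite lee_fin (le_trans _ (coord_le_enorm _)) // !mxE (le_trans _ (ler_norm _)) //.
  exact: lerB.
have [->|Hfin] := eqVneq (H (A `|` B)) +oo%E; first exact: leey.
have HABf : H (A `|` B) \is a fin_num.
  by rewrite ge0_fin_numE ?outer_measure_ge0 // ltey.
(* The suprema over [d1] and [d2] are taken one at a time, moving the other summand across the
   inequality; this needs its finiteness. *)
have le1 (d1 d2 : R) : 0 < d1 -> 0 < d2 ->
    (cover_outer (diam_weight s d1) A <=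
      H (A `|` B) - cover_outer (diam_weight s d2) B)%E.
  move=> d10 d20; rewrite leeBrDr ?key //.
  rewrite ge0_fin_numE; last exact: (cover_outer_ge0 (@diam_weight_ge0 R n s d2)).
  rewrite (@le_lt_trans _ _ (H (A `|` B))) ?ltey //.
  apply: le_trans (key d1 d2 d10 d20); rewrite -[leLHS]add0e leeD2r //.
  exact: (cover_outer_ge0 (@diam_weight_ge0 R n s d1)).
have HAf : H A \is a fin_num.
  rewrite ge0_fin_numE ?outer_measure_ge0 //.
  apply: (@le_lt_trans _ _ (H (A `|` B))); last by rewrite ltey.
  by apply: le_outer_measure; exact: subsetUl.
rewrite addeC -leeBrDr // [leLHS]/= .
apply: ge_ereal_sup => _ [d2 d20 <-].
rewrite leeBrDr // addeC -leeBrDr; last first.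
  rewrite ge0_fin_numE; last exact: (cover_outer_ge0 (@diam_weight_ge0 R n s d2)).
  rewrite (@le_lt_trans _ _ (H (A `|` B))) ?ltey //.
  apply: le_trans (key 1 d2 ltr01 d20); rewrite -[leLHS]add0e leeD2r //.
  exact: (cover_outer_ge0 (@diam_weight_ge0 R n s 1)).
by apply: ge_ereal_sup => _ [d1 d10 <-]; exact: le1.
Qed.

(* Caratheodory's argument: the shells [c - 1/(m+2) < x_i <= c - 1/(m+3)] are
   separated from the sets [x_i <= c - 1/(m+1)], so their measures are summable. *)
Lemma hausdorff_half_space (c : R) : H.-caratheodory [set x | x ord0 i < c].
Proof.
apply: le_caratheodory_measurable => X.
set L := [set x | x ord0 i < c].
have [->|XN] := eqVneq (H X) +oo%E; first exact: leey.
have Xf : H X \is a fin_num by rewrite ge0_fin_numE ?outer_measure_ge0 // ltey.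
pose t (m : nat) : R := c - m.+1%:R^-1.
have tlt m k : (m < k)%N -> t m < t k.
  by move=> mk; rewrite /t ltrD2l ltrN2 ltf_pV2 ?posrE // ltr_nat.
pose A m := X `&` [set x | x ord0 i <= t m].
pose E m := X `&` [set x | t m < x ord0 i <= t m.+1].
have subf Y : Y `<=` X -> H Y \is a fin_num.
  move=> YX; rewrite ge0_fin_numE ?outer_measure_ge0 //.
  by apply: (@le_lt_trans _ _ (H X)); [exact: le_outer_measure|rewrite ltey].
have Af m : H (A m) \is a fin_num by apply: subf => x [].
have Ef m : H (E m) \is a fin_num by apply: subf => x [].
have [a aE] : exists a : nat -> R, forall m, H (A m) = (a m)%:E.
  by exists (fun m => fine (H (A m))) => m; rewrite fineK.
have [e eE] : exists e : nat -> R, forall m, H (E m) = (e m)%:E.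
  by exists (fun m => fine (H (E m))) => m; rewrite fineK.
have e0 m : 0 <= e m by rewrite -lee_fin -eE outer_measure_ge0.
(* [A m] and the shell [E m.+1] are separated by the layer between [t m] and [t m.+1]. *)
have step m : a m + e m.+1 <= a m.+2.
  rewrite -lee_fin EFinD -(aE m) -(aE m.+2) -(eE m.+1).
  apply: (@le_trans _ _ (H (A m `|` E m.+1))).
    apply: (@hausdorff_separated (t m) (t m.+1)).
    - exact: tlt.
    - by move=> x [].
    - by move=> x [_ /andP[/ltW]].
  apply: le_outer_measure => x [[Xx /= xm]|[Xx /= /andP[_ xm]]]; split => //=.
  by rewrite (le_trans xm) // ltW // tlt.
have amono m : a m <= a m.+1.
  rewrite -lee_fin -!aE; apply: le_outer_measure => x [Xx /= xm]; split => //=.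
  by rewrite (le_trans xm) // ltW // tlt.
have aX m : ((a m)%:E + H (X `&` ~` L) <= H X)%E.
  rewrite -aE; apply: (@le_trans _ _ (H (A m `|` (X `&` ~` L)))).
    apply: (@hausdorff_separated (t m) c).
    - by rewrite /t ltrBlDr ltrDl invr_gt0.
    - by move=> x [].
    - by move=> x [_ /= /negP]; rewrite -leNgt.
  by apply: le_outer_measure => x [[]|[]].
have XLf : H (X `&` ~` L) \is a fin_num by apply: subf => x [].
pose S := [set a m | m in setT].
have Sb : has_sup S.
  split; first by exists (a 0%N), 0%N.
  exists (fine (H X)) => _ [m _ <-]; rewrite -lee_fin -aE fineK //.
  by apply: le_outer_measure => x [].
have supS m : a m <= sup S by apply: ub_le_sup; [case: Sb | exists m].
(* Points of [X] in the half-space lie in [A m.+1] or in a later shell. *)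
have tail m : (H (X `&` L) <= (a m.+1 + 2 * (sup S - a m))%:E)%E.
  pose F k := if (k < m.+1)%N then A m.+1 else E k.
  apply: (@le_trans _ _ (H (A m.+1 `|` \bigcup_(k in ~` `I_m.+1) E k))).
    apply: le_outer_measure => x [Xx xL].
    have [xm|xm] := leP (x ord0 i) (t m.+1); first by left.
    right.
    have ex : exists k, x ord0 i <= t k.
      have cx : 0 < c - x ord0 i by rewrite subr_gt0.
      have [N _ /(_ N (leqnn _)) /= hN] := near_infty_natSinv_lt (PosNum cx).
      by exists N; rewrite /t lerBrDr -lerBrDl ltW.
    pose k := ex_minn ex; case: (ex_minnP ex) => {}k xk kmin.
    have mk : (m.+1 < k)%N.
      rewrite ltnNge; apply/negP => km.
      have : t k <= t m.+1.
        by move: km; rewrite leq_eqVlt => /orP[/eqP->//|/tlt/ltW].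
      by move=> /(le_trans xk); rewrite leNgt xm.
    case: k xk kmin mk => // k xk kmin mk.
    exists k; first by apply/negP; rewrite -leqNgt.
    split => //=; rewrite xk andbT ltNge; apply/negP => xk'.
    by have := kmin _ xk'; rewrite ltnn.
  apply: (le_trans (outer_measureU2 _ _ _)); rewrite EFinD -aE leeD2l //.
  apply: (le_trans (outer_measure_sigma_subadditive_tail _ _ _)).
  apply: lime_le; first by apply: is_cvg_nneseries => k _ _; exact: outer_measure_ge0.
  exists m.+1 => // N /= mN.
  under eq_bigr do rewrite eE; rewrite sumEFin lee_fin.
  have -> : N = (m.+1 + (N - m.+1))%N by rewrite subnKC.
  move: (N - m.+1)%N => {mN}N.
  (* [step] telescopes with stride two, so even and odd shells each contribute a boundary
     difference. *)
  have H2 : \sum_(m.+1 <= k < m.+1 + N) e k <=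
      (a (m + N)%N - a m) + (a (m + N).+1 - a m.+1).
    elim: N => [|N IH]; first by rewrite !addn0 big_geq // !subrr addr0.
    rewrite addnS big_nat_recr ?leq_addr //= addnS.
    by have := step (m + N)%N; rewrite -addSn in IH *; lra.
  apply: (le_trans H2); have := supS (m + N)%N; have := supS (m + N).+1.
  by have := amono m; lra.
apply/lee_addgt0Pr => eps eps0.
have e40 : 0 < eps / 2 by rewrite divr_gt0.
(* With [a m] this close to the supremum, the error in [tail] is at most [eps]. *)
have [_ [m _ <-] hm] := sup_adherent e40 Sb.
apply: (le_trans (leeD2r _ (tail m))).
have -> : H (X `&` ~` L) = (fine (H (X `&` ~` L)))%:E by rewrite fineK.
have := aX m.+1; rewrite -(fineK XLf) -(fineK Xf) -!EFinD !lee_fin.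
by lra.
Qed.

End HausdorffHalfSpace.

Section BorelMeasurable.
Context (R : realType) (n : nat) (mu : {outer_measure set 'rV[R]_n -> \bar R}).
Hypothesis half_space : forall (i : 'I_n) c, mu.-caratheodory [set x | x ord0 i < c].
Local Notation T := (caratheodory_type mu).

Let lt_coord (i : 'I_n) (c : R) : measurable ([set x | x ord0 i < c] : set T).
Proof. exact: half_space. Qed.

Lemma measurable_coord (i : 'I_n) :
  measurable_fun [set: T] (fun x : T => (x : 'rV[R]_n) ord0 i).
Proof.
apply: (measurability _ (RGenInftyO.measurableE R)).
move=> _ [_ [c ->] <-]; rewrite setTI.
rewrite (_ : _ @^-1` _ = [set x : 'rV[R]_n | x ord0 i < c]); first exact: lt_coord.
by apply/seteqP; split => x /=; rewrite in_itv.
Qed.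

Lemma measurable_rV_ball (q : 'rV[R]_n) (e : R) : 0 < e ->
  measurable (ball q e : set T).
Proof.
move=> e0.
have -> : ball q e = \bigcap_(i in [set: 'I_n])
    [set x : 'rV[R]_n | q ord0 i - e < x ord0 i < q ord0 i + e].
  rewrite mx_norm_ball; apply/seteqP; split => x.
    move=> /= h i _ /=; have := entry_le_norm (q - x) ord0 i.
    move=> /le_lt_trans/(_ h); rewrite !mxE ltr_norml => /andP[h1 h2].
    by apply/andP; split; lra.
  move=> h /=; rewrite /Num.norm /= mx_normrE; apply/bigmax_ltP; split => // -[j i] _ /=.
  rewrite ord1 !mxE ltr_norml; have /andP[h1 h2] := h i I.
  by apply/andP; split; lra.
apply: fin_bigcap_measurable => [|i _]; first exact: finite_finset.
have -> : [set x : 'rV[R]_n | q ord0 i - e < x ord0 i < q ord0 i + e] =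
   (fun x : 'rV[R]_n => x ord0 i) @^-1` `]q ord0 i - e, q ord0 i + e[.
  by apply/seteqP; split => x /=; rewrite in_itv.
rewrite -[X in measurable X]setTI.
by apply: measurable_coord => //; exact: measurable_itv.
Qed.

(** An open set is the union of the countably many balls with rational centre and radius
    [1 / (N + 1)] that it contains. In the maximum norm a ball is a finite intersection of
    coordinate strips. *)
Lemma open_caratheodory (U : set 'rV[R]_n) : open U -> measurable (U : set T).
Proof.
move=> oU.
pose Q := ('rV[rat]_n * nat)%type.
pose c (p : Q) : 'rV[R]_n := map_mx ratr p.1.
pose e (p : Q) : R := p.2.+1%:R^-1.
have e0 p : 0 < e p by rewrite invr_gt0.
have -> : U = \bigcup_(p in [set: Q])
    (if `[< ball (c p) (e p) `<=` U >] then ball (c p) (e p) else set0).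
  apply/seteqP; split => [x Ux|x [p _]]; last by case: asboolP => // h; exact: h.
  have /nbhs_ballP[d /= d0 dU] : nbhs x U by exact: open_nbhs_nbhs.
  have d20 : 0 < d / 2 by rewrite divr_gt0.
  have [N _ /(_ N (leqnn _)) /= hN] := near_infty_natSinv_lt (PosNum d20).
  pose eN : R := N.+1%:R^-1.
  have eN0 : 0 < eN by rewrite invr_gt0.
  have eNd : eN < d / 2 by [].
  have /choice[q hq] : forall i : 'I_n, exists q : rat,
      x ord0 i - eN < ratr q < x ord0 i + eN.
    move=> i; have [] := @rat_in_itvoo R (x ord0 i - eN) (x ord0 i + eN); first by lra.
    by move=> q; rewrite in_itv /= => h; exists q.
  exists (\row_i q i, N) => //.
  have xb : ball (c (\row_i q i, N)) (e (\row_i q i, N)) x.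
    rewrite mx_norm_ball /= /Num.norm /= mx_normrE; apply/bigmax_ltP.
    split => [|[j i] _ /=]; first exact: e0.
    rewrite ord1 !mxE ltr_norml; have /andP[h1 h2] := hq i.
    by rewrite /e /= -/eN; apply/andP; split; lra.
  case: asboolP => // -[] y yb; apply: dU.
  have -> : d = d / 2 + d / 2 by rewrite -splitr.
  apply: (@ball_triangle _ _ (c (\row_i q i, N))).
    apply: le_ball (ball_sym xb); rewrite /e /= -/eN; exact: ltW.
  by apply: le_ball yb; rewrite /e /= -/eN; exact: ltW.
apply: countable_bigcupT_measurable => [|p]; first exact: countableP.
by case: asboolP => _ //; exact: measurable_rV_ball.
Qed.

Lemma continuous_caratheodory (D : set T) (f : 'rV[R]_n -> R) :
  continuous f -> measurable_fun D (f : T -> R).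
Proof.
move=> cf; apply: (@measurable_funS _ _ _ _ [set: T]) => //.
apply: (measurability _ (RGenOInfty.measurableE R)).
move=> _ [_ [a ->] <-]; rewrite setTI.
apply: open_caratheodory; apply: open_comp => [x _|]; first exact: cf.
exact: interval_open.
Qed.

End BorelMeasurable.

(** Vectors are [1 x n] matrices, so this single pairing serves for [vdot], through [vdotE], and for
    [tdot], by conversion. *)
Definition mdot (R : realType) m p (A B : 'M[R]_(m, p)) : R :=
  \sum_i \sum_j A i j * B i j.

Section Mdot.
Context (R : realType) (m p : nat).
Implicit Types A B C : 'M[R]_(m, p).

Lemma mdotC A B : mdot A B = mdot B A.
Proof. by apply: eq_bigr => i _; apply: eq_bigr => j _; rewrite mulrC. Qed.

Lemma mdot_linl a A B C : mdot (a *: A + B) C = a * mdot A C + mdot B C.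
Proof.
rewrite /mdot mulr_sumr -big_split /=; apply: eq_bigr => i _.
rewrite mulr_sumr -big_split /=; apply: eq_bigr => j _.
by rewrite !mxE mulrDl mulrA.
Qed.

Lemma mdot_ge0 A : 0 <= mdot A A.
Proof. by do 2![apply: sumr_ge0 => ? _]; rewrite -expr2 sqr_ge0. Qed.

Definition mdot_preip : preip R 'M[R]_(m, p) :=
  @PreIp R 'M[R]_(m, p) (@mdot R m p) (fun a A B => a *: A + B)
    mdotC mdot_linl mdot_ge0.

Lemma mdot_eq0 A : mdot A A = 0 -> A = 0.
Proof.
move=> A0; apply/matrixP => i j; rewrite mxE; apply/eqP; rewrite -sqrf_eq0 expr2.
have pos k : 0 <= \sum_l A k l * A k l by apply: sumr_ge0 => l _; rewrite -expr2 sqr_ge0.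
have /psumr_eq0P : forall k, true -> 0 <= \sum_l A k l * A k l by [].
move=> /(_ A0 i isT).
by move=> /psumr_eq0P -> // l _; rewrite -expr2 sqr_ge0.
Qed.

Lemma mdot0 B : mdot 0 B = 0.
Proof. by rewrite /mdot big1 // => i _; rewrite big1 // => j _; rewrite mxE mul0r. Qed.

Lemma mdotZl a A B : mdot (a *: A) B = a * mdot A B.
Proof. by have := mdot_linl a A 0 B; rewrite addr0 mdot0 addr0. Qed.

Lemma mdotDl A B C : mdot (A + B) C = mdot A C + mdot B C.
Proof. by have := mdot_linl 1 A B C; rewrite scale1r mul1r. Qed.

Lemma mdotDr A B C : mdot C (A + B) = mdot C A + mdot C B.
Proof. by rewrite mdotC mdotDl !(mdotC _ C). Qed.

Lemma mdotZr a A B : mdot A (a *: B) = a * mdot A B.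
Proof. by rewrite mdotC mdotZl (mdotC B). Qed.

Lemma mdot_sqrD_le A B : mdot (A + B) (A + B) <= 2 * mdot A A + 2 * mdot B B.
Proof.
have := mdot_ge0 (A + (-1) *: B).
by rewrite !(mdotDl, mdotDr, mdotZl, mdotZr) (mdotC B A); lra.
Qed.

End Mdot.

(** * Matrix fields in L^2 *)

Section MatrixL2.
Context d (T : measurableType d) (R : realType) (mu : {measure set T -> \bar R}).
Context (D : set T) (mD : measurable D) (m p : nat).
Implicit Types A B C : T -> 'M[R]_(m, p).

Definition measurable_mx A := forall i j, measurable_fun D (fun x => A x i j).

Definition L2m A := forall i j, sq_integrable mu D (fun x => A x i j).

Lemma L2m_measurable A : L2m A -> measurable_mx A.
Proof. by move=> hA i j; have [] := hA i j. Qed.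

Lemma measurable_mdot A B : measurable_mx A -> measurable_mx B ->
  measurable_fun D (fun x => mdot (A x) (B x)).
Proof.
move=> mA mB; apply: measurable_sum => i; apply: measurable_sum => j.
exact: measurable_funM.
Qed.

Lemma measurable_mx_lin a A B : measurable_mx A -> measurable_mx B ->
  measurable_mx (fun x => a *: A x + B x).
Proof.
move=> mA mB i j; under eq_fun do rewrite !mxE.
by apply: measurable_funD => //; apply: measurable_funM.
Qed.

(* The integrals may be infinite here. *)
Lemma integral_mdotD_le A B : measurable_mx A -> measurable_mx B ->
  (\int[mu]_(x in D) (mdot (A x + B x) (A x + B x))%:E <=
   2%:E * \int[mu]_(x in D) (mdot (A x) (A x))%:E +
   2%:E * \int[mu]_(x in D) (mdot (B x) (B x))%:E)%E.
Proof.
move=> mA mB.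
have mAA := measurable_mdot mA mA; have mBB := measurable_mdot mB mB.
have mAB : measurable_mx (fun x => A x + B x).
  by have := measurable_mx_lin 1 mA mB; under eq_fun do rewrite scale1r.
have Z C : measurable_mx C -> (2%:E * \int[mu]_(x in D) (mdot (C x) (C x))%:E =
    \int[mu]_(x in D) (2 * mdot (C x) (C x))%:E)%E.
  move=> mC; under [RHS]eq_integral do rewrite EFinM.
  rewrite ge0_integralZl //.
  - by apply/measurable_EFinP; exact: measurable_mdot.
  - by move=> x _; rewrite lee_fin mdot_ge0.
rewrite !Z // -ge0_integralD //.
- apply: ge0_le_integral => //.
  + by move=> x _; rewrite lee_fin mdot_ge0.
  + by apply/measurable_EFinP; exact: measurable_mdot.
  + by apply: emeasurable_funD; apply/measurable_EFinP; exact: measurable_funM.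
  + by move=> x _; rewrite -EFinD lee_fin mdot_sqrD_le.
- by move=> x _; rewrite lee_fin mulr_ge0 ?mdot_ge0.
- by apply/measurable_EFinP; apply: measurable_funM.
- by move=> x _; rewrite lee_fin mulr_ge0 ?mdot_ge0.
- by apply/measurable_EFinP; apply: measurable_funM.
Qed.

Lemma L2m_lin a A B : L2m A -> L2m B -> L2m (fun x => a *: A x + B x).
Proof.
move=> hA hB i j; under eq_fun do rewrite !mxE.
exact: (sq_integrable_lin mD a (hA i j) (hB i j)).
Qed.

Lemma L2m0 : L2m (fun=> 0).
Proof. by move=> i j; under eq_fun do rewrite mxE; exact: sq_integrable0. Qed.

Lemma L2mB A B : L2m A -> L2m B -> L2m (fun x => A x - B x).
Proof.
move=> hA hB; have := L2m_lin (-1) hB hA.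
by under eq_fun do rewrite scaleN1r addrC.
Qed.

Lemma L2m_bounded_mul (c : T -> R) (M : R) A : measurable_fun D c ->
  {ae mu, forall x, D x -> `|c x| <= M} -> L2m A -> L2m (fun x => c x *: A x).
Proof.
move=> mc cM hA i j; under eq_fun do rewrite !mxE.
exact: (sq_integrable_bounded_mul mD mc cM (hA i j)).
Qed.

Lemma integrable_mdot A B : L2m A -> L2m B ->
  mu.-integrable D (fun x => (mdot (A x) (B x))%:E).
Proof.
move=> hA hB; rewrite /mdot; under eq_fun do rewrite -sumEFin.
apply: integrable_sum => // i _; under eq_fun do rewrite -sumEFin.
by apply: integrable_sum => // j _; exact: sq_integrableM.
Qed.

Definition ipm A B : R := \int[mu]_(x in D) mdot (A x) (B x).

Lemma ipmC A B : ipm A B = ipm B A.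
Proof. by apply: eq_Rintegral => x _; rewrite mdotC. Qed.

Lemma ipm_linl a A B C : L2m A -> L2m B -> L2m C ->
  ipm (fun x => a *: A x + B x) C = a * ipm A C + ipm B C.
Proof.
move=> hA hB hC; rewrite /ipm -RintegralZl //; last exact: integrable_mdot.
rewrite -RintegralD //; last exact: integrable_mdot.
  by apply: eq_Rintegral => x _; rewrite mdot_linl.
under [X in integrable _ _ X]eq_fun do rewrite /= EFinM.
by apply: integrableZl => //; exact: integrable_mdot.
Qed.

Lemma ipm_linr a A B C : L2m A -> L2m B -> L2m C ->
  ipm C (fun x => a *: A x + B x) = a * ipm C A + ipm C B.
Proof. by move=> hA hB hC; rewrite ipmC ipm_linl // !(ipmC C). Qed.

Lemma ipm_ge0 A : 0 <= ipm A A.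
Proof. by apply: Rintegral_ge0 => x _; exact: mdot_ge0. Qed.

Definition nrmm A : R := Num.sqrt (ipm A A).

Lemma nrmm_ge0 A : 0 <= nrmm A. Proof. exact: sqrtr_ge0. Qed.

Lemma sqr_nrmm A : nrmm A ^+ 2 = ipm A A.
Proof. by rewrite sqr_sqrtr // ipm_ge0. Qed.

Definition L2M := {A : T -> 'M[R]_(m, p) | L2m A}.

Definition L2Mlin a (A B : L2M) : L2M :=
  exist _ _ (L2m_lin a (svalP A) (svalP B)).

Definition L2Mpreip : preip R L2M :=
  @PreIp R L2M (fun f g => ipm (sval f) (sval g)) L2Mlin
    (fun f g => ipmC (sval f) (sval g))
    (fun a f g h => ipm_linl a (svalP f) (svalP g) (svalP h))
    (fun f => ipm_ge0 (sval f)).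

Lemma ipm_cs A B : L2m A -> L2m B -> `|ipm A B| <= nrmm A * nrmm B.
Proof.
by move=> hA hB; exact: (ip_cauchy_schwarz L2Mpreip (exist _ _ hA) (exist _ _ hB)).
Qed.

Lemma nrmm_lin a A B : L2m A -> L2m B ->
  nrmm (fun x => a *: A x + B x) <= `|a| * nrmm A + nrmm B.
Proof.
by move=> hA hB; exact: (nrm_lin L2Mpreip a (exist _ _ hA) (exist _ _ hB)).
Qed.

Lemma nrmmD A B : L2m A -> L2m B -> nrmm (fun x => A x + B x) <= nrmm A + nrmm B.
Proof.
move=> hA hB; have := nrmm_lin 1 hA hB; rewrite normr1 mul1r.
by under eq_fun do rewrite scale1r.
Qed.

Lemma Rintegral_sum (I : Type) (s : seq I) (F : I -> T -> R) :
  (forall i, mu.-integrable D (fun x => (F i x)%:E)) ->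
  \int[mu]_(x in D) (\sum_(i <- s) F i x) = \sum_(i <- s) \int[mu]_(x in D) F i x.
Proof.
move=> iF; elim: s => [|i s IH].
  rewrite big_nil; under eq_Rintegral do rewrite big_nil.
  by rewrite Rintegral_cst // mul0r.
rewrite big_cons -IH -RintegralD //.
- by apply: eq_Rintegral => x _; rewrite big_cons.
- exact: iF.
apply: (@eq_integrable _ _ _ mu D mD (fun x => (\sum_(j <- s) (F j x)%:E)%E)).
  by move=> x _; rewrite /= sumEFin.
by apply: integrable_sum.
Qed.

Lemma ipm_entries A B : L2m A -> L2m B ->
  ipm A B = \sum_i \sum_j \int[mu]_(x in D) (A x i j * B x i j).
Proof.
move=> hA hB; rewrite /ipm /mdot.
have I i j : mu.-integrable D (fun x => (A x i j * B x i j)%:E).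
  exact: sq_integrableM.
rewrite Rintegral_sum => [|i].
  by apply: eq_bigr => i _; rewrite Rintegral_sum.
under eq_fun do rewrite -sumEFin.
by apply: integrable_sum.
Qed.

Definition entry (A : L2M) i j : L2 mu D := exist _ _ (svalP A i j).

Lemma dist_entries (A B : L2M) : dist L2Mpreip A B ^+ 2 =
  \sum_i \sum_j dist (L2preip mu mD) (entry A i j) (entry B i j) ^+ 2.
Proof.
rewrite sqr_nrm [LHS]ipm_entries; [|exact: svalP..].
apply: eq_bigr => i _; apply: eq_bigr => j _.
rewrite sqr_nrm; apply: eq_Rintegral => x _ /=.
by rewrite !mxE.
Qed.

Lemma le_dist_entry (f g : L2M) i j :
  dist (L2preip mu mD) (entry f i j) (entry g i j) <= dist L2Mpreip f g.
Proof.
rewrite -ler_sqr ?nnegrE ?dist_ge0 // dist_entries.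
rewrite (bigD1 i) //= (bigD1 j) //= -addrA lerDl addr_ge0 //.
  by apply: sumr_ge0 => l _; exact: sqr_ge0.
by apply: sumr_ge0 => k _; apply: sumr_ge0 => l _; exact: sqr_ge0.
Qed.

Lemma cvg_sqr0 (u : nat -> R) : (forall k, 0 <= u k) ->
  u k ^+ 2 @[k --> \oo] --> 0 -> u k @[k --> \oo] --> 0.
Proof.
move=> u0 cu; apply/cvgrPdist_le => e e0.
have e20 : 0 < e ^+ 2 by rewrite exprn_gt0.
have /cvgrPdist_le/(_ _ e20)[N _ HN] := cu; exists N => // k Nk.
have := HN k Nk; rewrite /= !sub0r !normrN ger0_norm ?sqr_ge0 // => h.
by rewrite ger0_norm // -ler_sqr ?nnegrE ?u0 ?(ltW e0).
Qed.

Lemma cvg_sum0 (I : Type) (s : seq I) (F : I -> nat -> R) :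
  (forall i, F i k @[k --> \oo] --> 0) ->
  \sum_(i <- s) F i k @[k --> \oo] --> 0.
Proof.
move=> cF; elim: s => [|i s IH].
  rewrite (_ : (fun k => \sum_(j <- [::]) F j k) = (fun=> (0 : R))); first exact: cvg_cst.
  by apply/funext => k; rewrite big_nil.
rewrite (_ : (fun k => \sum_(j <- i :: s) F j k) = (fun k => F i k + \sum_(j <- s) F j k)).
  by have := cvgD (cF i) IH; rewrite addr0; exact.
by apply/funext => k; rewrite big_cons.
Qed.

(** Squared distances are finite sums of squared distances of entries, so the limit is assembled
    from scalar [L^2] limits. *)
Lemma L2M_complete : ip_complete L2Mpreip (fun=> True).
Proof.
move=> u _ cu.
have /choice[F HF] : forall ij : 'I_m * 'I_p, exists f : L2 mu D,
    dist (L2preip mu mD) (entry (u k) ij.1 ij.2) f @[k --> \oo] --> 0.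
  move=> [i j]; have [||f _ Hf] := @L2_complete _ _ _ mu D mD (fun k => entry (u k) i j).
  - by [].
  - move=> e e0; have [N HN] := cu e e0; exists N => a b Na Nb.
    exact: le_trans (le_dist_entry _ _ _ _) (HN _ _ Na Nb).
  - by exists f.
pose G x := \matrix_(i, j) sval (F (i, j)) x.
have hG : L2m G.
  by move=> i j; rewrite /G; under eq_fun do rewrite mxE; exact: svalP.
exists (exist _ G hG) => //.
apply: cvg_sqr0 => [k|]; first exact: dist_ge0.
rewrite (_ : (fun k => _ ^+ 2) = (fun k => \sum_i \sum_j
   dist (L2preip mu mD) (entry (u k) i j) (entry (exist _ G hG) i j) ^+ 2));
  last by apply/funext => k; rewrite dist_entries.
apply: cvg_sum0 => i; apply: cvg_sum0 => j.
have E k : dist (L2preip mu mD) (entry (u k) i j) (entry (exist _ G hG) i j) =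
           dist (L2preip mu mD) (entry (u k) i j) (F (i, j)).
  congr Num.sqrt; apply: eq_Rintegral => x _ /=; by rewrite /G !mxE.
have := HF (i, j) => /= h.
rewrite (_ : (fun k => _ ^+ 2) = (fun k => dist (L2preip mu mD) (entry (u k) i j) (F (i, j)) *
   dist (L2preip mu mD) (entry (u k) i j) (F (i, j)))).
  by have := cvgM h h; rewrite mul0r; exact.
by apply/funext => k; rewrite E expr2.
Qed.

End MatrixL2.

(** * Sobolev spaces *)

Section SmoothFields.
Context (R : realType) (n : nat).
Implicit Types f g : 'rV[R]_n -> R.

Lemma pderivs_lin a f g : smooth f -> smooth g -> forall s,
  pderivs s (fun x => a * f x + g x) = (fun x => a * pderivs s f x + pderivs s g x).
Proof.
move=> sf sg; elim=> [//|j s IH]; rewrite /= IH; apply/funext => x.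
have [_ df] := sf s; have [_ dg] := sg s.
rewrite /pderiv.
have -> : (fun x0 => a * pderivs s f x0 + pderivs s g x0) =
   (a \*: pderivs s f) + pderivs s g by [].
rewrite deriveD; [|exact: derivableZ|exact: dg].
by rewrite deriveZ.
Qed.

Lemma smooth_lin a f g : smooth f -> smooth g -> smooth (fun x => a * f x + g x).
Proof.
move=> sf sg s; rewrite pderivs_lin //.
have [cf df] := sf s; have [cg dg] := sg s; split=> [x|j x].
  apply: (@continuousD R R _ (fun x => a * pderivs s f x)); last exact: cg.
  apply: (@continuousM R _ (fun=> a)); last exact: cf.
  exact: cst_continuous.
have -> : (fun x0 => a * pderivs s f x0 + pderivs s g x0) =
   (a \*: pderivs s f) + pderivs s g by [].
by apply: derivableD; [exact: derivableZ|exact: dg].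
Qed.

Lemma pderivs0 s : pderivs s ((fun=> 0) : 'rV[R]_n -> R) = (fun=> 0).
Proof.
by elim: s => //= j s ->; apply/funext => x; rewrite /pderiv derive_cst.
Qed.

Lemma smooth0 : smooth ((fun=> 0) : 'rV[R]_n -> R).
Proof. by move=> s; rewrite pderivs0; split => [|j x]; [exact: cst_continuous|exact: derivable_cst]. Qed.

Lemma smooth_continuous f : smooth f -> continuous f.
Proof. by move=> /(_ [::])[]. Qed.

Lemma smooth_pderiv_continuous f j : smooth f -> continuous (pderiv j f).
Proof. by move=> /(_ [:: j])[]. Qed.

Lemma test_function_lin Omega a f g : test_function Omega f ->
  test_function Omega g -> test_function Omega (fun x => a * f x + g x).
Proof.
move=> [sf cf fO] [sg cg gO].
have sub : closure [set x | a * f x + g x != 0] `<=`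
    closure [set x | f x != 0] `|` closure [set x | g x != 0].
  rewrite -closureU; apply: closure_subset => x /=.
  have [->|] := eqVneq (f x) 0; last by left.
  by rewrite mulr0 add0r; right.
split; first exact: smooth_lin.
  apply: (@subclosed_compact _ _ (closure [set x | f x != 0] `|` closure [set x | g x != 0])) => //.
    exact: closed_closure.
  exact: compactU.
by move=> x /sub [/fO|/gO].
Qed.

Lemma test_function0 Omega : test_function Omega ((fun=> 0) : 'rV[R]_n -> R).
Proof.
have E : [set x : 'rV[R]_n | (0 : R) != 0] = set0.
  by rewrite -subset0 => x /=; rewrite eqxx.
by split; rewrite ?E ?closure0 //; [exact: smooth0|exact: compact0].
Qed.

Lemma cgrad_lin a (u v : vfield R n) :
  (forall i, smooth (fun x => u x ord0 i)) ->
  (forall i, smooth (fun x => v x ord0 i)) ->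
  cgrad (fun x => a *: u x + v x) = (fun x => a *: cgrad u x + cgrad v x).
Proof.
move=> su sv; apply/funext => x; apply/matrixP => i j; rewrite !mxE.
have -> : (fun y => (a *: u y + v y) ord0 i) = (fun y => a * u y ord0 i + v y ord0 i).
  by apply/funext => y; rewrite !mxE.
exact: (congr1 (@^~ x) (pderivs_lin a (su i) (sv i) [:: j])).
Qed.

(** Continuity holds on the whole space, so the bounded set can be enlarged to a compact ball.
    Smooth functions and their derivatives thereby become square integrable on the domain. *)
Lemma continuous_bounded_on (A : set 'rV[R]_n) f : bounded_set A -> continuous f ->
  exists M, forall x, A x -> `|f x| <= M.
Proof.
move=> bA cf; have [M [Mr AM]] := bA.
pose K := [set x : 'rV[R]_n | `|x| <= M + 1].
have cK : compact K.
  apply: bounded_closed_compact.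
    by exists (M + 1); split; [exact: num_real|move=> y My x Kx; exact: le_trans Kx (ltW My)].
  apply: (@closed_comp _ _ (fun x : 'rV[R]_n => `|x|) [set y | y <= M + 1]).
    by move=> x _; exact: norm_continuous.
  exact: closed_le.
have /compact_bounded[N [_ HN]] : compact (f @` K).
  by apply: continuous_compact => //; exact: continuous_subspaceT.
exists (N + 1) => x Ax; apply: HN; first by rewrite ltrDl.
by exists x => //; apply: AM => //; rewrite ltrDl.
Qed.

End SmoothFields.

Section Domain.
Context (R : realType) (n : nat) (Omega : set 'rV[R]_n).
Hypotheses (oO : open Omega) (bO : bounded_set Omega).
Local Notation T := (caratheodory_type (leb_om R n)).

Lemma measurable_domain : measurable (Omega : set T).
Proof. exact: (open_caratheodory (@lebesgue_half_space R n) oO). Qed.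

Lemma domain_finite : (lebR R n Omega < +oo)%E.
Proof. exact: lebesgue_bounded. Qed.

Lemma continuous_measurable_domain (D : set T) (f : 'rV[R]_n -> R) :
  continuous f -> measurable_fun D (f : T -> R).
Proof. exact: (continuous_caratheodory (@lebesgue_half_space R n)). Qed.

Lemma bounded_sq_integrable (f : T -> R) (M : R) : measurable_fun (Omega : set T) f ->
  (forall x, Omega x -> `|f x| <= M) -> sq_integrable (lebR R n) Omega f.
Proof.
move=> mf fM; split => //.
apply: (@le_integrable _ _ _ (lebR R n) Omega measurable_domain _ (cst (M ^+ 2)%:E)).
- by apply/measurable_EFinP; exact: measurable_funX.
- move=> x Ox; rewrite !abse_EFin lee_fin !ger0_norm ?sqr_ge0 //.
  rewrite -real_normK ?num_real // ler_pXn2r ?nnegrE ?fM //.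
  exact: le_trans (fM x Ox).
- apply/integrableP; split; first exact: measurable_cst.
  rewrite /cst; under eq_integral do rewrite gee0_abs ?lee_fin ?sqr_ge0 //.
  rewrite integral_cst; last exact: measurable_domain.
  by rewrite lte_mul_pinfty ?lee_fin ?sqr_ge0 // domain_finite.
Qed.

Lemma continuous_sq_integrable (f : 'rV[R]_n -> R) : continuous f ->
  sq_integrable (lebR R n) Omega f.
Proof.
move=> cf; have [M fM] := continuous_bounded_on bO cf.
by apply: bounded_sq_integrable fM; exact: continuous_measurable_domain.
Qed.

End Domain.

Section Limits.
Context (R : realType).

Lemma le_cvg0_eq0 (S C : R) (e : nat -> R) :
  (forall k, `|S| <= C * e k) -> e k @[k --> \oo] --> 0 -> S = 0.
Proof.
move=> Se ce; apply/eqP; rewrite -normr_le0.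
have cC : C * e k @[k --> \oo] --> 0.
  by rewrite -[X in _ --> X](mulr0 C); apply: cvgMr.
apply/ler_addgt0Pr => d d0; rewrite add0r.
have /cvgrPdist_le/(_ _ d0)[N _ /(_ N (leqnn _))] := cC.
rewrite /= sub0r normrN => h; apply: le_trans (Se N) _.
exact: le_trans (ler_norm _) h.
Qed.

Lemma ecvg0P (a : nat -> \bar R) : (forall k, 0 <= a k)%E ->
  (a k @[k --> \oo] --> 0%E) <->
  (forall e : R, 0 < e -> exists N, forall k, (N <= k)%N -> (a k <= e%:E)%E).
Proof.
move=> a0; split=> [/fine_cvgP[[N1 _ HN1] ca] e e0|H].
  have /cvgrPdist_le/(_ _ e0)[N2 _ HN2] := ca.
  exists (maxn N1 N2) => k; rewrite geq_max => /andP[k1 k2].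
  rewrite -(fineK (HN1 k k1)) lee_fin.
  have := HN2 k k2; rewrite /= sub0r normrN ger0_norm //.
  exact: fine_ge0.
apply/fine_cvgP; split.
  have [N HN] := H 1 ltr01; exists N => // k Nk.
  by rewrite ge0_fin_numE // (le_lt_trans (HN k Nk)) // ltry.
apply/cvgrPdist_le => e e0; have [N HN] := H e e0; exists N => // k Nk.
rewrite /= sub0r normrN ger0_norm ?fine_ge0 // -lee_fin fineK ?HN //.
by rewrite ge0_fin_numE // (le_lt_trans (HN k Nk)) // ltry.
Qed.

Lemma cvg0P (d : nat -> R) : (forall k, 0 <= d k) ->
  (d k @[k --> \oo] --> 0) <->
  (forall e : R, 0 < e -> exists N, forall k, (N <= k)%N -> d k <= e).
Proof.
move=> d0; split=> [/cvgrPdist_le H e e0|H].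
  have [N _ HN] := H e e0; exists N => k Nk.
  by have := HN k Nk; rewrite /= sub0r normrN ger0_norm.
apply/cvgrPdist_le => e e0; have [N HN] := H e e0; exists N => // k Nk.
by rewrite /= sub0r normrN ger0_norm ?HN.
Qed.

End Limits.

Section Sobolev.
Context (R : realType) (n : nat) (Omega : set 'rV[R]_n).
Hypotheses (oO : open Omega) (bO : bounded_set Omega).
Local Notation T := (caratheodory_type (leb_om R n)).
Local Notation mu := (lebR R n).
Let mO : measurable (Omega : set T) := measurable_domain oO.

Lemma vdotE (x y : 'rV[R]_n) : vdot x y = mdot x y.
Proof. by rewrite /mdot big_ord1. Qed.

Lemma L2vE (u : vfield R n) : L2v Omega u <-> @L2m _ T R mu Omega 1 n u.
Proof. by split=> [h i j|h j]; [rewrite (ord1 i); exact: h|exact: h]. Qed.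

Lemma norm0vE (u : vfield R n) : norm0v Omega u = @nrmm _ T R mu Omega 1 n u.
Proof.
by congr Num.sqrt; apply: eq_Rintegral => x _; rewrite vdotE.
Qed.

Lemma norm0tE (A : tfield R n) : norm0t Omega A = @nrmm _ T R mu Omega n n A.
Proof. by []. Qed.

Lemma test_sq (f : 'rV[R]_n -> R) : smooth f -> sq_integrable mu Omega f.
Proof. by move=> /smooth_continuous; exact: continuous_sq_integrable. Qed.

Lemma test_pderiv_sq (f : 'rV[R]_n -> R) j : smooth f -> sq_integrable mu Omega (pderiv j f).
Proof. by move=> sf; apply: continuous_sq_integrable => //; exact: smooth_pderiv_continuous. Qed.

Lemma intO_lin a (f g h : T -> R) : sq_integrable mu Omega f ->
  sq_integrable mu Omega g -> sq_integrable mu Omega h ->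
  intO Omega (fun x => (a * f x + g x) * h x) =
  a * intO Omega (fun x => f x * h x) + intO Omega (fun x => g x * h x).
Proof.
move=> sf sg sh.
exact: (L2ip_lin mO a (exist _ f sf) (exist _ g sg) (exist _ h sh)).
Qed.

Lemma eq_intO (f g : 'rV[R]_n -> R) : f =1 g -> intO Omega f = intO Omega g.
Proof. by move=> fg; congr intO; apply/funext. Qed.

Lemma intO0 : intO Omega (fun=> 0) = 0.
Proof. by rewrite /intO Rintegral_cst // mul0r. Qed.

Lemma weak_grad_lin a (u v : H1 Omega) :
  weak_grad Omega (fun x => a *: u x + v x) (fun x => a *: grad u x + grad v x).
Proof.
move=> f i j tf; have [sf _ _] := tf.
have := intO_lin a (h1_L2 u i) (h1_L2 v i) (test_pderiv_sq j sf).
rewrite (gradP u i j tf) (gradP v i j tf) => h1.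
have h2 := intO_lin a (grad_L2 u i j) (grad_L2 v i j) (test_sq sf).
rewrite [LHS](eq_intO (g := fun x => (a * u x ord0 i + v x ord0 i) * pderiv j f x)).
  rewrite h1 [in RHS](eq_intO (g := fun x => (a * grad u x i j + grad v x i j) * f x)).
    by rewrite h2 mulrN opprD.
  by move=> x; rewrite !mxE.
by move=> x; rewrite !mxE.
Qed.

Lemma h1_L2m (u : H1 Omega) : @L2m _ T R mu Omega 1 n u.
Proof. by apply/L2vE; exact: h1_L2. Qed.

Definition h1lin a (u v : H1 Omega) : H1 Omega :=
  Build_H1 (proj2 (L2vE _) (L2m_lin mO a (h1_L2m u) (h1_L2m v)))
    (L2m_lin mO a (grad_L2 u) (grad_L2 v)) (weak_grad_lin a u v).

Lemma weak_grad0 : weak_grad Omega (fun=> 0) (fun=> 0).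
Proof.
move=> f i j _.
rewrite (eq_intO (g := fun=> 0)) => [|x]; last by rewrite mxE mul0r.
rewrite [in RHS](eq_intO (g := fun=> 0)) => [|x]; last by rewrite mxE mul0r.
by rewrite intO0 oppr0.
Qed.

Definition h1zero : H1 Omega :=
  Build_H1 (proj2 (L2vE _) (@L2m0 _ T R mu Omega 1 n))
    (@L2m0 _ T R mu Omega n n) weak_grad0.

Definition h1ip (u v : H1 Omega) : R :=
  @ipm _ T R mu Omega 1 n u v + @ipm _ T R mu Omega n n (grad u) (grad v).

Definition h1preip : preip R (H1 Omega).
Proof.
refine (@PreIp R (H1 Omega) h1ip h1lin _ _ _).
- by move=> u v; rewrite /h1ip ipmC [X in _ + X]ipmC.
- move=> a u v w.
  have e1 := ipm_linl mO a (h1_L2m u) (h1_L2m v) (h1_L2m w).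
  have e2 := ipm_linl mO a (grad_L2 u) (grad_L2 v) (grad_L2 w).
  by apply: (etrans (congr2 +%R e1 e2)); rewrite addrACA -mulrDr.
- by move=> u; rewrite addr_ge0 // ipm_ge0.
Defined.

Lemma norm1E (u : H1 Omega) : norm1 u = nrm h1preip u.
Proof.
by rewrite /norm1 norm0vE /semi1 norm0tE !sqr_nrmm.
Qed.

Definition h1v (u : H1 Omega) : @L2M _ T R mu Omega 1 n := exist _ _ (h1_L2m u).
Definition h1g (u : H1 Omega) : @L2M _ T R mu Omega n n := exist _ _ (grad_L2 u).

Lemma sqr_dist1 (u v : H1 Omega) : dist h1preip u v ^+ 2 =
  dist (L2Mpreip mu mO 1 n) (h1v u) (h1v v) ^+ 2 +
  dist (L2Mpreip mu mO n n) (h1g u) (h1g v) ^+ 2.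
Proof. by rewrite !sqr_nrm. Qed.

Lemma dist1_h1v (u v : H1 Omega) :
  dist (L2Mpreip mu mO 1 n) (h1v u) (h1v v) <= dist h1preip u v.
Proof.
rewrite -ler_sqr ?nnegrE ?dist_ge0 // sqr_dist1.
by rewrite lerDl sqr_ge0.
Qed.

Lemma dist1_h1g (u v : H1 Omega) :
  dist (L2Mpreip mu mO n n) (h1g u) (h1g v) <= dist h1preip u v.
Proof.
rewrite -ler_sqr ?nnegrE ?dist_ge0 // sqr_dist1.
by rewrite lerDr sqr_ge0.
Qed.

Lemma intO_entry m p (A : @L2M _ T R mu Omega m p) i j (h : L2 mu (Omega : set T)) :
  intO Omega (fun x => sval A x i j * sval h x) = L2preip mu mO (entry A i j) h.
Proof. by []. Qed.

Lemma intO_entry_dist m p (A B : @L2M _ T R mu Omega m p) i j (h : L2 mu (Omega : set T)) :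
  `|intO Omega (fun x => sval A x i j * sval h x) -
    intO Omega (fun x => sval B x i j * sval h x)| <=
  dist (L2Mpreip mu mO m p) A B * nrm (L2preip mu mO) h.
Proof.
rewrite !intO_entry ler_norml.
have key A' B' : L2preip mu mO (entry A' i j) h - L2preip mu mO (entry B' i j) h <=
   dist (L2Mpreip mu mO m p) A' B' * nrm (L2preip mu mO) h.
  apply: (le_trans (dist_ip _ _ _ _)).
  by rewrite ler_wpM2r ?nrm_ge0 // le_dist_entry.
have k1 := key A B; have k2 := key B A.
by rewrite k1 andbT lerNl opprB distC k2.
Qed.

(** Fields and gradients converge separately in [L^2]. The weak derivative identity passes to the
    limit because each of its sides is a pairing with a fixed square integrable function. *)
Lemma h1_complete : ip_complete h1preip (fun=> True).
Proof.
move=> u _ cu.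
have cv : cauchy_for (dist (L2Mpreip mu mO 1 n)) (fun k => h1v (u k)).
  move=> e e0; have [N HN] := cu e e0; exists N => a b Na Nb.
  exact: le_trans (dist1_h1v _ _) (HN _ _ Na Nb).
have cg : cauchy_for (dist (L2Mpreip mu mO n n)) (fun k => h1g (u k)).
  move=> e e0; have [N HN] := cu e e0; exists N => a b Na Nb.
  exact: le_trans (dist1_h1g _ _) (HN _ _ Na Nb).
have [v _ Hv] := L2M_complete (fun=> I) cv.
have [G _ HG] := L2M_complete (fun=> I) cg.
have wg : weak_grad Omega (sval v) (sval G).
  move=> f i j tf; have [sf _ _] := tf.
  pose hf : L2 mu (Omega : set T) := exist _ _ (test_sq sf).
  pose hd : L2 mu (Omega : set T) := exist _ _ (test_pderiv_sq j sf).
  apply/eqP; rewrite -addr_eq0; apply/eqP.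
  apply: (@le_cvg0_eq0 R _ (nrm (L2preip mu mO) hf + nrm (L2preip mu mO) hd)
     (fun k => dist (L2Mpreip mu mO 1 n) (h1v (u k)) v +
               dist (L2Mpreip mu mO n n) (h1g (u k)) G)); last first.
    by have := cvgD Hv HG; rewrite addr0; exact.
  move=> k.
  have h1 := intO_entry_dist (h1v (u k)) v ord0 i hd.
  have h2 := intO_entry_dist (h1g (u k)) G i j hf.
  have := gradP (u k) i j tf => h3.
  rewrite /= in h1 h2; rewrite h3 in h1.
  set S := _ + _.
  set D1 := dist _ (h1v _) _ in h1 *; set D2 := dist _ (h1g _) _ in h2 *.
  have d1 : 0 <= D1 by exact: dist_ge0.
  have d2 : 0 <= D2 by exact: dist_ge0.
  apply: (@le_trans _ _ (D1 * nrm (L2preip mu mO) hd + D2 * nrm (L2preip mu mO) hf)).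
    move: h1 h2; rewrite !ler_norml => /andP[? ?] /andP[? ?]; apply/andP; split;
    rewrite /S; lra.
  have := mulr_ge0 d1 (nrm_ge0 (L2preip mu mO) hf).
  have := mulr_ge0 d2 (nrm_ge0 (L2preip mu mO) hd).
  by lra.
exists (Build_H1 (proj2 (L2vE _) (svalP v)) (svalP G) wg) => //.
apply/(cvg0P (fun k => dist_ge0 _ _ _)) => e e0.
have e20 : 0 < e / 2 by rewrite divr_gt0.
move/(cvg0P (fun k => dist_ge0 _ _ _)) : Hv => /(_ _ e20)[N1 HN1].
move/(cvg0P (fun k => dist_ge0 _ _ _)) : HG => /(_ _ e20)[N2 HN2].
exists (maxn N1 N2) => k; rewrite geq_max => /andP[k1 k2].
have := HN1 k k1; have := HN2 k k2.
set w := Build_H1 _ _ _.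
have -> : dist (L2Mpreip mu mO 1 n) (h1v (u k)) v =
          dist (L2Mpreip mu mO 1 n) (h1v (u k)) (h1v w) by [].
have -> : dist (L2Mpreip mu mO n n) (h1g (u k)) G =
          dist (L2Mpreip mu mO n n) (h1g (u k)) (h1g w) by [].
move=> l1 l2.
apply: (@le_trans _ _ (dist (L2Mpreip mu mO 1 n) (h1v (u k)) (h1v w) +
   dist (L2Mpreip mu mO n n) (h1g (u k)) (h1g w))); last by lra.
rewrite -ler_sqr ?nnegrE ?addr_ge0 ?dist_ge0 // sqr_dist1 sqrrD.
by rewrite lerD2r lerDl mulrn_wge0 // mulr_ge0 // dist_ge0.
Qed.

End Sobolev.

Section ExtendedLimits.
Context (R : realType).

Lemma ecvg0_lin (A B : R) (a b c : nat -> \bar R) : 0 <= A -> 0 <= B ->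
  (forall k, 0 <= a k)%E -> (forall k, 0 <= b k)%E -> (forall k, 0 <= c k)%E ->
  (forall k, c k <= A%:E * a k + B%:E * b k)%E ->
  a k @[k --> \oo] --> 0%E -> b k @[k --> \oo] --> 0%E -> c k @[k --> \oo] --> 0%E.
Proof.
move=> A0 B0 a0 b0 c0 cab /(ecvg0P a0) Ha /(ecvg0P b0) Hb.
apply/(ecvg0P c0) => e e0.
pose C := A + B + 1.
have C0 : 0 < C by rewrite /C; lra.
have d0 : 0 < e / C by rewrite divr_gt0.
have [N1 H1] := Ha _ d0; have [N2 H2] := Hb _ d0.
exists (maxn N1 N2) => k; rewrite geq_max => /andP[k1 k2].
apply: (le_trans (cab k)).
apply: (@le_trans _ _ (A%:E * (e / C)%:E + B%:E * (e / C)%:E)%E).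
  by apply: leeD; apply: lee_wpmul2l; rewrite ?lee_fin ?H1 ?H2.
rewrite -!EFinM -EFinD lee_fin -mulrDl mulrCA -[leRHS]mulr1 ler_wpM2l ?(ltW e0) //.
by rewrite ler_pdivrMr // mul1r /C lerDl.
Qed.

Lemma leeD_comb (A B x1 x2 y1 y2 z1 z2 : \bar R) :
  (0 <= x1 -> 0 <= x2 -> 0 <= y1 -> 0 <= y2 ->
   z1 <= A * x1 + B * y1 -> z2 <= A * x2 + B * y2 ->
   z1 + z2 <= A * (x1 + x2) + B * (y1 + y2))%E.
Proof.
move=> x10 x20 y10 y20 z1A z2A.
rewrite (ge0_muleDr A x10 x20) (ge0_muleDr B y10 y20) addeACA.
exact: leeD.
Qed.

Lemma harmonic_ecvg0 : (k.+1%:R^-1 : R)%:E @[k --> \oo] --> 0%E.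
Proof.
apply/ecvg0P => [k|e e0]; first by rewrite lee_fin invr_ge0.
have [N _ HN] := near_infty_natSinv_lt (PosNum e0); exists N => k Nk.
by rewrite lee_fin; apply: ltW; exact: HN.
Qed.

Lemma sqr_ecvg0 (d : nat -> R) : (forall k, 0 <= d k) ->
  d k @[k --> \oo] --> 0 -> (d k ^+ 2)%:E @[k --> \oo] --> 0%E.
Proof.
move=> d0 /(cvg0P d0) H; apply/ecvg0P => [k|e e0]; first by rewrite lee_fin sqr_ge0.
have s0 : 0 < Num.sqrt e by rewrite sqrtr_gt0.
have [N HN] := H _ s0; exists N => k Nk; rewrite lee_fin.
rewrite -[leRHS](sqr_sqrtr (ltW e0)) ler_pXn2r ?nnegrE ?sqrtr_ge0 //; exact: HN.
Qed.

End ExtendedLimits.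

Section QuadraticIntegral.
Context d (T : measurableType d) (R : realType) (mu : {measure set T -> \bar R}).
Context (D : set T) (mD : measurable D) (m p : nat).
Implicit Types A B : T -> 'M[R]_(m, p).

(** Kept in the extended reals: it is also applied to differences with smooth approximants before
    these are known to be square integrable. *)
Definition esq A : \bar R := (\int[mu]_(x in D) (mdot (A x) (A x))%:E)%E.

Lemma esq_ge0 A : (0 <= esq A)%E.
Proof. by apply: integral_ge0 => x _; rewrite lee_fin mdot_ge0. Qed.

(** Replaces the triangle inequality: the bound by twice the sum of squares holds for infinite
    integrals as well. *)
Lemma esq_lin_le a A B : measurable_mx D A -> measurable_mx D B ->
  (esq (fun x => a *: A x + B x)%R <= (2 * a ^+ 2)%:E * esq A + 2%:E * esq B)%E.
Proof.
move=> mA mB.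
have maA : measurable_mx D (fun x => a *: A x).
  move=> i j; under eq_fun do rewrite mxE; exact: measurable_funM.
apply: (le_trans (integral_mdotD_le mu mD maA mB)).
rewrite leeD2r // EFinM -muleA lee_wpmul2l ?lee_fin //.
rewrite /esq -ge0_integralZl //; last 3 first.
- by apply/measurable_EFinP; exact: measurable_mdot.
- by move=> x _; rewrite lee_fin mdot_ge0.
- by rewrite lee_fin sqr_ge0.
apply: le_of_eq.
by apply: eq_integral => x _; rewrite mdotZl mdotZr -EFinM mulrA expr2.
Qed.

Lemma esqE A : L2m mu D A -> esq A = (nrmm mu D A ^+ 2)%:E.
Proof.
move=> hA; rewrite sqr_nrmm /ipm /Rintegral fineK //.
by apply: integrable_fin_num => //; exact: integrable_mdot.
Qed.

End QuadraticIntegral.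

Section SobolevSubspaces.
Context (R : realType) (n : nat) (Omega : set 'rV[R]_n).
Hypotheses (oO : open Omega) (bO : bounded_set Omega).
Local Notation T := (caratheodory_type (leb_om R n)).
Local Notation mu := (lebR R n).
Let mO : measurable (Omega : set T) := measurable_domain oO.
Local Notation Hp := (h1preip oO bO).
Local Notation hlin := (h1lin oO bO).

Definition smooth_field (f : vfield R n) := forall i, smooth (fun x => f x ord0 i).

Lemma smooth_field_lin a f g : smooth_field f -> smooth_field g ->
  smooth_field (fun x => a *: f x + g x).
Proof.
move=> sf sg i; have := smooth_lin a (sf i) (sg i).
by congr smooth; apply/funext => x; rewrite !mxE.
Qed.

Lemma smooth_field_measurable f : smooth_field f ->
  @measurable_mx _ T R Omega 1 n f.
Proof.
move=> sf i j; rewrite (ord1 i).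
by apply: continuous_measurable_domain; exact: smooth_continuous.
Qed.

Lemma cgrad_measurable f : smooth_field f ->
  @measurable_mx _ T R Omega n n (cgrad f).
Proof.
move=> sf i j; rewrite /cgrad; under eq_fun do rewrite mxE.
by apply: continuous_measurable_domain; exact: smooth_pderiv_continuous.
Qed.

Lemma dist1sqE (u : H1 Omega) f : dist1sq u f =
  (@esq _ T R mu Omega 1 n (fun x => u x - f x)%R +
   @esq _ T R mu Omega n n (fun x => grad u x - cgrad f x)%R)%E.
Proof.
by congr (_ + _)%E; apply: eq_integral => x _; rewrite vdotE.
Qed.

Lemma dist1sq_ge0 (u : H1 Omega) f : (0 <= dist1sq u f)%E.
Proof. by rewrite dist1sqE adde_ge0 // esq_ge0. Qed.

Lemma measurable_mxB m p (A B : T -> 'M[R]_(m, p)) : measurable_mx (Omega : set T) A ->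
  measurable_mx (Omega : set T) B -> measurable_mx (Omega : set T) (fun x => A x - B x).
Proof.
move=> mA mB; have := measurable_mx_lin (-1) mB mA.
by under eq_fun do rewrite scaleN1r addrC.
Qed.

Let mv (u : H1 Omega) f : smooth_field f ->
  @measurable_mx _ T R Omega 1 n (fun x => u x - f x).
Proof.
move=> sf; apply: measurable_mxB; last exact: smooth_field_measurable.
exact: L2m_measurable (h1_L2m u).
Qed.

Let mg (u : H1 Omega) f : smooth_field f ->
  @measurable_mx _ T R Omega n n (fun x => grad u x - cgrad f x).
Proof.
move=> sf; apply: measurable_mxB; last exact: cgrad_measurable.
exact: L2m_measurable (grad_L2 u).
Qed.

Lemma dist1sq_lin a (u v : H1 Omega) f g : smooth_field f -> smooth_field g ->
  (dist1sq (hlin a u v) (fun x => a *: f x + g x)%R <=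
   (2 * a ^+ 2)%:E * dist1sq u f + 2%:E * dist1sq v g)%E.
Proof.
move=> sf sg; rewrite !dist1sqE.
have h1 := esq_lin_le mu mO a (mv u sf) (mv v sg).
have h2 := esq_lin_le mu mO a (mg u sf) (mg v sg).
apply: le_trans (leeD_comb _ _ _ _ h1 h2); [|exact: esq_ge0..].
apply: le_of_eq.
congr (_ + _)%E; apply: eq_integral => x _.
  by congr (mdot _ _)%:E; rewrite scalerBr opprD addrACA.
by rewrite (cgrad_lin a sf sg); congr (mdot _ _)%:E; rewrite scalerBr opprD addrACA.
Qed.

Lemma dist1sq_shift (u v : H1 Omega) f : smooth_field f ->
  (dist1sq u f <= 2%:E * (dist Hp u v ^+ 2)%:E + 2%:E * dist1sq v f)%E.
Proof.
move=> sf; rewrite !dist1sqE sqr_dist1 EFinD.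
have mu1 : @measurable_mx _ T R Omega 1 n (hlin (-1) v u).
  exact: L2m_measurable (h1_L2m _).
have mu2 : @measurable_mx _ T R Omega n n (grad (hlin (-1) v u)).
  exact: L2m_measurable (grad_L2 _).
have h1 := esq_lin_le mu mO 1 mu1 (mv v sf).
have h2 := esq_lin_le mu mO 1 mu2 (mg v sf).
have E1 := esqE mO (h1_L2m (hlin (-1) v u)).
have E2 := esqE mO (grad_L2 (hlin (-1) v u)).
rewrite !expr1n !mulr1 in h1 h2; rewrite E1 in h1; rewrite E2 in h2.
apply: le_trans (leeD_comb _ _ _ _ h1 h2); rewrite ?esq_ge0 ?lee_fin ?sqr_ge0 //.
apply: le_of_eq.
congr (_ + _)%E; apply: eq_integral => x _ /=;
  by congr (mdot _ _)%:E; rewrite scale1r scaleN1r addrACA addNr add0r.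
Qed.

Lemma inH10_lin a (u v : H1 Omega) : inH10 u -> inH10 v -> inH10 (hlin a u v).
Proof.
move=> [f [tf cf]] [g [tg cg]]; exists (fun k x => a *: f k x + g k x); split.
  move=> k i; have := test_function_lin a (tf k i) (tg k i).
  by congr test_function; apply/funext => x; rewrite !mxE.
have sf k : smooth_field (f k) by move=> i; have [] := tf k i.
have sg k : smooth_field (g k) by move=> i; have [] := tg k i.
exact: (ecvg0_lin (mulr_ge0 (ler0n R 2) (sqr_ge0 a)) (ler0n R 2)
  (fun k => dist1sq_ge0 u (f k)) (fun k => dist1sq_ge0 v (g k))
  (fun k => dist1sq_ge0 _ _) (fun k => dist1sq_lin a u v (sf k) (sg k)) cf cg).
Qed.

Lemma inH10_zero : inH10 (@h1zero R n Omega oO).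
Proof.
exists (fun _ _ => 0); split=> [k i|].
  by have := @test_function0 R n Omega; congr test_function; apply/funext => x; rewrite mxE.
rewrite (_ : (fun k => _) = (fun=> 0%E)); first exact: cvg_cst.
apply/funext => k; rewrite dist1sqE.
have E m p : @esq _ T R mu Omega m p (fun=> 0) = 0%E.
  by rewrite /esq; under eq_integral do rewrite mdot0; exact: integral0.
have c0 (x : 'rV[R]_n) : cgrad (fun=> 0) x = 0 :> 'M[R]_n.
  by apply/matrixP => i j; rewrite !mxE /pderiv derive_cst.
transitivity (@esq _ T R mu Omega 1 n (fun=> 0)%R + @esq _ T R mu Omega n n (fun=> 0)%R)%E.
  congr (_ + _)%E; apply: eq_integral => x _ /=; first by rewrite subr0.
  by rewrite c0 subr0.
by rewrite !E adde0.
Qed.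

(** Diagonal argument: [f k] approximates [u k] up to [1 / (k + 1)], and [u k] approaches [v], so
    the single sequence [f] approximates [v]. *)
Lemma dist1sq_closed (u : nat -> H1 Omega) (v : H1 Omega) (f : nat -> vfield R n) :
  dist Hp (u k) v @[k --> \oo] --> 0 -> (forall k, smooth_field (f k)) ->
  (forall k, dist1sq (u k) (f k) <= (k.+1%:R^-1)%:E)%E ->
  dist1sq v (f k) @[k --> \oo] --> 0%E.
Proof.
move=> cu sf uf.
have h0 k : (0 <= (k.+1%:R^-1 : R)%:E)%E by rewrite lee_fin invr_ge0.
have h1 k : (0 <= (dist Hp (u k) v ^+ 2)%:E)%E by rewrite lee_fin sqr_ge0.
apply: (ecvg0_lin (ler0n R 2) (ler0n R 2) h1 h0 (fun k => dist1sq_ge0 v (f k)) _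
  (sqr_ecvg0 (fun k => dist_ge0 _ _ _) cu) (@harmonic_ecvg0 R)).
move=> k; apply: (le_trans (dist1sq_shift v (u k) (sf k))).
by rewrite distC leeD2l // lee_wpmul2l ?lee_fin.
Qed.

Lemma inH10_closed (u : nat -> H1 Omega) (v : H1 Omega) :
  (forall k, inH10 (u k)) -> dist Hp (u k) v @[k --> \oo] --> 0 -> inH10 v.
Proof.
move=> hu cu.
have /choice[f Hf] : forall k, exists f : vfield R n,
    (forall i, test_function Omega (fun x => f x ord0 i)) /\
    (dist1sq (u k) f <= (k.+1%:R^-1)%:E)%E.
  move=> k; have [f [tf]] := hu k.
  move=> /(ecvg0P (fun k' => dist1sq_ge0 _ _))/(_ k.+1%:R^-1).
  rewrite invr_gt0 ltr0n => /(_ isT)[N HN]; exists (f N); split; [exact: tf|].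
  exact: HN.
exists f; split => [k|]; first by have [] := Hf k.
have sf k : smooth_field (f k) by move=> i; have [/(_ i)[]] := Hf k.
exact: dist1sq_closed cu (fun k => sf k) (fun k => proj2 (Hf k)).
Qed.

Variable Gamma : set 'rV[R]_n.
Local Notation TG := (caratheodory_type (haus_om R n n.-1)).
Local Notation nuG := (hausR R n n.-1).
Hypothesis mG : measurable (Gamma : set TG).

Let esqG (f : vfield R n) := @esq _ TG R nuG Gamma 1 n f.

Lemma trace_intE (g f : vfield R n) :
  (\int[nuG]_(x in Gamma) (vdot (g x - f x) (g x - f x))%:E)%E =
  esqG (fun x => g x - f x).
Proof. by apply: eq_integral => x _; rewrite vdotE. Qed.

Let mGv (g f : vfield R n) :
  (forall i, sq_integrable nuG Gamma (fun x => g x ord0 i)) ->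
  smooth_field f -> @measurable_mx _ TG R Gamma 1 n (fun x => g x - f x).
Proof.
move=> sg sf i j; rewrite (ord1 i); under eq_fun do rewrite !mxE.
apply: measurable_funB; first by have [] := sg j.
apply: (continuous_caratheodory (@hausdorff_half_space R n n.-1)).
exact: smooth_continuous.
Qed.

Lemma has_trace_lin a (u v : H1 Omega) (g h : vfield R n) :
  has_trace Gamma u g -> has_trace Gamma v h ->
  has_trace Gamma (hlin a u v) (fun x => a *: g x + h x).
Proof.
move=> [sg [f [sf cf tf]]] [sh [f' [sf' cf' tf']]]; split.
  by move=> i; under eq_fun do rewrite !mxE; exact: sq_integrable_lin.
exists (fun k x => a *: f k x + f' k x); split.
- by move=> k; exact: smooth_field_lin.
- exact: (ecvg0_lin (mulr_ge0 (ler0n R 2) (sqr_ge0 a)) (ler0n R 2)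
    (fun k => dist1sq_ge0 u (f k)) (fun k => dist1sq_ge0 v (f' k))
    (fun k => dist1sq_ge0 _ _) (fun k => dist1sq_lin a u v (sf k) (sf' k)) cf cf').
- under eq_cvg do rewrite trace_intE.
  have tf1 : esqG (fun x => g x - f k x) @[k --> \oo] --> 0%E.
    by move: tf; under eq_cvg do rewrite trace_intE.
  have tf2 : esqG (fun x => h x - f' k x) @[k --> \oo] --> 0%E.
    by move: tf'; under eq_cvg do rewrite trace_intE.
  apply: (ecvg0_lin (mulr_ge0 (ler0n R 2) (sqr_ge0 a)) (ler0n R 2)
    (fun k => esq_ge0 _ _ _) (fun k => esq_ge0 _ _ _) (fun k => esq_ge0 _ _ _)
    _ tf1 tf2).
  move=> k; apply: le_trans (esq_lin_le nuG mG a (mGv sg (sf k)) (mGv sh (sf' k))).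
  apply: le_of_eq; apply: eq_integral => x _.
  by congr (mdot _ _)%:E; rewrite scalerBr opprD addrACA.
Qed.

Lemma inH1D_lin a (u v : H1 Omega) :
  inH1D Gamma u -> inH1D Gamma v -> inH1D Gamma (hlin a u v).
Proof.
move=> hu hv; have := has_trace_lin a hu hv.
by under [X in has_trace _ _ X]eq_fun do rewrite scaler0 addr0.
Qed.

Lemma has_trace_addD a (u v : H1 Omega) g :
  inH1D Gamma u -> has_trace Gamma v g -> has_trace Gamma (hlin a u v) g.
Proof.
move=> hu hv; have := has_trace_lin a hu hv.
by under [X in has_trace _ _ X]eq_fun do rewrite scaler0 add0r.
Qed.

(** Makes the difference of two lifts of the same boundary datum an admissible test field for the
    heat problem. *)
Lemma has_trace_sub (u v : H1 Omega) g :
  has_trace Gamma u g -> has_trace Gamma v g -> inH1D Gamma (hlin (-1) u v).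
Proof.
move=> hu hv; have := has_trace_lin (-1) hu hv.
by under [X in has_trace _ _ X]eq_fun do rewrite scaleN1r addNr.
Qed.

(** Diagonal argument again, with each [f k] chosen close to [u k] in the domain and small on
    [Gamma] at once. *)
Lemma inH1D_closed (u : nat -> H1 Omega) (v : H1 Omega) :
  (forall k, inH1D Gamma (u k)) -> dist Hp (u k) v @[k --> \oo] --> 0 ->
  inH1D Gamma v.
Proof.
move=> hu cu.
have /choice[f Hf] : forall k, exists f : vfield R n, [/\ smooth_field f,
    (dist1sq (u k) f <= (k.+1%:R^-1)%:E)%E &
    (esqG (fun x => 0 - f x)%R <= (k.+1%:R^-1)%:E)%E].
  move=> k; have [_ [f [sf cf tf]]] := hu k.
  have k0 : 0 < k.+1%:R^-1 :> R by rewrite invr_gt0.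
  move/(ecvg0P (fun k' => dist1sq_ge0 _ _)) : cf => /(_ _ k0)[N1 HN1].
  have tf' : esqG (fun x => 0 - f k x) @[k --> \oo] --> 0%E.
    by move: tf; under eq_cvg do rewrite trace_intE.
  move/(ecvg0P (fun k' => esq_ge0 _ _ _)) : tf' => /(_ _ k0)[N2 HN2].
  exists (f (maxn N1 N2)); split; [exact: sf| |].
    by apply: HN1; exact: leq_maxl.
  by apply: HN2; exact: leq_maxr.
split; first by have [] := hu 0%N.
have sf k : smooth_field (f k) by have [] := Hf k.
exists f; split => [//||].
- by apply: dist1sq_closed cu sf _ => k; have [] := Hf k.
- under eq_cvg do rewrite trace_intE.
  apply/ecvg0P => [k|e e0]; first exact: esq_ge0.
  have h0 k : (0 <= (k.+1%:R^-1 : R)%:E)%E by rewrite lee_fin invr_ge0.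
  have [H _] := ecvg0P h0; have [N HN] := H (@harmonic_ecvg0 R) e e0.
  exists N => k Nk; apply: le_trans (HN k Nk).
  by have [] := Hf k.
Qed.

Lemma inH1D_complete : ip_complete Hp (inH1D Gamma).
Proof.
move=> u Pu cu; have [v _ cv] := h1_complete (fun=> I) cu.
by exists v => //; exact: inH1D_closed cv.
Qed.

End SobolevSubspaces.

(** * Null fields and pointwise constraints in the limit *)

Section NullFields.
Context d (T : measurableType d) (R : realType) (mu : {measure set T -> \bar R}).
Context (D : set T) (mD : measurable D).

Lemma ae_on_imp (P Q : T -> Prop) : {ae mu, forall x, D x -> P x} ->
  (forall x, D x -> P x -> Q x) -> {ae mu, forall x, D x -> Q x}.
Proof. by move=> aP PQ; apply: filterS aP => x Px Dx; exact: PQ (Px Dx). Qed.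

Lemma ae_on_imp2 (P Q S : T -> Prop) : {ae mu, forall x, D x -> P x} ->
  {ae mu, forall x, D x -> Q x} -> (forall x, D x -> P x -> Q x -> S x) ->
  {ae mu, forall x, D x -> S x}.
Proof.
by move=> aP aQ PQS; apply: filterS2 aP aQ => x Px Qx Dx; exact: PQS (Px Dx) (Qx Dx).
Qed.

Lemma nrmm_eq0P m p (A : T -> 'M[R]_(m, p)) : L2m mu D A ->
  nrmm mu D A = 0 <-> {ae mu, forall x, D x -> A x = 0}.
Proof.
move=> hA.
have E : (\int[mu]_(x in D) `|(mdot (A x) (A x))%:E| = (nrmm mu D A ^+ 2)%:E)%E.
  rewrite -(esqE mD hA); apply: eq_integral => x _.
  by rewrite gee0_abs // lee_fin mdot_ge0.
have mf : measurable_fun D (fun x => (mdot (A x) (A x))%:E).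
  by apply/measurable_EFinP; apply: measurable_mdot; exact: L2m_measurable hA.
have [h1 h2] := ae_eq_integral_abs mu mD mf; rewrite E in h1 h2.
split => [n0|ae0].
  have /h1 : (nrmm mu D A ^+ 2)%:E = 0%E by rewrite n0 expr0n.
  apply: filterS => x H Dx; apply: mdot_eq0.
  by have := H Dx => -[].
have : (nrmm mu D A ^+ 2)%:E = 0%E.
  by apply: h2; apply: filterS ae0 => x H Dx; rewrite (H Dx) mdot0.
by move=> -[/eqP]; rewrite sqrf_eq0 => /eqP.
Qed.

Lemma nrmm_le m p m' p' (A : T -> 'M[R]_(m, p)) (B : T -> 'M[R]_(m', p')) (C : R) :
  0 <= C -> L2m mu D A -> L2m mu D B ->
  {ae mu, forall x, D x -> mdot (B x) (B x) <= C ^+ 2 * mdot (A x) (A x)} ->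
  nrmm mu D B <= C * nrmm mu D A.
Proof.
move=> C0 hA hB BA.
rewrite -ler_sqr ?nnegrE ?mulr_ge0 ?nrmm_ge0 // exprMn -lee_fin.
rewrite [leRHS]EFinM -(esqE mD hA) -(esqE mD hB) /esq -ge0_integralZl //.
- apply: ae_ge0_le_integral => //.
  + by move=> x _; rewrite lee_fin mdot_ge0.
  + by apply/measurable_EFinP; apply: measurable_mdot; exact: L2m_measurable hB.
  + by move=> x _; rewrite -EFinM lee_fin mulr_ge0 ?sqr_ge0 ?mdot_ge0.
  + apply/measurable_EFinP; apply: measurable_funM => //.
    by apply: measurable_mdot; exact: L2m_measurable hA.
- by apply/measurable_EFinP; apply: measurable_mdot; exact: L2m_measurable hA.
- by move=> x _; rewrite lee_fin mdot_ge0.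
- by rewrite lee_fin sqr_ge0.
Qed.

Lemma nrmm_le_pw m p m' p' (A : T -> 'M[R]_(m, p)) (B : T -> 'M[R]_(m', p')) (C : R) :
  0 <= C -> L2m mu D A -> L2m mu D B ->
  (forall x, mdot (B x) (B x) <= C ^+ 2 * mdot (A x) (A x)) ->
  nrmm mu D B <= C * nrmm mu D A.
Proof. by move=> C0 hA hB BA; apply: nrmm_le => //; apply: nearW => x _. Qed.

(** A constraint holding almost everywhere, such as symmetry or zero trace, is the vanishing of the
    [L^2] norm of a bounded linear image; in this form it is stable under [L^2] limits. *)
Lemma L2M_kernel_closed m p m' p' (L : 'M[R]_(m, p) -> 'M[R]_(m', p')) (C : R)
    (u : nat -> L2M mu D m p) (v : L2M mu D m p) :
  0 <= C -> (forall A, L2m mu D A -> L2m mu D (L \o A)) ->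
  (forall A B, L (A - B) = L A - L B) ->
  (forall A, mdot (L A) (L A) <= C ^+ 2 * mdot A A) ->
  (forall k, nrmm mu D (L \o sval (u k)) = 0) ->
  dist (L2Mpreip mu mD m p) (u k) v @[k --> \oo] --> 0 ->
  nrmm mu D (L \o sval v) = 0.
Proof.
move=> C0 LL LB LC Lu cu; apply: (@le_cvg0_eq0 R _ C _ _ cu) => k.
rewrite ger0_norm ?nrmm_ge0 //.
have hd := L2mB mD (svalP v) (svalP (u k)).
have h2 := LL _ (svalP (u k)).
have := nrmmD mD (LL _ hd) h2; rewrite Lu addr0.
rewrite (_ : (fun x => _ + _) = L \o sval v); last first.
  by apply/funext => x; rewrite /= LB subrK.
move=> /le_trans; apply.
apply: (le_trans (nrmm_le_pw C0 hd (LL _ hd) (fun x => LC _))).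
rewrite ler_wpM2l // distC.
apply: le_of_eq; congr Num.sqrt.
apply: eq_Rintegral => x _ /=; by rewrite scaleN1r addrC.
Qed.

End NullFields.

Section SumOfSquares.
Context (R : realType).

Lemma norm_sum_le_pert (a1 a2 b1 b2 N1 N2 D1 D2 : R) : a1 + a2 = 0 ->
  `|a1 - b1| <= D1 * N1 -> `|a2 - b2| <= D2 * N2 ->
  0 <= N1 -> 0 <= N2 -> 0 <= D1 -> 0 <= D2 ->
  `|b1 + b2| <= (N1 + N2) * (D1 + D2).
Proof.
move=> h3 h1 h2 n1 n2 d1 d2.
have := mulr_ge0 d1 n2; have := mulr_ge0 d2 n1.
move: h1 h2; rewrite !ler_norml => /andP[? ?] /andP[? ?] ? ?.
by apply/andP; split; lra.
Qed.

Lemma le_of_sqr_sum4 (t a b c e : R) : 0 <= t -> 0 <= a -> 0 <= b -> 0 <= c ->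
  0 <= e -> t ^+ 2 = a ^+ 2 + (b ^+ 2 + c ^+ 2) + e ^+ 2 -> t <= a + b + c + e.
Proof.
move=> t0 a0 b0 c0 e0 E; rewrite -ler_sqr ?nnegrE ?addr_ge0 // E.
have := mulr_ge0 a0 b0; have := mulr_ge0 a0 c0; have := mulr_ge0 a0 e0.
have := mulr_ge0 b0 c0; have := mulr_ge0 b0 e0; have := mulr_ge0 c0 e0.
by move: a b c e {E a0 b0 c0 e0} => a b c e *; lra.
Qed.

Lemma cvg0_le (t e : nat -> R) : (forall k, 0 <= t k) -> (forall k, t k <= e k) ->
  e k @[k --> \oo] --> 0 -> t k @[k --> \oo] --> 0.
Proof.
move=> t0 te /cvgrPdist_le ce; apply/cvgrPdist_le => d d0.
have [N _ HN] := ce _ d0; exists N => // k Nk.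
have := HN k Nk; rewrite /= !sub0r !normrN ger0_norm ?(le_trans (t0 k)) // => h.
by rewrite ger0_norm // (le_trans (te k)).
Qed.

End SumOfSquares.

(** * The tensor components of the product space *)

Section TraceFreeAndDiv.
Context (R : realType) (n : nat) (Omega : set 'rV[R]_n).
Hypotheses (oO : open Omega) (bO : bounded_set Omega).
Local Notation T := (caratheodory_type (leb_om R n)).
Local Notation mu := (lebR R n).
Let mO : measurable (Omega : set T) := measurable_domain oO.

Lemma mdot_tr m p (A B : 'M[R]_(m, p)) : mdot A^T B^T = mdot A B.
Proof.
by rewrite /mdot exchange_big; apply: eq_bigr => i _; apply: eq_bigr => j _; rewrite !mxE.
Qed.

Lemma mxtrace_mdot (A : 'M[R]_n) : \tr A = mdot A 1%:M.
Proof.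
apply: eq_bigr => i _; rewrite (bigD1 i) //= mxE eqxx mulr1.
by rewrite big1 ?addr0 // => j ji; rewrite mxE eq_sym (negPf ji) mulr0.
Qed.

Definition skew2 (A : 'M[R]_n) : 'M[R]_n := A - A^T.
(** The trace as a [1 x 1] matrix, the shape that [L2M_kernel_closed] asks for. *)
Definition trmx1 (A : 'M[R]_n) : 'M[R]_1 := (\tr A)%:M.

Lemma L2m_skew2 (A : T -> 'M[R]_n) : L2m mu Omega A -> L2m mu Omega (skew2 \o A).
Proof.
move=> hA i j; rewrite /skew2 /=.
have := sq_integrable_lin mO (-1) (hA j i) (hA i j).
by congr sq_integrable; apply/funext => x; rewrite !mxE; ring.
Qed.

Lemma L2m_trmx1 (A : T -> 'M[R]_n) : L2m mu Omega A -> L2m mu Omega (trmx1 \o A).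
Proof.
move=> hA i j; rewrite /trmx1 /= (ord1 i) (ord1 j).
have := sq_integrable_sum mO (index_enum 'I_n) (fun i => hA i i).
by congr sq_integrable; apply/funext => x; rewrite !mxE mulr1n.
Qed.

Lemma skew2B A B : skew2 (A - B) = skew2 A - skew2 B.
Proof. by apply/matrixP => i j; rewrite !mxE; ring. Qed.

Lemma trmx1B A B : trmx1 (A - B) = trmx1 A - trmx1 B.
Proof. by rewrite /trmx1 raddfB /= raddfB. Qed.

Lemma skew2_le A : mdot (skew2 A) (skew2 A) <= 2 ^+ 2 * mdot A A.
Proof.
apply: le_trans (mdot_sqrD_le _ _) _.
have -> : mdot (- A^T) (- A^T) = mdot A A.
  by rewrite -[- A^T]scaleN1r mdotZl mdotZr mdot_tr !mulN1r opprK.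
by lra.
Qed.

(** The trace is the pairing with the identity, so this is Cauchy-Schwarz. *)
Lemma trmx1_le A : mdot (trmx1 A) (trmx1 A) <=
  (nrm (mdot_preip R n n) 1%:M) ^+ 2 * mdot A A.
Proof.
have -> : mdot (trmx1 A) (trmx1 A) = \tr A ^+ 2.
  by rewrite /mdot !big_ord1 mxE mulr1n expr2.
rewrite mxtrace_mdot; have := ip_cauchy_schwarz (mdot_preip R n n) A 1%:M.
have -> : mdot A A = nrm (mdot_preip R n n) A ^+ 2 by rewrite sqr_nrm.
move=> h; rewrite mulrC -exprMn -real_normK ?num_real //.
by rewrite ler_pXn2r ?nnegrE ?mulr_ge0 ?nrm_ge0.
Qed.

Lemma skew2_eq0 A : skew2 A = 0 <-> A^T = A.
Proof.
split=> [/eqP|E]; first by rewrite subr_eq0 => /eqP.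
by rewrite /skew2 E subrr.
Qed.

Lemma trmx1_eq0 A : trmx1 A = 0 <-> \tr A = 0.
Proof.
split=> [/matrixP/(_ ord0 ord0)|E]; first by rewrite !mxE mulr1n.
by rewrite /trmx1 E raddf0.
Qed.

Lemma trfree_iff (A : T -> 'M[R]_n) : L2m mu Omega A ->
  (aeO Omega (fun x => (A x)^T = A x) /\ aeO Omega (fun x => \tr (A x) = 0)) <->
  (nrmm mu Omega (skew2 \o A) = 0 /\ nrmm mu Omega (trmx1 \o A) = 0).
Proof.
move=> hA; rewrite /aeO (nrmm_eq0P mO (L2m_skew2 hA)) (nrmm_eq0P mO (L2m_trmx1 hA)).
split=> -[h1 h2]; split.
- by apply: ae_on_imp h1 _ => x _ H; apply/skew2_eq0.
- by apply: ae_on_imp h2 _ => x _ H; apply/trmx1_eq0.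
- by apply: ae_on_imp h1 _ => x _ H; apply/skew2_eq0.
- by apply: ae_on_imp h2 _ => x _ H; apply/trmx1_eq0.
Qed.

Lemma l2tr_lin_sym a (t s : L2tr Omega) :
  aeO Omega (fun x => (a *: t x + s x)^T = a *: t x + s x).
Proof.
apply: ae_on_imp2 (l2_sym t) (l2_sym s) _ => x _ h1 h2.
by rewrite linearD /= linearZ /= h1 h2.
Qed.

Lemma l2tr_lin_tr a (t s : L2tr Omega) :
  aeO Omega (fun x => \tr (a *: t x + s x) = 0).
Proof.
apply: ae_on_imp2 (l2_tr t) (l2_tr s) _ => x _ h1 h2.
by rewrite linearD /= linearZ /= h1 h2 mulr0 addr0.
Qed.

Definition l2trlin a (t s : L2tr Omega) : L2tr Omega :=
  Build_L2tr (L2m_lin mO a (l2_L2 t) (l2_L2 s)) (l2tr_lin_sym a t s) (l2tr_lin_tr a t s).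

Definition l2trM (t : L2tr Omega) : @L2M _ T R mu Omega n n := exist _ _ (l2_L2 t).

Lemma l2tr_closed (u : nat -> L2tr Omega) (v : @L2M _ T R mu Omega n n) :
  dist (L2Mpreip mu mO n n) (l2trM (u k)) v @[k --> \oo] --> 0 ->
  aeO Omega (fun x => (sval v x)^T = sval v x) /\
  aeO Omega (fun x => \tr (sval v x) = 0).
Proof.
move=> cu; apply/(trfree_iff (svalP v)).
have Hu k := proj1 (trfree_iff (l2_L2 (u k))) (conj (l2_sym (u k)) (l2_tr (u k))).
split.
- apply: (@L2M_kernel_closed _ T R mu Omega mO n n n n skew2 2 (fun k => l2trM (u k)) v
    (ler0n R 2) L2m_skew2 skew2B skew2_le _ cu).
  by move=> k; have [] := Hu k.
- apply: (@L2M_kernel_closed _ T R mu Omega mO n n 1 1 trmx1 _ (fun k => l2trM (u k)) v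
    (nrm_ge0 _ _) L2m_trmx1 trmx1B trmx1_le _ cu).
  by move=> k; have [] := Hu k.
Qed.

(* Tested against [f], the weak divergence of row [i] is the pairing with this
   tensor. *)
Definition row_grad (i : 'I_n) (f : 'rV[R]_n -> R) (x : 'rV[R]_n) : 'M[R]_n :=
  \matrix_(k, j) (if k == i then pderiv j f x else 0).

Definition row_test (i : 'I_n) (f : 'rV[R]_n -> R) (x : 'rV[R]_n) : 'rV[R]_n :=
  \row_k (if k == i then f x else 0).

Lemma row_gradE i f x (A : 'M[R]_n) :
  mdot A (row_grad i f x) = \sum_j A i j * pderiv j f x.
Proof.
rewrite /mdot (bigD1 i) //= [X in _ + X]big1 ?addr0.
  by apply: eq_bigr => j _; rewrite mxE eqxx.
by move=> k /negPf ki; rewrite big1 // => j _; rewrite mxE ki mulr0.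
Qed.

Lemma row_testE i f x (v : 'rV[R]_n) : mdot v (row_test i f x) = v ord0 i * f x.
Proof.
rewrite /mdot big_ord1 (bigD1 i) //= [X in _ + X]big1 ?addr0.
  by rewrite mxE eqxx.
by move=> k /negPf ki; rewrite mxE ki mulr0.
Qed.

Lemma L2m_row_grad i f : smooth f -> @L2m _ T R mu Omega n n (row_grad i f).
Proof.
move=> sf k j; rewrite /row_grad; under eq_fun do rewrite mxE.
by case: eqP => _; [exact: test_pderiv_sq|exact: sq_integrable0].
Qed.

Lemma L2m_row_test i f : smooth f -> @L2m _ T R mu Omega 1 n (row_test i f).
Proof.
move=> sf k j; rewrite /row_test; under eq_fun do rewrite mxE.
by case: eqP => _; [exact: test_sq|exact: sq_integrable0].
Qed.

Lemma L2m_cst m p (A : 'M[R]_(m, p)) : @L2m _ T R mu Omega m p (fun=> A).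
Proof. by move=> i j; apply: continuous_sq_integrable => //; exact: cst_continuous. Qed.

(** Two pairings with fixed square integrable fields: in this form linearity and passage to the
    limit are immediate. *)
Lemma weak_divE (A : tfield R n) (v : vfield R n) : weak_div Omega A v <->
  forall f i, test_function Omega f ->
   @ipm _ T R mu Omega n n A (row_grad i f) + @ipm _ T R mu Omega 1 n v (row_test i f) = 0.
Proof.
have E1 f i : intO Omega (fun x => \sum_j A x i j * pderiv j f x) =
    @ipm _ T R mu Omega n n A (row_grad i f).
  by apply: eq_Rintegral => x _; rewrite row_gradE.
have E2 f i : intO Omega (fun x => v x ord0 i * f x) =
    @ipm _ T R mu Omega 1 n v (row_test i f).
  by apply: eq_Rintegral => x _; rewrite row_testE.
split=> H f i tf; first by have := H f i tf; rewrite E1 E2 => ->; rewrite addNr.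
by rewrite E1 E2; apply/eqP; rewrite -addr_eq0 H.
Qed.

Lemma hd_trE (A : tfield R n) : intO Omega (fun x => \tr (A x)) =
  @ipm _ T R mu Omega n n A (fun=> 1%:M).
Proof. by apply: eq_Rintegral => x _; rewrite mxtrace_mdot. Qed.

Lemma hdiv_L2m (s : Hdiv0 Omega) : @L2m _ T R mu Omega 1 n (hdiv s).
Proof. by apply/L2vE; exact: hdiv_L2. Qed.

Lemma weak_div_lin a (s t : Hdiv0 Omega) :
  weak_div Omega (fun x => a *: s x + t x) (fun x => a *: hdiv s x + hdiv t x).
Proof.
apply/weak_divE => f i tf; have [sf _ _] := tf.
have h1 := proj1 (weak_divE _ _) (hdivP s) f i tf.
have h2 := proj1 (weak_divE _ _) (hdivP t) f i tf.
have e1 := ipm_linl mO a (hd_L2 s) (hd_L2 t) (L2m_row_grad i sf).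
have e2 := ipm_linl mO a (hdiv_L2m s) (hdiv_L2m t) (L2m_row_test i sf).
by apply: (etrans (congr2 +%R e1 e2)); rewrite addrACA -mulrDr h1 h2 mulr0 addr0.
Qed.

Lemma hd_tr_lin a (s t : Hdiv0 Omega) : intO Omega (fun x => \tr (a *: s x + t x)) = 0.
Proof.
rewrite hd_trE.
have e1 := ipm_linl mO a (hd_L2 s) (hd_L2 t) (L2m_cst (1%:M : 'M[R]_n)).
apply: (etrans e1).
by have := hd_tr s; rewrite hd_trE => ->; have := hd_tr t; rewrite hd_trE => ->; rewrite mulr0 addr0.
Qed.

Definition hdivlin a (s t : Hdiv0 Omega) : Hdiv0 Omega :=
  Build_Hdiv0 (L2m_lin mO a (hd_L2 s) (hd_L2 t))
    (proj2 (L2vE _ _) (L2m_lin mO a (hdiv_L2m s) (hdiv_L2m t)))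
    (weak_div_lin a s t) (hd_tr_lin a s t).

Definition hdM (s : Hdiv0 Omega) : @L2M _ T R mu Omega n n := exist _ _ (hd_L2 s).
Definition hdivM (s : Hdiv0 Omega) : @L2M _ T R mu Omega 1 n := exist _ _ (hdiv_L2m s).

Lemma ipm_dist m p (A B : @L2M _ T R mu Omega m p) (h : @L2M _ T R mu Omega m p) :
  `|ipm mu Omega (sval A) (sval h) - ipm mu Omega (sval B) (sval h)| <=
  dist (L2Mpreip mu mO m p) A B * nrm (L2Mpreip mu mO m p) h.
Proof.
rewrite ler_norml; apply/andP; split.
  by rewrite lerNl opprB distC; exact: (dist_ip (L2Mpreip mu mO m p)).
exact: (dist_ip (L2Mpreip mu mO m p)).
Qed.

Lemma hdiv0_closed (u : nat -> Hdiv0 Omega) (v : @L2M _ T R mu Omega n n)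
    (w : @L2M _ T R mu Omega 1 n) :
  dist (L2Mpreip mu mO n n) (hdM (u k)) v @[k --> \oo] --> 0 ->
  dist (L2Mpreip mu mO 1 n) (hdivM (u k)) w @[k --> \oo] --> 0 ->
  weak_div Omega (sval v) (sval w) /\ intO Omega (fun x => \tr (sval v x)) = 0.
Proof.
move=> cv cw; split.
  apply/weak_divE => f i tf; have [sf _ _] := tf.
  pose hg : @L2M _ T R mu Omega n n := exist _ _ (L2m_row_grad i sf).
  pose ht : @L2M _ T R mu Omega 1 n := exist _ _ (L2m_row_test i sf).
  apply: (@le_cvg0_eq0 R _ (nrm (L2Mpreip mu mO n n) hg + nrm (L2Mpreip mu mO 1 n) ht)
     (fun k => dist (L2Mpreip mu mO n n) (hdM (u k)) v +
               dist (L2Mpreip mu mO 1 n) (hdivM (u k)) w)); last first.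
    by have := cvgD cv cw; rewrite addr0; exact.
  move=> k.
  have h1 := ipm_dist (hdM (u k)) v hg.
  have h2 := ipm_dist (hdivM (u k)) w ht.
  have h3 := proj1 (weak_divE _ _) (hdivP (u k)) f i tf.
  exact: (norm_sum_le_pert h3 h1 h2 (nrm_ge0 _ _) (nrm_ge0 _ _)
    (dist_ge0 _ _ _) (dist_ge0 _ _ _)).
rewrite hd_trE.
pose h1 : @L2M _ T R mu Omega n n := exist _ _ (L2m_cst (1%:M : 'M[R]_n)).
apply: (@le_cvg0_eq0 R _ (nrm (L2Mpreip mu mO n n) h1) _ _ cv) => k.
have := ipm_dist (hdM (u k)) v h1; rewrite /=.
have -> : ipm mu Omega (u k) (fun=> 1%:M) = 0 by rewrite -hd_trE hd_tr.
by rewrite sub0r normrN mulrC.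
Qed.

End TraceFreeAndDiv.

(** * The product space and its completeness *)

Section ProductSpace.
Context (R : realType) (n : nat) (Omega : set 'rV[R]_n).
Hypotheses (oO : open Omega) (bO : bounded_set Omega).
Local Notation T := (caratheodory_type (leb_om R n)).
Local Notation mu := (lebR R n).
Let mO : measurable (Omega : set T) := measurable_domain oO.
Local Notation Hp := (h1preip oO bO).
Local Notation ipt := (@ipm _ T R mu Omega n n).
Local Notation ipv := (@ipm _ T R mu Omega 1 n).
Local Notation Mt := (L2Mpreip mu mO n n).
Local Notation Mv := (L2Mpreip mu mO 1 n).
Implicit Types xi eta : HH Omega.

Lemma l2tr0_sym : aeO Omega (fun=> (0 : 'M[R]_n)^T = 0).
Proof. by apply: nearW => x _; rewrite trmx0. Qed.

Lemma l2tr0_tr : aeO Omega (fun=> \tr (0 : 'M[R]_n) = 0).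
Proof. by apply: nearW => x _; rewrite mxtrace0. Qed.

Definition l2tr0 : L2tr Omega :=
  Build_L2tr (@L2m0 _ T R mu Omega n n) l2tr0_sym l2tr0_tr.

Lemma ipm0 m p (A : T -> 'M[R]_(m, p)) : @ipm _ T R mu Omega m p (fun=> 0) A = 0.
Proof.
by rewrite /ipm; under eq_Rintegral do rewrite mdot0; rewrite Rintegral_cst // mul0r.
Qed.

Lemma weak_div0 : weak_div Omega (fun=> 0) (fun=> 0).
Proof. by apply/weak_divE => f i _; rewrite !ipm0 addr0. Qed.

Lemma hd_tr0 : intO Omega (fun=> \tr (0 : 'M[R]_n)) = 0.
Proof. by rewrite hd_trE ipm0. Qed.

Definition hdiv00 : Hdiv0 Omega :=
  Build_Hdiv0 (@L2m0 _ T R mu Omega n n)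
    (proj2 (L2vE _ _) (@L2m0 _ T R mu Omega 1 n)) weak_div0 hd_tr0.

Definition hhzero : HH Omega := @Build_HH R n Omega l2tr0 hdiv00 _ (inH10_zero oO).

Definition hhlin a xi eta : HH Omega :=
  @Build_HH R n Omega (l2trlin oO a (ht xi) (ht eta))
    (hdivlin oO bO a (hs xi) (hs eta)) _
    (inH10_lin oO bO a (hu0 xi) (hu0 eta)).

Definition hhip xi eta : R :=
  ipt (ht xi) (ht eta) + (ipt (hs xi) (hs eta) +
  ipv (hdiv (hs xi)) (hdiv (hs eta))) + Hp (hu xi) (hu eta).

Lemma hhipC xi eta : hhip xi eta = hhip eta xi.
Proof.
rewrite /hhip (ipC Hp); congr (_ + (_ + _) + _); exact: ipmC.
Qed.

Lemma hhip_linl a xi eta zeta :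
  hhip (hhlin a xi eta) zeta = a * hhip xi zeta + hhip eta zeta.
Proof.
have e1 := ipm_linl mO a (l2_L2 (ht xi)) (l2_L2 (ht eta)) (l2_L2 (ht zeta)).
have e2 := ipm_linl mO a (hd_L2 (hs xi)) (hd_L2 (hs eta)) (hd_L2 (hs zeta)).
have e3 := ipm_linl mO a (hdiv_L2m (hs xi)) (hdiv_L2m (hs eta)) (hdiv_L2m (hs zeta)).
have e4 := ip_linl Hp a (hu xi) (hu eta) (hu zeta).
apply: (etrans (congr2 +%R (congr2 +%R e1 (congr2 +%R e2 e3)) e4)).
rewrite /hhip; move: (ipt (ht xi) _) (ipt (ht eta) _) (ipt (hs xi) _) (ipt (hs eta) _)
  (ipm _ _ (hdiv (hs xi) : T -> 'M[R]_(1, n)) _)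
  (ipm _ _ (hdiv (hs eta) : T -> 'M[R]_(1, n)) _) (Hp _ _) (Hp _ _) => x1 x2 x3 x4 x5 x6 x7 x8.
ring.
Qed.

Lemma hhip_ge0 xi : 0 <= hhip xi xi.
Proof.
by rewrite /hhip !addr_ge0 ?ipm_ge0 // ip_ge0.
Qed.

Definition hhpreip : preip R (HH Omega) := PreIp hhipC hhip_linl hhip_ge0.

Lemma normHHE xi : normHH xi = nrm hhpreip xi.
Proof.
rewrite /normHH norm0vE (norm1E oO bO) !norm0tE sqr_nrm !sqr_nrmm.
by [].
Qed.

Lemma sqr_normHH xi : normHH xi ^+ 2 = norm0t Omega (ht xi) ^+ 2 +
  (norm0t Omega (hs xi) ^+ 2 + norm0v Omega (hdiv (hs xi)) ^+ 2) +
  norm1 (hu xi) ^+ 2.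
Proof. by rewrite /normHH sqr_sqrtr // !addr_ge0 // sqr_ge0. Qed.

Lemma sqr_distHH xi eta : dist hhpreip xi eta ^+ 2 =
  dist Mt (l2trM (ht xi)) (l2trM (ht eta)) ^+ 2 +
  (dist Mt (hdM (hs xi)) (hdM (hs eta)) ^+ 2 +
   dist Mv (hdivM (hs xi)) (hdivM (hs eta)) ^+ 2) +
  dist Hp (hu xi) (hu eta) ^+ 2.
Proof. by rewrite !sqr_nrm. Qed.

Lemma norm0t_ht_le xi : norm0t Omega (ht xi) <= normHH xi.
Proof.
rewrite -ler_sqr ?nnegrE ?sqrtr_ge0 // sqr_normHH -addrA lerDl.
by rewrite !addr_ge0 // sqr_ge0.
Qed.

Lemma norm1_hu_le xi : norm1 (hu xi) <= normHH xi.
Proof.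
rewrite -ler_sqr ?nnegrE ?sqrtr_ge0 // sqr_normHH lerDr.
by rewrite !addr_ge0 // sqr_ge0.
Qed.

Lemma norm0t_hs_le xi : norm0t Omega (hs xi) <= normHH xi.
Proof.
rewrite -ler_sqr ?nnegrE ?sqrtr_ge0 // sqr_normHH addrAC addrCA lerDl.
by rewrite !addr_ge0 // sqr_ge0.
Qed.

Lemma norm0v_hdiv_le xi : norm0v Omega (hdiv (hs xi)) <= normHH xi.
Proof.
rewrite -ler_sqr ?nnegrE ?sqrtr_ge0 // sqr_normHH.
rewrite [X in _ <= _ + X + _]addrC addrAC addrCA lerDl.
by rewrite !addr_ge0 // sqr_ge0.
Qed.

Lemma distHH_ht xi eta : dist Mt (l2trM (ht xi)) (l2trM (ht eta)) <= dist hhpreip xi eta.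
Proof.
rewrite -ler_sqr ?nnegrE ?dist_ge0 // sqr_distHH -addrA lerDl.
by rewrite !addr_ge0 // sqr_ge0.
Qed.

Lemma distHH_hs xi eta : dist Mt (hdM (hs xi)) (hdM (hs eta)) <= dist hhpreip xi eta.
Proof.
rewrite -ler_sqr ?nnegrE ?dist_ge0 // sqr_distHH addrAC addrCA lerDl.
by rewrite !addr_ge0 // sqr_ge0.
Qed.

Lemma distHH_hdiv xi eta : dist Mv (hdivM (hs xi)) (hdivM (hs eta)) <= dist hhpreip xi eta.
Proof.
rewrite -ler_sqr ?nnegrE ?dist_ge0 // sqr_distHH.
rewrite [X in _ <= _ + X + _]addrC addrAC addrCA lerDl.
by rewrite !addr_ge0 // sqr_ge0.
Qed.

Lemma distHH_hu xi eta : dist Hp (hu xi) (hu eta) <= dist hhpreip xi eta.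
Proof.
rewrite -ler_sqr ?nnegrE ?dist_ge0 // sqr_distHH lerDr.
by rewrite !addr_ge0 // sqr_ge0.
Qed.

Lemma cauchy_comp (Y : Type) (dY : Y -> Y -> R) (f : HH Omega -> Y) (u : nat -> HH Omega) :
  (forall x y, dY (f x) (f y) <= dist hhpreip x y) ->
  cauchy_for (dist hhpreip) u -> cauchy_for dY (fun k => f (u k)).
Proof.
move=> H cu e e0; have [N HN] := cu e e0; exists N => a b Na Nb.
exact: le_trans (H _ _) (HN _ _ Na Nb).
Qed.

(** Each component, and the divergence of the second one, is Cauchy in its own space. The closedness
    lemmas put the limits back into the constrained spaces. *)
Lemma hh_complete : ip_complete hhpreip (fun=> True).
Proof.
move=> u _ cu.
have [t _ Ht] := L2M_complete (fun=> I) (cauchy_comp distHH_ht cu).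
have [s _ Hs] := L2M_complete (fun=> I) (cauchy_comp distHH_hs cu).
have [w _ Hw] := L2M_complete (fun=> I) (cauchy_comp distHH_hdiv cu).
have [v _ Hv] := h1_complete (fun=> I) (cauchy_comp distHH_hu cu).
have [tsym ttr] := l2tr_closed Ht.
have [swd str] := hdiv0_closed bO Hs Hw.
have v0 : inH10 v := inH10_closed (fun k => hu0 (u k)) Hv.
pose xi : HH Omega := @Build_HH R n Omega (Build_L2tr (svalP t) tsym ttr)
  (Build_Hdiv0 (svalP s) (proj2 (L2vE _ _) (svalP w)) swd str) v v0.
exists xi => //.
have c4 : dist Mt (l2trM (ht (u k))) t + dist Mt (hdM (hs (u k))) s
  + dist Mv (hdivM (hs (u k))) w + dist Hp (hu (u k)) v @[k --> \oo] --> 0.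
  by have := cvgD (cvgD (cvgD Ht Hs) Hw) Hv; rewrite !addr0; exact.
apply: cvg0_le c4 => k.
  exact: dist_ge0.
apply: le_of_sqr_sum4; try exact: dist_ge0.
exact: (sqr_distHH (u k) xi).
Qed.

Lemma norm0v_le_norm1 (v : H1 Omega) : norm0v Omega v <= norm1 v.
Proof.
rewrite -ler_sqr ?nnegrE ?sqrtr_ge0 //.
by rewrite [leRHS]sqr_sqrtr ?addr_ge0 ?sqr_ge0 // lerDl sqr_ge0.
Qed.

Lemma semi1_le_norm1 (v : H1 Omega) : semi1 v <= norm1 v.
Proof.
rewrite -ler_sqr ?nnegrE ?sqrtr_ge0 //.
by rewrite [leRHS]sqr_sqrtr ?addr_ge0 ?sqr_ge0 // lerDr sqr_ge0.
Qed.

End ProductSpace.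

(** * Bounds on the forms *)

Section BoundedForms.
Context d (T : measurableType d) (R : realType) (mu : {measure set T -> \bar R}).
Context (D : set T) (mD : measurable D).
Context (X : Type) (H : preip R X).
Local Notation lin := (lin H).
Local Notation nrm := (nrm H).

(** A bounded linear map into [L^2] fields, linear at every point rather than almost everywhere.
    Apart from scalar factors, the terms of the forms are pairings of two such maps. *)
Definition bounded_field m p (L : X -> T -> 'M[R]_(m, p)) (C : R) : Prop :=
  [/\ 0 <= C, forall x, L2m mu D (L x),
      forall a x y z, L (lin a x y) z = a *: L x z + L y z &
      forall x, nrmm mu D (L x) <= C * nrm x].

Lemma bounded_field_map m p m' p' (L : X -> T -> 'M[R]_(m, p)) C
    (f : 'M[R]_(m, p) -> 'M[R]_(m', p')) :
  bounded_field L C ->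
  (forall A, L2m mu D A -> L2m mu D (f \o A)) ->
  (forall a A B, f (a *: A + B) = a *: f A + f B) ->
  (forall A, mdot (f A) (f A) <= mdot A A) ->
  bounded_field (fun x z => f (L x z)) C.
Proof.
move=> [C0 L2 Llin Lb] f2 flin fle; split => //.
- by move=> x; exact: f2.
- by move=> a x y z; rewrite Llin flin.
- move=> x; apply: le_trans (Lb x); rewrite -[leRHS]mul1r.
  apply: (nrmm_le_pw mD) => //; first exact: f2.
  by move=> z; rewrite expr1n mul1r; exact: fle.
Qed.

Lemma bounded_field_comb m p (L1 L2 : X -> T -> 'M[R]_(m, p)) C1 C2 c :
  bounded_field L1 C1 -> bounded_field L2 C2 ->
  bounded_field (fun x z => L1 x z - c *: L2 x z) (C1 + `|c| * C2).
Proof.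
move=> [C10 L12 L1lin L1b] [C20 L22 L2lin L2b].
have E x : (fun z => L1 x z - c *: L2 x z) = (fun z => - c *: L2 x z + L1 x z).
  by apply/funext => z; rewrite scaleNr addrC.
split.
- by rewrite addr_ge0 // mulr_ge0.
- by move=> x; rewrite E; exact: L2m_lin.
- move=> a x y z; rewrite L1lin L2lin !scalerDr !scalerN !scalerA (mulrC c a).
  by rewrite opprD addrACA.
- move=> x; rewrite E; apply: (le_trans (nrmm_lin mD _ (L22 x) (L12 x))).
  rewrite normrN addrC mulrDl lerD // -mulrA ler_wpM2l //.
Qed.

Lemma bounded_field_mul m p (L : X -> T -> 'M[R]_(m, p)) C (c : T -> R) (M : R) :
  0 <= M -> measurable_fun D c -> {ae mu, forall x, D x -> `|c x| <= M} ->
  bounded_field L C -> bounded_field (fun x z => c z *: L x z) (M * C).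
Proof.
move=> M0 mc cM [C0 L2 Llin Lb]; split.
- exact: mulr_ge0.
- by move=> x; exact: L2m_bounded_mul cM (L2 x).
- by move=> a x y z; rewrite Llin scalerDr !scalerA mulrC.
- move=> x; rewrite -mulrA; apply: (@le_trans _ _ (M * nrmm mu D (L x))); last first.
    by rewrite ler_wpM2l.
  apply: nrmm_le => //; first exact: L2m_bounded_mul cM (L2 x).
  apply: (ae_on_imp cM) => z Dz h; rewrite mdotZl mdotZr mulrA -expr2.
  apply: ler_wpM2r; first exact: mdot_ge0.
  by rewrite -real_normK ?num_real // ler_pXn2r ?nnegrE.
Qed.

(** The bound is existential because the estimates of solutions rest on the coercivity constant, not
    on this one. *)
Definition bounded_bilinear (a : X -> X -> R) : Prop :=
  [/\ forall t x y z, a (lin t x y) z = t * a x z + a y z,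
      forall t x y z, a z (lin t x y) = t * a z x + a z y &
      exists2 M, 0 <= M & forall x y, `|a x y| <= M * nrm x * nrm y].

Lemma bounded_bilinear_ipm m p (L1 L2 : X -> T -> 'M[R]_(m, p)) C1 C2 :
  bounded_field L1 C1 -> bounded_field L2 C2 ->
  bounded_bilinear (fun x y => ipm mu D (L1 x) (L2 y)).
Proof.
move=> [C10 L12 L1lin L1b] [C20 L22 L2lin L2b]; split.
- move=> t x y z; rewrite -(ipm_linl mD) //; congr ipm; apply/funext => w.
  exact: L1lin.
- move=> t x y z; rewrite -(ipm_linr mD) //; congr ipm; apply/funext => w.
  exact: L2lin.
- exists (C1 * C2); first exact: mulr_ge0.
  move=> x y; apply: (le_trans (ipm_cs mD (L12 x) (L22 y))).
  have -> : C1 * C2 * nrm x * nrm y = (C1 * nrm x) * (C2 * nrm y) by ring.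
  by apply: ler_pM; rewrite ?nrmm_ge0.
Qed.

Lemma bounded_bilinearD a b : bounded_bilinear a -> bounded_bilinear b ->
  bounded_bilinear (fun x y => a x y + b x y).
Proof.
move=> [al ar [M M0 aM]] [bl br [N N0 bN]]; split.
- by move=> t x y z; rewrite al bl mulrDr addrACA.
- by move=> t x y z; rewrite ar br mulrDr addrACA.
- exists (M + N); first exact: addr_ge0.
  by move=> x y; rewrite !mulrDl (le_trans (ler_normD _ _)) // lerD.
Qed.

Lemma bounded_bilinearZ c a : bounded_bilinear a ->
  bounded_bilinear (fun x y => c * a x y).
Proof.
move=> [al ar [M M0 aM]]; split.
- by move=> t x y z; rewrite al mulrDr mulrCA.
- by move=> t x y z; rewrite ar mulrDr mulrCA.
- exists (`|c| * M); first exact: mulr_ge0.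
  by move=> x y; rewrite normrM -!mulrA ler_wpM2l // mulrA.
Qed.

Lemma bounded_bilinearN a : bounded_bilinear a ->
  bounded_bilinear (fun x y => - a x y).
Proof.
move=> [al ar [M M0 aM]]; split.
- by move=> t x y z; rewrite al opprD mulrN.
- by move=> t x y z; rewrite ar opprD mulrN.
- by exists M => // x y; rewrite normrN.
Qed.

Lemma bounded_bilinearC a : bounded_bilinear a ->
  bounded_bilinear (fun x y => a y x).
Proof.
move=> [al ar [M M0 aM]]; split => //.
by exists M => // x y; rewrite mulrAC.
Qed.

Lemma eq_bounded_bilinear a b : (forall x y, a x y = b x y) ->
  bounded_bilinear a -> bounded_bilinear b.
Proof.
move=> ab [al ar [M M0 aM]]; split.
- by move=> t x y z; rewrite -!ab.
- by move=> t x y z; rewrite -!ab.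
- by exists M => // x y; rewrite -ab.
Qed.

Lemma bounded_bilinear_dist0 a x y z : bounded_bilinear a ->
  dist H x y = 0 -> a x z = a y z.
Proof.
move=> [al ar [M M0 aM]] xy; apply/eqP; rewrite -subr_eq0 -normr_le0.
have -> : a x z - a y z = a (lin (-1) y x) z by rewrite al; ring.
by apply: (le_trans (aM _ _)); rewrite -/(dist H x y) xy mulr0 mul0r.
Qed.

End BoundedForms.

Section PointwiseMaps.
Context (R : realType) (n : nat).
Implicit Types A B : 'M[R]_n.

Lemma tsym_lin a A B : tsym (a *: A + B) = a *: tsym A + tsym B.
Proof. by apply/matrixP => i j; rewrite !mxE; ring. Qed.

Lemma tskew_lin a A B : tskew (a *: A + B) = a *: tskew A + tskew B.
Proof. by apply/matrixP => i j; rewrite !mxE; ring. Qed.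

Lemma dev_lin a A B : dev (a *: A + B) = a *: dev A + dev B.
Proof.
rewrite /dev linearD /= linearZ /= mulrDl -mulrA raddfD /=.
by rewrite -scale_scalar_mx scalerBr opprD addrACA.
Qed.

Lemma tsym_le A : mdot (tsym A) (tsym A) <= mdot A A.
Proof.
rewrite /tsym mdotZl mdotZr; have := mdot_sqrD_le A A^T.
by rewrite mdot_tr; lra.
Qed.

Lemma tskew_le A : mdot (tskew A) (tskew A) <= mdot A A.
Proof.
rewrite /tskew mdotZl mdotZr; have := skew2_le A; rewrite /skew2; lra.
Qed.

Lemma mdot_scalar_mx A c : mdot A c%:M = c * \tr A.
Proof.
rewrite /mxtrace mulr_sumr; apply: eq_bigr => i _; rewrite (bigD1 i) //= mxE eqxx mulr1n mulrC.
by rewrite big1 ?addr0 // => j ji; rewrite mxE eq_sym (negPf ji) mulr0.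
Qed.

(** [dev] is the orthogonal projection onto trace-free matrices: it removes [(tr A)^2 / n] from the
    squared norm. *)
Lemma dev_le A : mdot (dev A) (dev A) <= mdot A A.
Proof.
have [n0|n0] := posnP n.
  rewrite /mdot !big1 // => i; by have := ltn_ord i; rewrite {2}n0.
have nR : n%:R != 0 :> R by rewrite pnatr_eq0 -lt0n.
set c := \tr A / n%:R.
have E1 : mdot A c%:M = c ^+ 2 * n%:R.
  by rewrite mdot_scalar_mx /c; field.
have E2 : mdot (c%:M : 'M[R]_n) c%:M = c ^+ 2 * n%:R.
  by rewrite mdot_scalar_mx mxtrace_scalar -mulr_natr; ring.
have -> : dev A = A + (-1) *: c%:M by rewrite scaleN1r /dev.
rewrite !(mdotDl, mdotDr, mdotZl, mdotZr) (mdotC c%:M A) E1 E2.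
have : 0 <= c ^+ 2 * n%:R by rewrite mulr_ge0 ?sqr_ge0.
by lra.
Qed.

Context d (T : measurableType d) (mu : {measure set T -> \bar R}).
Context (D : set T) (mD : measurable D).

Lemma L2m_tsym (A : T -> 'M[R]_n) : L2m mu D A -> L2m mu D (@tsym R n \o A).
Proof.
move=> hA i j; rewrite /=.
have := sq_integrableZ mD 2^-1 (sq_integrableD mD (hA i j) (hA j i)).
by congr sq_integrable; apply/funext => x; rewrite !mxE.
Qed.

Lemma L2m_tskew (A : T -> 'M[R]_n) : L2m mu D A -> L2m mu D (@tskew R n \o A).
Proof.
move=> hA i j; rewrite /=.
have := sq_integrableZ mD 2^-1 (sq_integrable_lin mD (-1) (hA j i) (hA i j)).
by congr sq_integrable; apply/funext => x; rewrite !mxE; ring.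
Qed.

Lemma L2m_dev (A : T -> 'M[R]_n) : L2m mu D A -> L2m mu D (@dev R n \o A).
Proof.
move=> hA i j; rewrite /=.
have str := sq_integrable_sum mD (index_enum 'I_n) (fun i => hA i i).
have := sq_integrable_lin mD (- (n%:R^-1 *+ (i == j))) str (hA i j).
congr sq_integrable; apply/funext => x; rewrite !mxE /mxtrace.
by case: (i == j); rewrite ?mulr1n ?mulr0n; ring.
Qed.

End PointwiseMaps.

Section Powers.
Context (R : realType).

Lemma powR_half_sqr (a r : R) : 0 <= a -> Num.sqrt a `^ r = a `^ (r / 2).
Proof. by move=> a0; rewrite -powR12_sqrt // -powRrM mulrC. Qed.

Lemma enormE n (x : 'rV[R]_n) : enorm x = Num.sqrt (mdot x x).
Proof. by rewrite /enorm vdotE. Qed.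

Lemma mdot_otimes n (u w : 'rV[R]_n) :
  mdot (otimes u w) (otimes u w) = mdot u u * mdot w w.
Proof.
rewrite /mdot !big_ord1 mulr_suml; apply: eq_bigr => i _.
rewrite mulr_sumr; apply: eq_bigr => j _.
by rewrite /otimes !mxE !big_ord1 !mxE; ring.
Qed.

End Powers.

(** * Products of fields by Hoelder's inequality *)

Section Hoelder.
Context d (T : measurableType d) (R : realType) (mu : {measure set T -> \bar R}).
Context (D : set T) (mD : measurable D).

Lemma Lnorm_restrict (f : T -> R) (p : R) : 0 < p -> (forall x, 0 <= f x) ->
  Lnorm mu p%:E (EFin \o (f \_ D)) = ((\int[mu]_(x in D) (f x `^ p)%:E) `^ p^-1)%E.
Proof.
move=> p0 f0; rewrite [@Lnorm]Lnorm.unlock; congr (poweR _ _).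
rewrite [RHS]integral_mkcond; apply: eq_integral => x _.
rewrite /= /patch; case: ifP => xD /=.
  by rewrite ger0_norm.
by rewrite normr0 powR0 // gt_eqF.
Qed.

Lemma hoelder_on (f g : T -> R) (p q : R) : measurable_fun D f -> measurable_fun D g ->
  (forall x, 0 <= f x) -> (forall x, 0 <= g x) -> 0 < p -> 0 < q -> p^-1 + q^-1 = 1 ->
  (\int[mu]_(x in D) (f x * g x)%:E <= (\int[mu]_(x in D) (f x `^ p)%:E) `^ p^-1 *
    (\int[mu]_(x in D) (g x `^ q)%:E) `^ q^-1)%E.
Proof.
move=> mf mg f0 g0 p0 q0 pq.
have mfD : measurable_fun setT (f \_ D) by apply/(measurable_restrict _ mD measurableT); rewrite setTI.
have mgD : measurable_fun setT (g \_ D) by apply/(measurable_restrict _ mD measurableT); rewrite setTI.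
rewrite -!Lnorm_restrict //.
apply: le_trans (hoelder mu mfD mgD p0 q0 pq).
rewrite Lnorm1 integral_mkcond; apply: le_of_eq.
apply: eq_integral => x _; rewrite /= /patch; case: ifP => xD /=.
  by rewrite ger0_norm // mulr_ge0.
by rewrite mul0r normr0.
Qed.

(** Hoelder for the squared norms with exponents [r / 2] and [s / 2]. It is used with [r = s = 4]
    for convection and with the exponents of the regularity assumption for viscosity. *)
Lemma hoelder_mx m p m' p' (A : T -> 'M[R]_(m, p)) (v : T -> 'M[R]_(m', p'))
    (r s a b : R) :
  measurable_mx D A -> measurable_mx D v -> 0 < r -> 0 < s ->
  (r / 2)^-1 + (s / 2)^-1 = 1 -> 0 <= a -> 0 <= b ->
  ((\int[mu]_(x in D) (Num.sqrt (mdot (A x) (A x)) `^ r)%:E) `^ r^-1 <= a%:E)%E ->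
  ((\int[mu]_(x in D) (Num.sqrt (mdot (v x) (v x)) `^ s)%:E) `^ s^-1 <= b%:E)%E ->
  (\int[mu]_(x in D) (mdot (A x) (A x) * mdot (v x) (v x))%:E <= ((a * b) ^+ 2)%:E)%E.
Proof.
move=> mA mv r0 s0 rs a0 b0.
under eq_integral do rewrite powR_half_sqr ?mdot_ge0 //.
move=> ha; under eq_integral do rewrite powR_half_sqr ?mdot_ge0 //.
move=> hb.
have r20 : 0 < r / 2 by rewrite divr_gt0.
have s20 : 0 < s / 2 by rewrite divr_gt0.
have sq (I : \bar R) (t c : R) : (0 <= I)%E -> 0 < t -> 0 <= c ->
    (I `^ t^-1 <= c%:E -> I `^ (t / 2)^-1 <= (c ^+ 2)%:E)%E.
  move=> I0 t0 c0 h.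
  have -> : (t / 2)^-1 = t^-1 * 2%:R by rewrite invf_div mulrC.
  rewrite poweRrM -powR_mulrn // -poweR_EFin; apply: gt0_ler_poweR => //.
    by rewrite in_itv /= poweR_ge0 leey.
  by rewrite in_itv /= lee_fin c0 leey.
apply: (le_trans (hoelder_on (measurable_mdot mA mA) (measurable_mdot mv mv)
  (fun x => mdot_ge0 _) (fun x => mdot_ge0 _) r20 s20 rs)).
rewrite exprMn EFinM; apply: lee_pmul.
- exact: poweR_ge0.
- exact: poweR_ge0.
- by apply: sq => //; apply: integral_ge0 => x _; rewrite lee_fin powR_ge0.
- by apply: sq => //; apply: integral_ge0 => x _; rewrite lee_fin powR_ge0.
Qed.

Lemma L2m_of_esq_lty m p (A : T -> 'M[R]_(m, p)) : measurable_mx D A ->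
  (esq mu D A < +oo)%E -> L2m mu D A.
Proof.
move=> mA Afin i j; split; first exact: mA.
apply/integrableP; split.
  by apply/measurable_EFinP; apply: measurable_funX; exact: mA.
apply: le_lt_trans Afin; apply: ge0_le_integral => //.
- by apply: measurableT_comp => //; apply/measurable_EFinP; apply: measurable_funX; exact: mA.
- by apply/measurable_EFinP; exact: measurable_mdot.
move=> x _; rewrite gee0_abs ?lee_fin ?sqr_ge0 // /mdot (bigD1 i) //= (bigD1 j) //=.
rewrite -addrA -expr2 lerDl addr_ge0 //.
  by apply: sumr_ge0 => l _; rewrite -expr2 sqr_ge0.
by apply: sumr_ge0 => k _; apply: sumr_ge0 => l _; rewrite -expr2 sqr_ge0.
Qed.

(** For products of fields, whose square integrability is itself part of what the estimate
    proves. *)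
Lemma nrmm_le_esq m p (A : T -> 'M[R]_(m, p)) (c : R) : measurable_mx D A -> 0 <= c ->
  (esq mu D A <= (c ^+ 2)%:E)%E -> L2m mu D A /\ nrmm mu D A <= c.
Proof.
move=> mA c0 Ac.
have hA : L2m mu D A by apply: L2m_of_esq_lty => //; exact: le_lt_trans Ac (ltry _).
split => //; rewrite -ler_sqr ?nnegrE ?nrmm_ge0 //.
by rewrite -lee_fin -esqE.
Qed.

End Hoelder.

Section DomainEstimates.
Context (R : realType) (n : nat) (Omega : set 'rV[R]_n).
Hypotheses (oO : open Omega) (bO : bounded_set Omega).
Local Notation T := (caratheodory_type (leb_om R n)).
Local Notation mu := (lebR R n).
Let mO : measurable (Omega : set T) := measurable_domain oO.

Lemma measurable_otimes (u w : H1 Omega) :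
  @measurable_mx _ T R Omega n n (fun x => otimes (u x) (w x)).
Proof.
move=> i j.
have -> : (fun x : T => otimes (u x) (w x) i j) = (fun x => u x ord0 i * w x ord0 j).
  by apply/funext => x; rewrite /otimes !mxE big_ord1 !mxE.
by apply: measurable_funM; [have [] := h1_L2 u i|have [] := h1_L2 w j].
Qed.

Lemma normLpvE (p : R) (v : vfield R n) : normLpv Omega p v =
  ((\int[mu]_(x in Omega) (Num.sqrt (mdot (v x) (v x)) `^ p)%:E) `^ p^-1)%E.
Proof.
have E x : (enorm (v x) `^ p)%:E = (Num.sqrt (mdot (v x) (v x)) `^ p)%:E :> \bar R.
  by rewrite enormE.
rewrite /normLpv /eintO.
by under eq_integral do rewrite E.
Qed.

Section Otimes.
Variable i4 : R.
Hypotheses (i40 : 0 <= i4)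
  (hi4 : forall v : H1 Omega, (normLpv Omega 4 v <= i4%:E * (norm1 v)%:E)%E).

(** [|u (x) w| = |u| |w|] pointwise, and both factors are in [L^4]; the constant is [i4 ^+ 2], that
    is [c1]. *)
Lemma otimes_bound (u w : H1 Omega) :
  @L2m _ T R mu Omega n n (fun x => otimes (u x) (w x)) /\
  @nrmm _ T R mu Omega n n (fun x => otimes (u x) (w x)) <= i4 ^+ 2 * norm1 u * norm1 w.
Proof.
have n0 (v : H1 Omega) : 0 <= norm1 v by exact: sqrtr_ge0.
have E : i4 ^+ 2 * norm1 u * norm1 w = (i4 * norm1 u) * (i4 * norm1 w) by ring.
apply: (nrmm_le_esq mO (measurable_otimes u w)).
  by rewrite E !mulr_ge0.
rewrite E /esq; under eq_integral do rewrite mdot_otimes.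
have h4 : 0 < 4 :> R by [].
have h44 : (4 / 2 : R)^-1 + (4 / 2)^-1 = 1 by field.
have key (v : H1 Omega) : ((\int[mu]_(x in Omega)
   (Num.sqrt (mdot (v x) (v x)) `^ 4)%:E) `^ 4^-1 <= (i4 * norm1 v)%:E)%E.
  rewrite EFinM; apply: le_trans (hi4 v).
  by rewrite normLpvE.
by apply: (hoelder_mx mO (L2m_measurable (h1_L2m u)) (L2m_measurable (h1_L2m w)) h4 h4 h44
  _ _ (key u) (key w)); rewrite mulr_ge0.
Qed.

End Otimes.

End DomainEstimates.

Section Viscosity.
Context (R : realType).

Lemma sqrt_sum_sqr_le (a b : R) : Num.sqrt (a ^+ 2 + b ^+ 2) <= `|a| + `|b|.
Proof.
rewrite -ler_sqr ?nnegrE ?sqrtr_ge0 ?addr_ge0 //.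
rewrite sqr_sqrtr ?addr_ge0 ?sqr_ge0 // sqrrD !real_normK ?num_real //.
by have := mulr_ge0 (normr_ge0 a) (normr_ge0 b); lra.
Qed.

(* A Lipschitz function is the infimum over rational [(p, q)] of the functions
   [nu p q + L (|a - p| + |b - q|)]. *)
Lemma measurable_lipschitz2 d (T : measurableType d) (D : set T) (nu : R -> R -> R)
    (L : R) (f g : T -> R) : 0 <= L ->
  (forall a b a' b', `|nu a b - nu a' b'| <= L * (`|a - a'| + `|b - b'|)) ->
  measurable_fun D f -> measurable_fun D g ->
  measurable_fun D (fun x => nu (f x) (g x)).
Proof.
move=> L0 hL mf mg mD; apply: (measurability _ (RGenInftyO.measurableE R)) => //.
move=> _ [_ [c ->] <-].
pose h (r : rat * rat) x := nu (ratr r.1) (ratr r.2) +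
  L * (`|f x - ratr r.1| + `|g x - ratr r.2|).
have -> : D `&` (fun x => nu (f x) (g x)) @^-1` `]-oo, c[ =
    \bigcup_(r in [set: (rat * rat)%type]) (D `&` h r @^-1` `]-oo, c[).
  apply/seteqP; split => x.
    move=> [Dx]; rewrite /= in_itv /= => nc.
    (* Rational points within [e] of [f x] and [g x] raise the value by at most [4 L e], which is
       less than the gap to [c]. *)
    pose e := (c - nu (f x) (g x)) / (4 * (L + 1)).
    have L1 : 0 < 4 * (L + 1) by lra.
    have e0 : 0 < e by rewrite divr_gt0 // subr_gt0.
    have eE : e * (4 * (L + 1)) = c - nu (f x) (g x) by rewrite mulfVK // gt_eqF.
    have [p] := @rat_in_itvoo R (f x - e) (f x + e) ltac:(lra).
    rewrite in_itv /= => /andP[p1 p2].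
    have [q] := @rat_in_itvoo R (g x - e) (g x + e) ltac:(lra).
    rewrite in_itv /= => /andP[q1 q2].
    exists (p, q) => //; split => //=; rewrite in_itv /= /h /=.
    have fp : `|f x - ratr p| <= e by rewrite ler_norml; apply/andP; split; lra.
    have gq : `|g x - ratr q| <= e by rewrite ler_norml; apply/andP; split; lra.
    have := hL (ratr p) (ratr q) (f x) (g x).
    rewrite !(distrC (ratr _)) => /(le_trans (ler_norm _)) hn.
    have hn2 : L * (`|f x - ratr p| + `|g x - ratr q|) <= L * (e + e).
      by rewrite ler_wpM2l // lerD.
    by lra.
  move=> [r _ [Dx]]; rewrite /= in_itv /= /h => hc; split => //=; rewrite in_itv /=.
  apply: le_lt_trans hc.
  have := hL (f x) (g x) (ratr r.1) (ratr r.2).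
  by move=> /(le_trans (ler_norm _)); lra.
apply: countable_bigcupT_measurable => [|r]; first exact: countableP.
have mh : measurable_fun D (h r).
  apply: measurable_funD; first exact: measurable_cst.
  apply: measurable_funM; first exact: measurable_cst.
  by apply: measurable_funD; apply: measurableT_comp => //; apply: measurable_funB => //;
    exact: measurable_cst.
by apply: mh => //; exact: measurable_itv.
Qed.

Lemma vcompB n k (x y : 'rV[R]_n) : vcomp k (x - y) = vcomp k x - vcomp k y.
Proof. by rewrite /vcomp; case: insub => [i|]; rewrite ?mxE ?subrr ?subr0. Qed.

(** At most two distinct coordinates contribute; an index out of range contributes 0. *)
Lemma vcomp_sqr_le n (x : 'rV[R]_n) : vcomp 0 x ^+ 2 + vcomp 1 x ^+ 2 <= mdot x x.
Proof.
rewrite /mdot big_ord1.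
have pos (P : pred 'I_n) : 0 <= \sum_(l | P l) x ord0 l * x ord0 l.
  by apply: sumr_ge0 => l _; rewrite -expr2 sqr_ge0.
rewrite /vcomp; case: insubP => [i _ vi|_]; case: insubP => [j _ vj|_].
- have ij : j != i by apply/eqP => E; move: vj; rewrite E vi.
  by rewrite (bigD1 i) //= (bigD1 j) //= addrA -!expr2 lerDl.
- by rewrite expr0n addr0 (bigD1 i) //= -expr2 lerDl.
- by rewrite expr0n add0r (bigD1 j) //= -expr2 lerDl.
- by rewrite !expr0n addr0.
Qed.

(** Source of the factors [sqrt (2 + k^2)]. Cauchy-Schwarz in the plane gives [1 + k^2]; the weaker
    [2 + k^2] is the one in the constants of the theorem. *)
Lemma comb_le_sqrt (k a b N : R) : 0 <= a -> 0 <= b -> 0 <= N ->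
  a ^+ 2 + b ^+ 2 <= N ^+ 2 -> a + `|k| * b <= Num.sqrt (2 + k ^+ 2) * N.
Proof.
move=> a0 b0 N0 abN; have k2 : 0 <= 2 + k ^+ 2 by rewrite addr_ge0 ?sqr_ge0.
rewrite -ler_sqr ?nnegrE ?addr_ge0 ?mulr_ge0 ?sqrtr_ge0 //.
rewrite exprMn sqr_sqrtr // -[in leRHS](real_normK (num_real k)).
move: (`|k|) (normr_ge0 k) => t t0.
apply: (@le_trans _ _ ((2 + t ^+ 2) * (a ^+ 2 + b ^+ 2))); last first.
  by rewrite ler_wpM2l // addr_ge0 ?sqr_ge0.
have h1 := sqr_ge0 (t * a - b); have h2 := sqr_ge0 a; have h3 := sqr_ge0 b.
by nra.
Qed.

End Viscosity.

Section Forms.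
Context (R : realType) (n : nat) (Omega : set 'rV[R]_n).
Hypotheses (oO : open Omega) (bO : bounded_set Omega).
Local Notation T := (caratheodory_type (leb_om R n)).
Local Notation mu := (lebR R n).
Let mO : measurable (Omega : set T) := measurable_domain oO.
Local Notation Hp := (h1preip oO bO).
Local Notation HHp := (hhpreip oO bO).
Local Notation ipt := (@ipm _ T R mu Omega n n).
Local Notation ipv := (@ipm _ T R mu Omega 1 n).
Local Notation nrt := (@nrmm _ T R mu Omega n n).
Local Notation nrv := (@nrmm _ T R mu Omega 1 n).
Implicit Types (xi eta : HH Omega) (w phi psi chi : H1 Omega).

Lemma bf_ht : @bounded_field _ T R mu Omega _ HHp n n (fun xi => ht xi) 1.
Proof.
split=> [|xi||xi]; [exact: ler01|exact: l2_L2|reflexivity|].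
by rewrite mul1r -normHHE; exact: norm0t_ht_le.
Qed.

Lemma bf_hs : @bounded_field _ T R mu Omega _ HHp n n (fun xi => hs xi) 1.
Proof.
split=> [|xi||xi]; [exact: ler01|exact: hd_L2|reflexivity|].
by rewrite mul1r -normHHE; exact: norm0t_hs_le.
Qed.

Lemma bf_hdiv : @bounded_field _ T R mu Omega _ HHp 1 n (fun xi => hdiv (hs xi)) 1.
Proof.
split=> [|xi||xi]; [exact: ler01|exact: hdiv_L2m|reflexivity|].
by rewrite mul1r -normHHE -norm0vE; exact: norm0v_hdiv_le.
Qed.

Lemma bf_hu : @bounded_field _ T R mu Omega _ HHp 1 n (fun xi => hu xi) 1.
Proof.
split=> [|xi||xi]; [exact: ler01|exact: h1_L2m|reflexivity|].
rewrite mul1r -normHHE -norm0vE (le_trans (norm0v_le_norm1 _)) //.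
exact: norm1_hu_le.
Qed.

Lemma bf_grad : @bounded_field _ T R mu Omega _ Hp n n (fun v => grad v) 1.
Proof.
split=> [|v||v]; [exact: ler01|exact: grad_L2|reflexivity|].
by rewrite mul1r -norm1E; exact: semi1_le_norm1.
Qed.

Lemma bf_ghu : @bounded_field _ T R mu Omega _ HHp n n (fun xi => grad (hu xi)) 1.
Proof.
split=> [|xi||xi]; [exact: ler01|exact: grad_L2|reflexivity|].
rewrite mul1r -normHHE (le_trans (semi1_le_norm1 _)) //.
exact: norm1_hu_le.
Qed.

Lemma bf_dev X (H : preip R X) (L : X -> T -> 'M[R]_n) C :
  bounded_field mu Omega H L C ->
  bounded_field mu Omega H (fun x z => dev (L x z)) C.
Proof.
move=> bL; apply: (bounded_field_map mO bL) => [A|a A B|A].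
- exact: L2m_dev.
- exact: dev_lin.
- exact: dev_le.
Qed.

Lemma bf_tsym X (H : preip R X) (L : X -> T -> 'M[R]_n) C :
  bounded_field mu Omega H L C ->
  bounded_field mu Omega H (fun x z => tsym (L x z)) C.
Proof.
move=> bL; apply: (bounded_field_map mO bL) => [A|a A B|A].
- exact: L2m_tsym.
- exact: tsym_lin.
- exact: tsym_le.
Qed.

Lemma bf_tskew X (H : preip R X) (L : X -> T -> 'M[R]_n) C :
  bounded_field mu Omega H L C ->
  bounded_field mu Omega H (fun x z => tskew (L x z)) C.
Proof.
move=> bL; apply: (bounded_field_map mO bL) => [A|a A B|A].
- exact: L2m_tskew.
- exact: tskew_lin.
- exact: tskew_le.
Qed.

Section Visc.
Variables (nu : R -> R -> R) (nu1 nu2 Lnu : R).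
Hypotheses (hnu1 : 0 < nu1) (hnu : forall a b, nu1 <= nu a b <= nu2)
  (hLnu : forall a b a' b', `|nu a b - nu a' b'| <=
            Lnu * Num.sqrt ((a - a') ^+ 2 + (b - b') ^+ 2)).

Lemma Lnu_ge0 : 0 <= Lnu.
Proof.
have := hLnu 1 0 0 0; rewrite subr0 subrr expr1n expr0n addr0 sqrtr1 mulr1.
exact: le_trans.
Qed.

Lemma visc_measurable phi : measurable_fun (Omega : set T) (visc nu phi : T -> R).
Proof.
have mc k : measurable_fun (Omega : set T) (fun x : T => vcomp k (phi x) : R).
  rewrite /vcomp; case: insub => [i|]; last exact: measurable_cst.
  by have [] := h1_L2 phi i.
apply: (measurable_lipschitz2 Lnu_ge0 _ (mc 0%N) (mc 1%N)) => a b a' b'.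
apply: (le_trans (hLnu a b a' b')).
by rewrite ler_wpM2l ?Lnu_ge0 // sqrt_sum_sqr_le.
Qed.

Lemma visc_bound phi : {ae mu, forall x, Omega x -> `|visc nu phi x| <= nu2}.
Proof.
apply: nearW => x _; have /andP[h1 h2] := hnu (vcomp 0 (phi x)) (vcomp 1 (phi x)).
by rewrite ger0_norm // (le_trans (ltW hnu1)).
Qed.

Lemma nu2_ge0 : 0 <= nu2.
Proof. by have /andP[h1 h2] := hnu 0 0; rewrite (le_trans (ltW hnu1)) // (le_trans h1). Qed.

Variables (gamma k1 k2 k3 : R).
Local Notation fA := (@formA R n Omega nu gamma k1 k2 k3).

(** The test combination shared by the viscous term, the [dev sigma] term and, up to sign,
    [formB]. *)
Definition rtau eta (x : T) : 'M[R]_n := ht eta x - k3 *: dev (hs eta x).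

Lemma bf_rtau : bounded_field mu Omega HHp rtau (1 + `|k3| * 1).
Proof. exact: (bounded_field_comb mO k3 bf_ht (bf_dev bf_hs)). Qed.

Lemma viscE phi xi eta : intO Omega (fun x =>
   visc nu phi x * tdot (ht xi x) (ht eta x - k3 *: dev (hs eta x))) =
   ipt (fun x => visc nu phi x *: ht xi x) (rtau eta).
Proof. by apply: eq_Rintegral => x _; rewrite mdotZl. Qed.

Lemma intO_vdot (u v : vfield R n) : intO Omega (fun x => vdot (u x) (v x)) = ipv u v.
Proof. by apply: eq_Rintegral => x _; rewrite vdotE. Qed.

Lemma formA_bilinear phi : bounded_bilinear HHp (fA phi).
Proof.
have bv := bounded_field_mul mO nu2_ge0 (visc_measurable phi) (visc_bound phi) bf_ht.
have t1 := bounded_bilinearZ 2 (bounded_bilinear_ipm mO bv bf_rtau).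
have t2 := bounded_bilinear_ipm mO bf_ht
  (bounded_field_comb mO k1 (bf_dev bf_hs) (bf_tsym bf_ghu)).
have t3 := bounded_bilinearN (bounded_bilinear_ipm mO (bf_dev bf_hs) bf_rtau).
have t4 := bounded_bilinearZ (1 - k2 * gamma) (bounded_bilinear_ipm mO bf_hu bf_hdiv).
have t5 := bounded_bilinearN (bounded_bilinearC (bounded_bilinear_ipm mO bf_hu bf_hdiv)).
have t6 := bounded_bilinear_ipm mO (bf_tskew bf_ghu) bf_hs.
have t7 := bounded_bilinearN (bounded_bilinear_ipm mO bf_hs (bf_tskew bf_ghu)).
have t8 := bounded_bilinearZ gamma (bounded_bilinear_ipm mO bf_hu bf_hu).
have t9 := bounded_bilinearZ k2 (bounded_bilinear_ipm mO bf_hdiv bf_hdiv).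
have t10 := bounded_bilinearZ k1 (bounded_bilinear_ipm mO (bf_tsym bf_ghu) (bf_tsym bf_ghu)).
have := bounded_bilinearD (bounded_bilinearD (bounded_bilinearD (bounded_bilinearD
  (bounded_bilinearD (bounded_bilinearD (bounded_bilinearD (bounded_bilinearD
  (bounded_bilinearD t1 t2) t3) t4) t5) t6) t7) t8) t9) t10.
apply: eq_bounded_bilinear => xi eta; rewrite /formA.
rewrite viscE !intO_vdot.
by [].
Qed.

End Visc.
End Forms.

(** [fine] maps infinite values to 0. The bound [M] excludes [+oo]; for [-oo] the defining
    inequality is false on [D], so the claim holds there vacuously. *)
Lemma ess_sup_restrict_ae d (T : measurableType d) (R : realType)
    (mu : {measure set T -> \bar R}) (D : set T) (f : T -> R) (M : R) :
  {ae mu, forall x, D x -> f x <= M} ->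
  {ae mu, forall x, D x -> f x <= fine (ess_sup mu ((fun x => (f x)%:E) \_ D))}.
Proof.
move=> HM.
have hM : (ess_sup mu ((fun x => (f x)%:E) \_ D) <= (Num.max M 0)%:E)%E.
  apply/ess_supP; apply: filterS HM => x H; rewrite /patch; case: ifPn => [xO|_].
    by rewrite lee_fin le_max H //; exact: set_mem.
  by rewrite lee_fin le_max lexx orbT.
have : {ae mu, forall x : T, (((fun x => (f x)%:E) \_ D) x <=
    ess_sup mu ((fun x => (f x)%:E) \_ D))%E} by exact: ess_sup_ge.
move: hM; set s := ess_sup _ _; case: s => [s| |] //= _.
- by apply: filterS => x; rewrite /patch => + Ox; rewrite mem_set // lee_fin.
- by apply: filterS => x; rewrite /patch => + Ox; rewrite mem_set.
Qed.

Lemma ess_sup_restrict_ge0 d (T : measurableType d) (R : realType)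
    (mu : {measure set T -> \bar R}) (D : set T) (f : T -> R) :
  (forall x, 0 <= f x) -> 0 <= fine (ess_sup mu ((fun x => (f x)%:E) \_ D)).
Proof.
move=> f0.
have : {ae mu, forall x : T, (((fun x => (f x)%:E) \_ D) x <=
    ess_sup mu ((fun x => (f x)%:E) \_ D))%E} by exact: ess_sup_ge.
set s := ess_sup _ _; case E : s => [r| |] //= H; rewrite leNgt; apply/negP => r0.
(* If [r < 0], the almost everywhere inequality [H] is false at every point, so any bound holds
   almost everywhere, even [r - 1]. *)
have : (s <= (r - 1)%:E)%E.
  apply/ess_supP; apply: filterS H => x; rewrite /patch; case: ifP => _.
    by rewrite lee_fin => h; have := le_lt_trans (le_trans (f0 x) h) r0; rewrite ltxx.
  by rewrite lee_fin => h; have := le_lt_trans h r0; rewrite ltxx.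
by rewrite E lee_fin lerBrDr gerDl ler10.
Qed.

Lemma Rintegral_ae_ge0 d (T : measurableType d) (R : realType)
    (mu : {measure set T -> \bar R}) (D : set T) (f : T -> R) : measurable D ->
  mu.-integrable D (fun x => (f x)%:E) -> {ae mu, forall x, D x -> 0 <= f x} ->
  0 <= \int[mu]_(x in D) f x.
Proof.
move=> mD fi f0; apply: fine_ge0.
have mf := measurable_int _ fi.
rewrite (@ae_eq_integral _ _ _ mu D (fun x => `|(f x)%:E|)%E) //.
- by apply: integral_ge0 => x _; exact: abse_ge0.
- exact: measurableT_comp.
- by apply: filterS f0 => x H Dx; rewrite gee0_abs // lee_fin H.
Qed.

Lemma esq_le_integral d (T : measurableType d) (R : realType)
    (mu : {measure set T -> \bar R}) (D : set T) m p (B : T -> 'M[R]_(m, p))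
    (h : T -> R) (c : R) : measurable D -> measurable_mx D B -> measurable_fun D h ->
  (forall x, 0 <= h x) -> (forall x, mdot (B x) (B x) <= c * h x) -> 0 <= c ->
  (esq mu D B <= c%:E * \int[mu]_(x in D) (h x)%:E)%E.
Proof.
move=> mD mB mh h0 Bh c0; rewrite -ge0_integralZl //.
- apply: ge0_le_integral => //.
  + by move=> x _; rewrite lee_fin mdot_ge0.
  + by apply/measurable_EFinP; exact: measurable_mdot.
  + by apply/measurable_EFinP; apply: measurable_funM.
  + by move=> x _; rewrite -EFinM lee_fin Bh.
- exact/measurable_EFinP.
- by move=> x _; rewrite lee_fin.
Qed.

Section FormBounds.
Context (R : realType) (n : nat) (Omega : set 'rV[R]_n).
Hypotheses (oO : open Omega) (bO : bounded_set Omega).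
Local Notation T := (caratheodory_type (leb_om R n)).
Local Notation mu := (lebR R n).
Let mO : measurable (Omega : set T) := measurable_domain oO.
Local Notation Hp := (h1preip oO bO).
Local Notation HHp := (hhpreip oO bO).
Local Notation ipt := (@ipm _ T R mu Omega n n).
Local Notation ipv := (@ipm _ T R mu Omega 1 n).
Local Notation nrt := (@nrmm _ T R mu Omega n n).
Local Notation nrv := (@nrmm _ T R mu Omega 1 n).
Implicit Types (xi eta : HH Omega) (w phi psi chi : H1 Omega).

Lemma normHH_ge0 xi : 0 <= normHH xi. Proof. exact: sqrtr_ge0. Qed.
Lemma norm1_ge0 phi : 0 <= norm1 phi. Proof. exact: sqrtr_ge0. Qed.

Lemma rtau_L2 k3 eta : @L2m _ T R mu Omega n n (rtau k3 eta).
Proof. by have [_ h _ _] := bf_rtau oO bO k3; exact: h. Qed.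

Lemma rtau_le k3 eta : nrt (rtau k3 eta) <= Num.sqrt (2 + k3 ^+ 2) * normHH eta.
Proof.
have hd := L2m_dev mO (hd_L2 (hs eta)).
have E : rtau k3 eta = (fun x => - k3 *: dev (hs eta x) + ht eta x).
  by apply/funext => x; rewrite /rtau scaleNr addrC.
rewrite E; apply: (le_trans (nrmm_lin mO (- k3) hd (l2_L2 (ht eta)))).
rewrite normrN addrC.
have nd : nrt (fun x => dev (hs eta x)) <= nrt (hs eta).
  rewrite -[leRHS]mul1r; apply: (nrmm_le_pw mO ler01 (hd_L2 (hs eta)) hd) => x.
  by rewrite expr1n mul1r; exact: dev_le.
apply: (@le_trans _ _ (norm0t Omega (ht eta) + `|k3| * norm0t Omega (hs eta))).
  by rewrite lerD2l ler_wpM2l.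
apply: comb_le_sqrt; rewrite ?sqrtr_ge0 //.
by rewrite sqr_normHH -[leRHS]addrA lerD2l -addrA lerDl addr_ge0 ?sqr_ge0.
Qed.

Definition vdiv k2 eta (x : T) : 'rV[R]_n := hu eta x - k2 *: hdiv (hs eta) x.

Lemma bf_vdiv k2 : bounded_field mu Omega HHp (vdiv k2) (1 + `|k2| * 1).
Proof. exact: (bounded_field_comb mO k2 (bf_hu oO bO) (bf_hdiv oO bO)). Qed.

Lemma vdiv_L2 k2 eta : @L2m _ T R mu Omega 1 n (vdiv k2 eta).
Proof. by have [_ h _ _] := bf_vdiv k2; exact: h. Qed.

Lemma vdiv_le k2 eta : nrv (vdiv k2 eta) <= Num.sqrt (2 + k2 ^+ 2) * normHH eta.
Proof.
have E : vdiv k2 eta = (fun x => - k2 *: hdiv (hs eta) x + hu eta x).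
  by apply/funext => x; rewrite /vdiv scaleNr addrC.
rewrite E; apply: (le_trans (nrmm_lin mO (- k2) (hdiv_L2m (hs eta)) (h1_L2m (hu eta)))).
rewrite normrN addrC -!norm0vE.
apply: (@le_trans _ _ (norm1 (hu eta) + `|k2| * norm0v Omega (hdiv (hs eta)))).
  by rewrite lerD2r; exact: norm0v_le_norm1.
apply: comb_le_sqrt; rewrite ?sqrtr_ge0 //.
rewrite sqr_normHH addrC lerD2r addrA lerDr.
by rewrite addr_ge0 ?sqr_ge0.
Qed.

Section Buoyancy.
Variables (alpha g : 'rV[R]_n) (k2 : R).

Definition buoy phi (x : T) : 'rV[R]_n := vdot alpha (phi x) *: g.

Lemma buoy_L2 phi : @L2m _ T R mu Omega 1 n (buoy phi).
Proof.
move=> i j.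
have h := sq_integrable_sum mO (index_enum 'I_n)
  (fun l => sq_integrableZ mO (alpha ord0 l) (h1_L2 phi l)).
have := sq_integrableZ mO (g i j) h.
by congr sq_integrable; apply/funext => x; rewrite /buoy mxE mulrC.
Qed.

Lemma buoy_le phi : nrv (buoy phi) <= enorm alpha * enorm g * norm0v Omega phi.
Proof.
rewrite norm0vE; apply: (nrmm_le_pw mO _ (h1_L2m phi) (buoy_L2 phi)).
  by rewrite mulr_ge0 // sqrtr_ge0.
move=> x; rewrite /buoy mdotZl mdotZr vdotE.
have E (y : 'rV[R]_n) : enorm y ^+ 2 = mdot y y.
  by rewrite /enorm vdotE sqr_sqrtr // mdot_ge0.
have cs : mdot alpha (phi x) ^+ 2 <= mdot alpha alpha * mdot (phi x) (phi x).
  have := ip_cauchy_schwarz (mdot_preip R 1 n) alpha (phi x).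
  rewrite -ler_sqr ?nnegrE ?mulr_ge0 ?nrm_ge0 //.
  by rewrite real_normK ?num_real // exprMn !sqr_nrm.
rewrite exprMn !E; move: cs (mdot_ge0 g).
move: (mdot alpha (phi x)) (mdot alpha alpha) (mdot g g) (mdot (phi x) (phi x)) => m a b c cs b0.
by have := ler_wpM2r b0 cs; lra.
Qed.

Lemma funFE phi eta : funF alpha g k2 phi eta = ipv (buoy phi) (vdiv k2 eta).
Proof.
apply: eq_Rintegral => x _; rewrite /buoy mdotZl; congr (_ * _); exact: vdotE.
Qed.

Lemma funF_bound phi eta : `|funF alpha g k2 phi eta| <=
  Num.sqrt (2 + k2 ^+ 2) * (enorm alpha * enorm g) * norm0v Omega phi * normHH eta.
Proof.
rewrite funFE; apply: (le_trans (ipm_cs mO (buoy_L2 phi) (vdiv_L2 k2 eta))).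
have -> : Num.sqrt (2 + k2 ^+ 2) * (enorm alpha * enorm g) * norm0v Omega phi * normHH eta =
  (enorm alpha * enorm g * norm0v Omega phi) * (Num.sqrt (2 + k2 ^+ 2) * normHH eta).
  by ring.
by apply: ler_pM; [exact: nrmm_ge0|exact: nrmm_ge0|exact: buoy_le|exact: vdiv_le].
Qed.

Lemma funF_linr phi a xi eta : funF alpha g k2 phi (hhlin oO bO a xi eta) =
  a * funF alpha g k2 phi xi + funF alpha g k2 phi eta.
Proof.
rewrite !funFE -(ipm_linr mO); [|exact: vdiv_L2|exact: vdiv_L2|exact: buoy_L2].
congr ipm; apply/funext => x.
by have [_ _ h _] := bf_vdiv k2; exact: h.
Qed.

Lemma funF_linl a phi psi eta : funF alpha g k2 (h1lin oO bO a phi psi) eta =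
  a * funF alpha g k2 phi eta + funF alpha g k2 psi eta.
Proof.
rewrite !funFE -(ipm_linl mO); [|exact: buoy_L2|exact: buoy_L2|exact: vdiv_L2].
congr ipm; apply/funext => x; rewrite /buoy /= scalerA -scalerDl; congr (_ *: _).
by rewrite !vdotE mdotDr mdotZr.
Qed.

End Buoyancy.

Section Convection.
Variable i4 : R.
Hypotheses (i40 : 0 <= i4)
  (hi4 : forall v : H1 Omega, (normLpv Omega 4 v <= i4%:E * (norm1 v)%:E)%E).
Let c1 := i4 ^+ 2.

Let otL2 u w := proj1 (otimes_bound oO i40 hi4 u w).
Let otb u w := proj2 (otimes_bound oO i40 hi4 u w).

Lemma otimes_linl a (u v w : 'rV[R]_n) : otimes (a *: u + v) w = a *: otimes u w + otimes v w.
Proof. by rewrite /otimes linearD linearZ /= mulmxDl -scalemxAl. Qed.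

Lemma otimes_linr a (u v w : 'rV[R]_n) : otimes w (a *: u + v) = a *: otimes w u + otimes w v.
Proof. by rewrite /otimes mulmxDr -scalemxAr. Qed.

Lemma c1norm_ge0 w : 0 <= c1 * norm1 w.
Proof. by rewrite mulr_ge0 ?sqr_ge0 ?sqrtr_ge0. Qed.

Lemma bf_otimesl w : bounded_field mu Omega HHp (fun xi x => otimes (hu xi x) (w x)) (c1 * norm1 w).
Proof.
split=> [|xi|a xi eta x|xi]; [exact: c1norm_ge0|exact: otL2|exact: otimes_linl|].
apply: (le_trans (otb (hu xi) w)); rewrite mulrAC ler_wpM2l ?c1norm_ge0 //.
by rewrite -normHHE; exact: norm1_hu_le.
Qed.

Variable k3 : R.

Lemma formBE w xi eta : Defs.formB k3 w xi eta =
  - ipt (fun x => dev (otimes (hu xi x) (w x))) (rtau k3 eta).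
Proof.
have h1 := L2m_dev mO (otL2 (hu xi) w).
have := ipm_linr mO (-1) (rtau_L2 k3 eta) (@L2m0 _ T R mu Omega n n) h1.
have -> : ipt (@dev R n \o (fun x => otimes (hu xi x) (w x))) (fun=> 0) = 0.
  by rewrite ipmC; exact: ipm0.
rewrite addr0 mulN1r => <-; apply: eq_Rintegral => x _.
by congr (tdot _ _); rewrite /rtau addr0 scaleN1r opprB.
Qed.

Lemma formB_bilinear w : bounded_bilinear HHp (Defs.formB k3 w).
Proof.
have := bounded_bilinearN (bounded_bilinear_ipm mO (bf_dev oO (bf_otimesl w)) (bf_rtau oO bO k3)).
by apply: eq_bounded_bilinear => xi eta; rewrite formBE.
Qed.

Lemma formB_bound w xi eta : `|Defs.formB k3 w xi eta| <=
  c1 * Num.sqrt (2 + k3 ^+ 2) * norm1 w * norm1 (hu xi) * normHH eta.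
Proof.
rewrite formBE normrN.
have h1 := L2m_dev mO (otL2 (hu xi) w).
apply: (le_trans (ipm_cs mO h1 (rtau_L2 k3 eta))).
have -> : c1 * Num.sqrt (2 + k3 ^+ 2) * norm1 w * norm1 (hu xi) * normHH eta =
  (c1 * norm1 (hu xi) * norm1 w) * (Num.sqrt (2 + k3 ^+ 2) * normHH eta) by ring.
apply: ler_pM; [exact: nrmm_ge0|exact: nrmm_ge0| |exact: rtau_le].
apply: le_trans (otb (hu xi) w).
rewrite -[leRHS]mul1r; apply: (nrmm_le_pw mO ler01 (otL2 (hu xi) w) h1) => x.
by rewrite expr1n mul1r; exact: dev_le.
Qed.

Lemma formB_linw a w w' xi eta : Defs.formB k3 (h1lin oO bO a w w') xi eta =
  a * Defs.formB k3 w xi eta + Defs.formB k3 w' xi eta.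
Proof.
rewrite !formBE.
have h1 := L2m_dev mO (otL2 (hu xi) w); have h2 := L2m_dev mO (otL2 (hu xi) w').
rewrite mulrN -opprD; congr (- _).
apply: etrans (ipm_linl mO a h1 h2 (rtau_L2 k3 eta)); congr ipm; apply/funext => x /=.
by rewrite otimes_linr dev_lin.
Qed.

(** [(grad phi) w . psi = grad phi : (psi (x) w)], which lets [otimes_bound] serve for the heat
    convection as well. *)
Lemma funGE w phi psi : funG w phi psi =
  - ipt (grad phi) (fun x => otimes (psi x) (w x)).
Proof.
congr (- _); apply: eq_Rintegral => x _.
rewrite /vdot /mdot; apply: eq_bigr => i _.
rewrite /mxapp mxE mulr_suml; apply: eq_bigr => j _.
by rewrite /otimes !mxE big_ord1 !mxE; ring.
Qed.

Lemma funG_bound w phi psi : `|funG w phi psi| <= c1 * norm1 w * norm1 phi * norm1 psi.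
Proof.
rewrite funGE normrN; apply: (le_trans (ipm_cs mO (grad_L2 phi) (otL2 psi w))).
have -> : c1 * norm1 w * norm1 phi * norm1 psi = norm1 phi * (c1 * norm1 psi * norm1 w) by ring.
apply: ler_pM; [exact: nrmm_ge0|exact: nrmm_ge0| |exact: otb].
exact: semi1_le_norm1.
Qed.

Lemma funG_linpsi w phi a psi psi' : funG w phi (h1lin oO bO a psi psi') =
  a * funG w phi psi + funG w phi psi'.
Proof.
rewrite !funGE mulrN -opprD; congr (- _).
apply: etrans (ipm_linr mO a (otL2 psi w) (otL2 psi' w) (grad_L2 phi)).
by congr ipm; apply/funext => x; rewrite -otimes_linl.
Qed.

Lemma funG_linphi w a phi phi' psi : funG w (h1lin oO bO a phi phi') psi =
  a * funG w phi psi + funG w phi' psi.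
Proof.
rewrite !funGE mulrN -opprD; congr (- _).
exact: (ipm_linl mO a (grad_L2 phi) (grad_L2 phi') (otL2 psi w)).
Qed.

Lemma funG_linw a w w' phi psi : funG (h1lin oO bO a w w') phi psi =
  a * funG w phi psi + funG w' phi psi.
Proof.
rewrite !funGE mulrN -opprD; congr (- _).
apply: etrans (ipm_linr mO a (otL2 psi w) (otL2 psi w') (grad_L2 phi)).
by congr ipm; apply/funext => x; rewrite -otimes_linr.
Qed.

End Convection.

Section Conductivity.
Variables (K : tfield R n) (k0 : R).
Hypotheses (k00 : 0 < k0) (hKinf : Linft Omega K)
  (hKdiag : aeO Omega (fun x => is_diag_mx (K x)))
  (hKpos : aeO Omega (fun x => forall y : 'rV[R]_n,
             k0 * enorm y ^+ 2 <= vdot (mxapp (K x) y) y)).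

Lemma normInf_ae : {ae mu, forall x : T, Omega x -> `|K x| <= normInf Omega K}.
Proof.
have [_ [M HM]] := hKinf.
exact: (@ess_sup_restrict_ae _ T R mu Omega (fun x : T => `|K x|) M HM).
Qed.

Lemma normInf_ge0 : 0 <= normInf Omega K.
Proof. exact: (@ess_sup_restrict_ge0 _ T R mu Omega (fun x : T => `|K x|)). Qed.

(** A diagonal matrix scales the rows of [G], so its largest entry bounds the product; for a general
    matrix the maximum norm would not. *)
Lemma diag_mulmx_le (A G : 'M[R]_n) (M : R) : is_diag_mx A -> `|A| <= M ->
  mdot (A *m G) (A *m G) <= M ^+ 2 * mdot G G.
Proof.
move=> /is_diag_mxP dA AM; rewrite /mdot mulr_sumr; apply: ler_sum => i _.
rewrite mulr_sumr; apply: ler_sum => j _.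
have -> : (A *m G) i j = A i i * G i j.
  rewrite mxE (bigD1 i) //= big1 ?addr0 // => l li.
  by rewrite dA ?mul0r // eq_sym.
rewrite -!expr2 exprMn ler_wpM2r ?sqr_ge0 // -real_normK ?num_real //.
have h : `|A i i| <= M by apply: le_trans AM; exact: entry_le_norm.
by rewrite ler_pXn2r ?nnegrE // (le_trans _ h).
Qed.

Definition Kgrad chi (x : T) : 'M[R]_n := K x *m grad chi x.

Lemma Kgrad_L2 chi : @L2m _ T R mu Omega n n (Kgrad chi).
Proof.
move=> i j.
have h l : sq_integrable mu Omega (fun x : T => K x i l * grad chi x l j).
  apply: (@sq_integrable_bounded_mul _ T R mu Omega mO (fun x : T => K x i l)
    (normInf Omega K)); [by have [] := hKinf| |exact: grad_L2].
  apply: ae_on_imp normInf_ae _ => x _; apply: le_trans.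
  exact: entry_le_norm.
have := sq_integrable_sum mO (index_enum 'I_n) h.
by congr sq_integrable; apply/funext => x; rewrite /Kgrad mxE.
Qed.

Lemma Kgrad_le chi : nrt (Kgrad chi) <= normInf Omega K * semi1 chi.
Proof.
apply: (nrmm_le mO normInf_ge0 (grad_L2 chi) (Kgrad_L2 chi)).
apply: ae_on_imp2 normInf_ae hKdiag _ => x _ h1 h2.
exact: diag_mulmx_le.
Qed.

Lemma bf_Kgrad : bounded_field mu Omega Hp Kgrad (normInf Omega K).
Proof.
split=> [|xi|a xi eta x|xi]; [exact: normInf_ge0|exact: Kgrad_L2| |].
  by rewrite /Kgrad /= mulmxDr -scalemxAr.
apply: (le_trans (Kgrad_le xi)); rewrite ler_wpM2l ?normInf_ge0 //.
by rewrite -norm1E; exact: semi1_le_norm1.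
Qed.

Lemma formC_bilinear : bounded_bilinear Hp (Defs.formC K).
Proof.
have := bounded_bilinear_ipm mO bf_Kgrad (bf_grad oO bO).
by apply: eq_bounded_bilinear.
Qed.

Lemma formC_bound chi psi : `|Defs.formC K chi psi| <=
  normInf Omega K * norm1 chi * norm1 psi.
Proof.
apply: (le_trans (ipm_cs mO (Kgrad_L2 chi) (grad_L2 psi))).
apply: ler_pM; [exact: nrmm_ge0|exact: nrmm_ge0| |exact: semi1_le_norm1].
apply: (le_trans (Kgrad_le chi)); rewrite ler_wpM2l ?normInf_ge0 //.
exact: semi1_le_norm1.
Qed.

(** Ellipticity applied to each column of [G], written as a row of [G^T], and summed. *)
Lemma mulmx_coercive (A G : 'M[R]_n) :
  (forall y : 'rV[R]_n, k0 * enorm y ^+ 2 <= vdot (mxapp A y) y) ->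
  k0 * mdot G G <= mdot (A *m G) G.
Proof.
move=> hA.
have E1 : mdot G G = \sum_j enorm (row j G^T) ^+ 2.
  rewrite /mdot exchange_big; apply: eq_bigr => j _.
  rewrite /enorm vdotE sqr_sqrtr ?mdot_ge0 // /mdot big_ord1.
  by apply: eq_bigr => i _; rewrite !mxE.
have -> : mdot (A *m G) G = \sum_j vdot (mxapp A (row j G^T)) (row j G^T).
  rewrite /mdot exchange_big; apply: eq_bigr => j _; apply: eq_bigr => i _.
  rewrite /mxapp !mxE; congr (_ * _); apply: eq_bigr => l _.
  by rewrite !mxE mulrC.
by rewrite E1 mulr_sumr; apply: ler_sum => j _.
Qed.

Lemma formC_coercive psi : k0 * semi1 psi ^+ 2 <= Defs.formC K psi psi.
Proof.
rewrite sqr_nrmm -subr_ge0.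
have i1 := integrable_mdot mO (Kgrad_L2 psi) (grad_L2 psi).
have i2 := integrable_mdot mO (grad_L2 psi) (grad_L2 psi).
have i3 : mu.-integrable Omega (fun x : T => (k0 * mdot (grad psi x) (grad psi x))%:E).
  by under eq_fun do rewrite EFinM; exact: integrableZl.
rewrite /ipm -RintegralZl // -RintegralB //.
apply: Rintegral_ae_ge0 => //.
  under eq_fun do rewrite EFinB; exact: integrableB.
apply: ae_on_imp hKpos _ => x _ h; rewrite subr_ge0.
exact: mulmx_coercive.
Qed.

End Conductivity.

Section ViscDifference.
Variables (nu : R -> R -> R) (nu1 nu2 Lnu : R).
Hypotheses (hnu1 : 0 < nu1) (hnu : forall a b, nu1 <= nu a b <= nu2)
  (hLnu : forall a b a' b', `|nu a b - nu a' b'| <=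
            Lnu * Num.sqrt ((a - a') ^+ 2 + (b - b') ^+ 2)).
Variables (gamma k1 k2 k3 : R).
Local Notation fA := (@formA R n Omega nu gamma k1 k2 k3).

Definition dvisc phi phi' xi (x : T) : 'M[R]_n :=
  (visc nu phi x - visc nu phi' x) *: ht xi x.

Let vt phi xi : @L2m _ T R mu Omega n n (fun x => visc nu phi x *: ht xi x).
Proof.
exact: (L2m_bounded_mul mO (visc_measurable hLnu phi) (visc_bound hnu1 hnu phi)
  (l2_L2 (ht xi))).
Qed.

(** [phi] enters [formA] only through the viscosity. *)
Lemma formA_diff phi phi' xi eta :
  fA phi xi eta - fA phi' xi eta = 2 * ipt (dvisc phi phi' xi) (rtau k3 eta).
Proof.
have e1 := ipm_linl mO (-1) (vt phi' xi) (vt phi xi) (rtau_L2 k3 eta).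
have -> : ipt (dvisc phi phi' xi) (rtau k3 eta) =
   ipt (fun x => visc nu phi x *: ht xi x) (rtau k3 eta) -
   ipt (fun x => visc nu phi' x *: ht xi x) (rtau k3 eta).
  rewrite addrC -mulN1r; apply: etrans e1; congr ipm; apply/funext => x.
  by rewrite /dvisc scaleN1r scalerBl addrC.
rewrite /formA !viscE mulrBr.
set t1 := ipt (fun x => visc nu phi x *: _) _.
set t2 := ipt (fun x => visc nu phi' x *: _) _.
have key (x y a1 a2 a3 a4 a5 a6 a7 a8 a9 : R) :
    2 * x + a1 - a2 + a3 - a4 + a5 - a6 + a7 + a8 + a9 -
    (2 * y + a1 - a2 + a3 - a4 + a5 - a6 + a7 + a8 + a9) = 2 * x - 2 * y by ring.
exact: key.
Qed.

Variables (r s : R) (Ce Ct : R).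
Hypotheses (r0 : 0 < r) (s0 : 0 < s) (rs : (r / 2)^-1 + (s / 2)^-1 = 1).

Lemma visc_diff_le phi phi' x :
  (visc nu phi x - visc nu phi' x) ^+ 2 <=
  Lnu ^+ 2 * mdot (phi x - phi' x) (phi x - phi' x).
Proof.
have h : `|visc nu phi x - visc nu phi' x| <= Lnu * Num.sqrt (mdot (phi x - phi' x) (phi x - phi' x)).
  apply: (le_trans (hLnu _ _ _ _)); rewrite ler_wpM2l ?(Lnu_ge0 hLnu) //.
  by rewrite ler_wsqrtr // -!vcompB; exact: vcomp_sqr_le.
rewrite -real_normK ?num_real //.
rewrite -[X in _ <= _ * X]sqr_sqrtr ?mdot_ge0 // -exprMn.
by rewrite ler_pXn2r ?nnegrE ?mulr_ge0 ?sqrtr_ge0 ?(Lnu_ge0 hLnu).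
Qed.

(** The Lipschitz bound on [nu] leaves the integral of [|t|^2 |phi - phi'|^2], and Hoelder
    distributes the integrability: [t] in [L^r], the difference in [L^s]. *)
Lemma dvisc_le phi phi' xi (a b : R) : 0 <= a -> 0 <= b ->
  (normLpt Omega r (ht xi) <= a%:E)%E ->
  (normLpv Omega s (h1lin oO bO (-1) phi' phi) <= b%:E)%E ->
  @L2m _ T R mu Omega n n (dvisc phi phi' xi) /\ nrt (dvisc phi phi' xi) <= Lnu * (a * b).
Proof.
move=> a0 b0 ha hb.
have L0 := Lnu_ge0 hLnu.
have md : @measurable_mx _ T R Omega n n (dvisc phi phi' xi).
  have E : dvisc phi phi' xi = (fun x => -1 *: (visc nu phi' x *: ht xi x) + visc nu phi x *: ht xi x).
    by apply/funext => x; rewrite /dvisc scaleN1r scalerBl addrC.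
  rewrite E; apply: measurable_mx_lin; apply: L2m_measurable; exact: vt.
apply: (nrmm_le_esq mO md); first by rewrite !mulr_ge0.
have md1 := L2m_measurable (h1_L2m (h1lin oO bO (-1) phi' phi)).
have mt1 := L2m_measurable (l2_L2 (ht xi)).
rewrite normLpvE in hb.
have h := hoelder_mx mO mt1 md1 r0 s0 rs a0 b0 ha hb.
rewrite exprMn EFinM.
have mh := measurable_funM (measurable_mdot mt1 mt1) (measurable_mdot md1 md1).
pose f (x : T) : R := mdot (ht xi x) (ht xi x) *
  mdot (h1lin oO bO (-1) phi' phi x) (h1lin oO bO (-1) phi' phi x).
have f0 x : 0 <= f x by rewrite mulr_ge0 ?mdot_ge0.
have fB x : mdot (dvisc phi phi' xi x) (dvisc phi phi' xi x) <= Lnu ^+ 2 * f x.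
  rewrite /dvisc mdotZl mdotZr mulrA -expr2.
  have := ler_wpM2r (mdot_ge0 (ht xi x)) (visc_diff_le phi phi' x).
  move=> /le_trans; apply; apply: le_of_eq.
  rewrite -mulrA; congr (_ * _); rewrite mulrC; congr (_ * mdot _ _);
    by rewrite /= scaleN1r addrC.
apply: (le_trans (esq_le_integral mu mO md (mh : measurable_fun (Omega : set T) f)
  f0 fB (sqr_ge0 Lnu))).
by apply: lee_wpmul2l; [rewrite lee_fin sqr_ge0|exact: h].
Qed.

Lemma formA_diff_bound phi phi' xi eta (a b : R) : 0 <= a -> 0 <= b ->
  (normLpt Omega r (ht xi) <= a%:E)%E ->
  (normLpv Omega s (h1lin oO bO (-1) phi' phi) <= b%:E)%E ->
  `|fA phi xi eta - fA phi' xi eta| <=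
    2 * Lnu * Num.sqrt (2 + k3 ^+ 2) * (a * b) * normHH eta.
Proof.
move=> a0 b0 ha hb; have [d2 dle] := dvisc_le a0 b0 ha hb.
rewrite formA_diff normrM ger0_norm //.
have -> : 2 * Lnu * Num.sqrt (2 + k3 ^+ 2) * (a * b) * normHH eta =
  2 * ((Lnu * (a * b)) * (Num.sqrt (2 + k3 ^+ 2) * normHH eta)) by ring.
rewrite ler_wpM2l //; apply: (le_trans (ipm_cs mO d2 (rtau_L2 k3 eta))).
by apply: ler_pM; [exact: nrmm_ge0|exact: nrmm_ge0|exact: dle|exact: rtau_le].
Qed.

End ViscDifference.

End FormBounds.

(** * The linearized problems *)

(** Turns coercivity tested with the solution itself into a bound on its norm; [x = 0] is separate,
    as one divides by [x]. *)
Lemma cancel_norm (R : realType) (c M x : R) : 0 < c -> 0 <= x -> 0 <= M ->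
  c * x ^+ 2 <= M * x -> x <= c^-1 * M.
Proof.
move=> c0 x0 M0; have [->|xn] := eqVneq x 0.
  by move=> _; rewrite mulr_ge0 // invr_ge0 ltW.
have xp : 0 < x by rewrite lt_neqAle eq_sym xn.
by rewrite expr2 mulrA ler_pM2r // => h; rewrite mulrC ler_pdivlMr // mulrC.
Qed.

(** Arithmetic of [flow_lipschitz]: [F], [A], [B] are the differences of load, viscous and
    convective terms, [D] is the norm of the difference of the solutions, and [m] is the maximum in
    [LA]. *)
Lemma lipschitz_combination (R : realType)
    (F A B D dw dp n0 n0' u S2 S3 c1 L Ce Ct Ch ag CA r m : R) :
  0 <= D -> 0 <= dw -> 0 <= dp -> 0 <= n0 -> 0 <= n0' -> 0 <= u -> 0 <= S2 ->
  0 <= c1 * S3 -> 0 <= 2 * L * S3 * Ce -> 0 <= Ct -> 0 <= Ch -> 0 <= ag ->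
  c1 * S3 <= m -> 2 * L * S3 * Ce <= m -> S2 <= m ->
  n0 <= dp -> n0' <= r -> u <= CA * r * ag ->
  `|F| <= S2 * ag * n0 * D ->
  `|A| <= 2 * L * S3 * (Ce * (Ch * ag * n0') * (Ct * dp)) * D ->
  `|B| <= c1 * S3 * dw * u * D ->
  F - A - B <= m * ag * (r * CA * dw + (r * Ct * Ch + 1) * dp) * D.
Proof.
move=> D0 dw0 dp0 n00 n0'0 u0 S20 cS LS Ct0 Ch0 ag0 m1 m2 m3 n0d n0r ur hF hA hB.
have t1 : F <= m * ag * dp * D.
  apply: (le_trans (ler_norm _)); apply: (le_trans hF); rewrite ler_wpM2r //.
  by apply: ler_pM => //; [exact: mulr_ge0|rewrite ler_wpM2r].
have t2 : - A <= m * ag * (r * Ct * Ch) * dp * D.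
  apply: (le_trans (ler_norm _)); rewrite normrN; apply: (le_trans hA).
  rewrite ler_wpM2r //.
  have -> : 2 * L * S3 * (Ce * (Ch * ag * n0') * (Ct * dp)) =
    2 * L * S3 * Ce * (n0' * (Ct * Ch * ag * dp)) by ring.
  have -> : m * ag * (r * Ct * Ch) * dp = m * (r * (Ct * Ch * ag * dp)) by ring.
  have h0 : 0 <= Ct * Ch * ag * dp by rewrite !mulr_ge0.
  by apply: ler_pM => //; [exact: mulr_ge0|rewrite ler_wpM2r].
have t3 : - B <= m * ag * (r * CA) * dw * D.
  apply: (le_trans (ler_norm _)); rewrite normrN; apply: (le_trans hB).
  rewrite ler_wpM2r //.
  have -> : m * ag * (r * CA) * dw = m * dw * (CA * r * ag) by ring.
  by apply: ler_pM => //; [exact: mulr_ge0|rewrite ler_wpM2r].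
have -> : m * ag * (r * CA * dw + (r * Ct * Ch + 1) * dp) * D =
  m * ag * dp * D + m * ag * (r * Ct * Ch) * dp * D + m * ag * (r * CA) * dw * D by ring.
by rewrite lerD // lerD.
Qed.

Section Solvers.
Context (R : realType) (n : nat) (Omega GammaD : set 'rV[R]_n).
Hypotheses (oO : open Omega) (bO : bounded_set Omega)
  (mG : measurable (GammaD : set (caratheodory_type (haus_om R n n.-1)))).
Local Notation T := (caratheodory_type (leb_om R n)).
Local Notation mu := (lebR R n).
Local Notation Hp := (h1preip oO bO).
Local Notation HHp := (hhpreip oO bO).
Local Notation hlin := (h1lin oO bO).
Variables (gamma : R) (alpha g : 'rV[R]_n).
Variables (nu : R -> R -> R) (nu1 nu2 Lnu : R).
Hypotheses (hnu1 : 0 < nu1) (hnu : forall a b, nu1 <= nu a b <= nu2)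
  (hLnu : forall a b a' b', `|nu a b - nu a' b'| <=
            Lnu * Num.sqrt ((a - a') ^+ 2 + (b - b') ^+ 2)).
Variables (k1 k2 k3 : R) (i4 : R).
Hypotheses (i40 : 0 <= i4)
  (hi4 : forall v : H1 Omega, (normLpv Omega 4 v <= i4%:E * (norm1 v)%:E)%E).
Variable (alphaO : R).
Hypotheses (alphaO0 : 0 < alphaO)
  (hellip : forall (phi : H1 Omega) (xi : HH Omega),
     alphaO * normHH xi ^+ 2 <= formA nu gamma k1 k2 k3 phi xi xi).
Variable (r : R).
Let c1 := i4 ^+ 2.
Let S2 := Num.sqrt (2 + k2 ^+ 2).
Let S3 := Num.sqrt (2 + k3 ^+ 2).
Let ag := enorm alpha * enorm g.
Hypothesis hr : c1 * S3 * r <= alphaO / 2.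
Implicit Types (xi eta : HH Omega) (w phi psi chi : H1 Omega).
Local Notation flow := (flow_sol nu gamma k1 k2 k3 alpha g).
Local Notation fA := (@formA R n Omega nu gamma k1 k2 k3).
Local Notation fB := (@Defs.formB R n Omega k3).
Local Notation fF := (@funF R n Omega alpha g k2).

Definition flow_form w phi xi eta := fA phi xi eta + fB w xi eta.

Lemma flow_form_bilinear w phi : bounded_bilinear HHp (flow_form w phi).
Proof.
exact: (bounded_bilinearD (formA_bilinear oO bO hnu1 hnu hLnu gamma k1 k2 k3 phi)
  (formB_bilinear oO bO i40 hi4 k3 w)).
Qed.

Lemma ag_ge0 : 0 <= ag. Proof. by rewrite mulr_ge0 ?sqrtr_ge0. Qed.

Lemma flow_coercive w phi xi : norm1 w <= r ->
  alphaO / 2 * normHH xi ^+ 2 <= flow_form w phi xi xi.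
Proof.
move=> wr.
have hB := formB_bound oO bO i40 hi4 k3 w xi xi.
have hA := hellip phi xi.
have hB2 : `|fB w xi xi| <= alphaO / 2 * normHH xi ^+ 2.
  apply: (le_trans hB).
  apply: (@le_trans _ _ (c1 * S3 * r * normHH xi * normHH xi)).
    rewrite ler_wpM2r ?normHH_ge0 //; apply: ler_pM.
    - by rewrite !mulr_ge0 ?sqr_ge0 ?sqrtr_ge0.
    - exact: norm1_ge0.
    - by rewrite ler_wpM2l // mulr_ge0 ?sqr_ge0 ?sqrtr_ge0.
    - exact: norm1_hu_le.
  by rewrite -mulrA -expr2 ler_wpM2r ?sqr_ge0.
move: hB2; rewrite ler_norml /flow_form => /andP[h1 h2].
by lra.
Qed.

Lemma flow_exists w phi : norm1 w <= r -> exists xi, flow w phi xi.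
Proof.
move=> wr; have [al ar [M M0 aM]] := flow_form_bilinear w phi.
pose N := S2 * ag * norm0v Omega phi.
have N0 : 0 <= N by rewrite !mulr_ge0 ?sqrtr_ge0.
have c0 : 0 < alphaO / 2 by rewrite divr_gt0.
have hc x : True -> alphaO / 2 * nrm HHp x ^+ 2 <= flow_form w phi x x.
  by move=> _; rewrite -normHHE; exact: flow_coercive.
have hF x : True -> `|fF phi x| <= N * nrm HHp x.
  by move=> _; rewrite -normHHE; exact: funF_bound.
have [xi _ Hxi] := @lax_milgram R (HH Omega) HHp (fun=> True) (hhzero oO)
  I (fun _ _ _ _ _ => I) (@hh_complete R n Omega oO bO) (flow_form w phi) M (alphaO / 2) M0 c0
  (fun t x y z _ _ _ => al t x y z) (fun t x y z _ _ _ => ar t x y z)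
  (fun x y _ _ => aM x y) hc (fF phi) N N0
  (fun t x y _ _ => funF_linr oO bO alpha g k2 phi t x y) hF.
by exists xi => eta; exact: Hxi.
Qed.

Lemma flow_norm w phi xi : norm1 w <= r -> flow w phi xi ->
  normHH xi <= (alphaO / 2)^-1 * (S2 * ag * norm0v Omega phi).
Proof.
move=> wr fl; apply: cancel_norm.
- by rewrite divr_gt0.
- exact: normHH_ge0.
- by rewrite !mulr_ge0 ?sqrtr_ge0.
- apply: (le_trans (flow_coercive phi xi wr)); rewrite /flow_form fl.
  exact: (le_trans (ler_norm _) (funF_bound oO bO alpha g k2 phi xi)).
Qed.

(** Being a solution depends only on the class modulo distance zero. *)
Lemma flow_congr w phi xi xi' : flow w phi xi -> dist HHp xi xi' = 0 -> flow w phi xi'.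
Proof.
move=> fl d0 eta; rewrite -fl.
exact: esym (bounded_bilinear_dist0 eta (flow_form_bilinear w phi) d0).
Qed.

Variables (p q Ce Ct Ch : R).
Hypotheses (p0 : 0 < p) (q0 : 0 < q) (pq : (p / 2)^-1 + (q / 2)^-1 = 1)
  (Ce0 : 0 <= Ce) (Ct0 : 0 <= Ct) (Ch0 : 0 <= Ch)
  (hCt : forall v : H1 Omega, (normLpv Omega q v <= Ct%:E * (norm1 v)%:E)%E)
  (hreg : forall w phi xi, inH10 w -> norm1 w + norm1 phi <= r -> flow w phi xi ->
     (normLpt Omega p (ht xi) <= (Ce * (Ch * ag * norm0v Omega phi))%:E)%E).

Let CA := 2 * Num.sqrt 2 * S2 / alphaO.
Let LA := 2 / alphaO *
    Num.max (Num.max (c1 * S3) (2 * Lnu * S3 * Ce)) (Num.sqrt 2 * S2).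

Lemma flow_norm_CA w phi xi : inH10 w -> norm1 w + norm1 phi <= r -> flow w phi xi ->
  normHH xi <= CA * r * ag.
Proof.
move=> w0 wr fl.
have n1 := norm1_ge0 w; have n2 := norm1_ge0 phi.
have wr1 : norm1 w <= r := le_trans (ler_wpDr n2 (lexx _)) wr.
apply: (le_trans (flow_norm wr1 fl)).
have pr : norm0v Omega phi <= r by apply: (le_trans (norm0v_le_norm1 phi)); lra.
have r0 : 0 <= r by apply: le_trans wr1.
have s2 : 1 <= Num.sqrt 2 :> R by rewrite -[leLHS]sqrtr1 ler_wsqrtr // ler1n.
apply: (@le_trans _ _ ((alphaO / 2)^-1 * (S2 * ag * r))).
  rewrite ler_wpM2l ?invr_ge0 ?divr_ge0 ?(ltW alphaO0) // ler_wpM2l //.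
  by rewrite mulr_ge0 ?sqrtr_ge0 ?ag_ge0.
(* [CA] exceeds the constant of [flow_norm] by the factor [sqrt 2 >= 1]. *)
have -> : CA * r * ag = Num.sqrt 2 * ((alphaO / 2)^-1 * (S2 * ag * r)).
  by rewrite /CA; field; rewrite gt_eqF.
rewrite ler_peMl // !mulr_ge0 ?invr_ge0 ?divr_ge0 ?(ltW alphaO0) ?sqrtr_ge0 //.
Qed.

(** Coercivity of the first problem is tested with the difference of the solutions. The remaining
    terms contain [xi'] only, so regularity and the a priori bound are invoked for [xi'] alone. *)
Lemma flow_lipschitz w phi xi w' phi' xi' :
  inH10 w -> norm1 w + norm1 phi <= r -> flow w phi xi ->
  inH10 w' -> norm1 w' + norm1 phi' <= r -> flow w' phi' xi' ->
  dist HHp xi xi' <= LA * ag * (r * CA * dist Hp w w' +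
    (r * Ct * Ch + 1) * dist Hp phi phi').
Proof.
move=> w0 wr fl w0' wr' fl'.
have n1 := norm1_ge0 w; have n2 := norm1_ge0 phi.
have n1' := norm1_ge0 w'; have n2' := norm1_ge0 phi'.
have wr1 : norm1 w <= r := le_trans (ler_wpDr n2 (lexx _)) wr.
have r0 : 0 <= r by apply: le_trans wr1.
pose D := hhlin oO bO (-1) xi' xi.
pose dw := hlin (-1) w' w; pose dp := hlin (-1) phi' phi.
have Edw : dist Hp w w' = norm1 dw by rewrite (norm1E oO bO).
have Edp : dist Hp phi phi' = norm1 dp by rewrite (norm1E oO bO).
have ED : dist HHp xi xi' = normHH D by rewrite (normHHE oO bO).
rewrite Edw Edp ED.
have [al _ _] := flow_form_bilinear w phi.
(* Subtract the two problems after adding and removing the first form at [xi']; what remains is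
   linear in [phi - phi'], in [w - w'], or a viscosity difference. *)
have E1 : flow_form w phi D D = fF dp D - (fA phi xi' D - fA phi' xi' D) - fB dw xi' D.
  have e1 : flow_form w phi D D = - flow_form w phi xi' D + flow_form w phi xi D.
    by rewrite -mulN1r -al.
  have e2 : flow_form w phi xi D = fF phi D := fl D.
  have e3 : fA phi' xi' D + fB w' xi' D = fF phi' D := fl' D.
  have e4 := funF_linl oO bO alpha g k2 (-1) phi' phi D.
  have e5 := formB_linw oO bO i40 hi4 k3 (-1) w' w xi' D.
  rewrite /dp /dw e1 e2 e4 e5 -e3 /flow_form.
  move: (fA phi xi' D) (fB w xi' D) (fF phi D) (fA phi' xi' D) (fB w' xi' D) => x1 x2 x3 x4 x5.
  ring.
pose a := Ce * (Ch * ag * norm0v Omega phi').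
have a0 : 0 <= a by rewrite /a !mulr_ge0 ?sqrtr_ge0.
have b0 : 0 <= Ct * norm1 dp by rewrite mulr_ge0 ?norm1_ge0.
have hF := funF_bound oO bO alpha g k2 dp D.
have hA : `|fA phi xi' D - fA phi' xi' D| <= 2 * Lnu * S3 * (a * (Ct * norm1 dp)) * normHH D.
  apply: (formA_diff_bound hnu1 hnu hLnu gamma k1 k2 k3 p0 q0 pq D a0 b0).
    exact: (hreg w0' wr' fl').
  by rewrite EFinM; exact: hCt.
have hB := formB_bound oO bO i40 hi4 k3 dw xi' D.
have L0 := Lnu_ge0 hLnu.
have S20 : 0 <= S2 by exact: sqrtr_ge0.
have S30 : 0 <= S3 by exact: sqrtr_ge0.
have c10 : 0 <= c1 by exact: sqr_ge0.
have D0 := normHH_ge0 D; have dw0 := norm1_ge0 dw; have dp0 := norm1_ge0 dp.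
have ag0 := ag_ge0.
pose m := Num.max (Num.max (c1 * S3) (2 * Lnu * S3 * Ce)) (Num.sqrt 2 * S2).
have m1 : c1 * S3 <= m by rewrite /m !le_max lexx.
have m2 : 2 * Lnu * S3 * Ce <= m by rewrite /m !le_max lexx !orbT.
have m3 : S2 <= m.
  rewrite /m !le_max; apply/orP; right; rewrite ler_peMl //.
  by rewrite -[leLHS]sqrtr1 ler_wsqrtr // ler1n.
have m0 : 0 <= m by exact: le_trans m3.
pose Q := r * CA * norm1 dw + (r * Ct * Ch + 1) * norm1 dp.
have CA0 : 0 <= CA by rewrite /CA !mulr_ge0 ?sqrtr_ge0 ?invr_ge0 ?(ltW alphaO0).
have Q0 : 0 <= Q.
  apply: addr_ge0; first exact: mulr_ge0 (mulr_ge0 r0 CA0) dw0.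
  by rewrite mulr_ge0 // addr_ge0 // !mulr_ge0.
have -> : LA * ag * Q = (alphaO / 2)^-1 * (m * ag * Q).
  by rewrite /LA -/m; field; rewrite gt_eqF.
apply: cancel_norm; [exact: divr_gt0|exact: D0|exact: mulr_ge0 (mulr_ge0 m0 ag0) Q0|].
apply: (le_trans (flow_coercive phi D wr1)); rewrite E1.
have u'b : norm1 (hu xi') <= CA * r * ag.
  exact: le_trans (norm1_hu_le xi') (flow_norm_CA w0' wr' fl').
have pr : norm1 phi' <= r := le_trans (ler_wpDl n1' (lexx _)) wr'.
have LS : 0 <= 2 * Lnu * S3 * Ce by rewrite !mulr_ge0.
exact: (lipschitz_combination D0 dw0 dp0 (sqrtr_ge0 _) (sqrtr_ge0 _) (norm1_ge0 _)
  S20 (mulr_ge0 c10 S30) LS Ct0 Ch0 ag0 m1 m2 m3 (norm0v_le_norm1 _)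
  (le_trans (norm0v_le_norm1 _) pr) u'b hF hA hB).
Qed.

Section Heat.
Variables (K : tfield R n) (k0 cgp : R) (phiD : vfield R n).
Hypotheses (k00 : 0 < k0) (hKinf : Linft Omega K)
  (hKdiag : aeO Omega (fun x => is_diag_mx (K x)))
  (hKpos : aeO Omega (fun x => forall y : 'rV[R]_n,
             k0 * enorm y ^+ 2 <= vdot (mxapp (K x) y) y))
  (cgp0 : 0 < cgp)
  (hpoincare : forall psi, inH1D GammaD psi -> norm1 psi <= cgp * semi1 psi)
  (hphiD : inHhalf Omega GammaD phiD).
Let alphat := k0 * cgp ^- 2.
Let CB := Num.max (alphat^-1 * c1) (alphat^-1 * normInf Omega K + 1).
Let LB := r * c1 / alphat.
Let normD := normHhalf Omega GammaD phiD.

(** [phi1] is the new temperature and [phi] the old one: convection is a load, so existence does not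
    depend on the size of [w]. *)
Definition heat w phi phi1 := has_trace GammaD phi1 phiD /\
  forall psi, inH1D GammaD psi -> Defs.formC K phi1 psi = funG w phi psi.

Lemma alphat_gt0 : 0 < alphat.
Proof. by rewrite mulr_gt0 // invr_gt0 exprn_gt0. Qed.

Lemma heat_coercive psi : inH1D GammaD psi ->
  alphat * norm1 psi ^+ 2 <= Defs.formC K psi psi.
Proof.
move=> hpsi; apply: le_trans (formC_coercive oO hKinf hKpos psi).
rewrite /alphat -mulrA ler_pM2l // mulrC ler_pdivrMr ?exprn_gt0 // mulrC -exprMn.
by rewrite ler_pXn2r ?nnegrE ?sqrtr_ge0 ?mulr_ge0 ?(ltW cgp0) ?sqrtr_ge0 ?hpoincare.
Qed.

(** Lift the boundary datum by some [chi] and solve for the correction, which has zero trace on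
    [GammaD]. *)
Lemma heat_exists w phi : exists phi1, heat w phi phi1.
Proof.
have [chi hchi] := hphiD.
have [al ar [M M0 aM]] := formC_bilinear oO bO hKinf hKdiag.
pose F psi := funG w phi psi - Defs.formC K chi psi.
pose N := c1 * norm1 w * norm1 phi + normInf Omega K * norm1 chi.
have N0 : 0 <= N.
  by rewrite addr_ge0 ?mulr_ge0 ?sqr_ge0 ?sqrtr_ge0 // normInf_ge0.
(* Lax-Milgram needs one element of the subspace; [chi - chi] has zero trace. *)
have z0 : inH1D GammaD (hlin (-1) chi chi) := has_trace_sub oO bO mG hchi hchi.
have hc x : inH1D GammaD x -> alphat * nrm Hp x ^+ 2 <= Defs.formC K x x.
  by move=> hx; rewrite -norm1E; exact: heat_coercive.
have hFl t x y : inH1D GammaD x -> inH1D GammaD y -> F (hlin t x y) = t * F x + F y.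
  by move=> _ _; rewrite /F ar (funG_linpsi oO bO i40 hi4); ring.
have hF x : inH1D GammaD x -> `|F x| <= N * nrm Hp x.
  move=> _; rewrite -norm1E /F mulrDl; apply: (le_trans (ler_normB _ _)).
  apply: lerD; first exact: (funG_bound oO i40 hi4).
  exact: (formC_bound oO hKinf hKdiag).
have [psi hpsi Hpsi] := @lax_milgram R (H1 Omega) Hp (inH1D GammaD) _
  z0 (fun a u v hu hv => inH1D_lin oO bO mG a hu hv) (@inH1D_complete R n Omega oO bO GammaD)
  (Defs.formC K) M alphat M0 alphat_gt0
  (fun t x y z _ _ _ => al t x y z) (fun t x y z _ _ _ => ar t x y z)
  (fun x y _ _ => aM x y) hc F N N0 hFl hF.
exists (hlin 1 psi chi); split; first exact: (has_trace_addD oO bO mG 1 hpsi hchi).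
by move=> eta he; rewrite al mul1r (Hpsi _ he) /F; ring.
Qed.

(** The estimate is proved for every lift [chi] and then the infimum is taken. In [CB] the first
    entry comes from convection; in the second, the [+ 1] comes from adding [chi] back. *)
Lemma heat_norm w phi phi1 : heat w phi phi1 ->
  norm1 phi1 <= CB * (norm1 w * norm1 phi + normD).
Proof.
move=> [tr1 h1].
have at0 := alphat_gt0.
have ai0 : 0 <= alphat^-1 by rewrite invr_ge0 ltW.
have nK0 := normInf_ge0 Omega K.
have w0 := norm1_ge0 w; have p0' := norm1_ge0 phi.
have key chi : has_trace GammaD chi phiD ->
    norm1 phi1 <= CB * (norm1 w * norm1 phi + norm1 chi).
  move=> hchi; pose psi := hlin (-1) chi phi1.
  have hpsi : inH1D GammaD psi := has_trace_sub oO bO mG hchi tr1.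
  have c0 := norm1_ge0 chi.
  have [al ar _] := formC_bilinear oO bO hKinf hKdiag.
  have b1 : norm1 psi <= alphat^-1 * (c1 * norm1 w * norm1 phi + normInf Omega K * norm1 chi).
    apply: cancel_norm => //; first exact: norm1_ge0.
      by rewrite addr_ge0 ?mulr_ge0 ?sqr_ge0.
    apply: (le_trans (heat_coercive hpsi)).
    rewrite {1}/psi al h1 //.
    have g1 := funG_bound oO i40 hi4 w phi psi.
    have g2 := formC_bound oO hKinf hKdiag chi psi.
    rewrite mulN1r mulrDl addrC; apply: lerD.
      exact: le_trans (ler_norm _) g1.
    by apply: le_trans g2; rewrite -normrN; exact: ler_norm.
  have b2 : norm1 phi1 <= norm1 psi + norm1 chi.
    have := nrm_dist Hp phi1 chi; rewrite -!norm1E /dist -norm1E -/psi; lra.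
  have B1 : alphat^-1 * c1 <= CB by rewrite /CB le_max lexx.
  have B2 : alphat^-1 * normInf Omega K + 1 <= CB by rewrite /CB le_max lexx orbT.
  move: b1 b2 (ler_wpM2r (mulr_ge0 w0 p0') B1) (ler_wpM2r c0 B2).
  move: (norm1 psi) (norm1 phi1) (norm1 chi) (norm1 w) (norm1 phi) => x1 x2 x3 x4 x5.
  move: (alphat^-1) (normInf Omega K) CB c1 => x6 x7 x8 x9.
  by lra.
have CB0 : 0 < CB.
  apply: (@lt_le_trans _ _ (alphat^-1 * normInf Omega K + 1)); last by rewrite /CB le_max lexx orbT.
  by rewrite ltr_wpDl // mulr_ge0.
(* Solved for the norm of the lift, the estimate is a lower bound for all lifts, hence for their
   infimum. *)
suff : norm1 phi1 / CB - norm1 w * norm1 phi <= normD.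
  by rewrite lerBlDl ler_pdivrMr // mulrC.
apply: lb_le_inf; first by have [chi hchi] := hphiD; exists (norm1 chi), chi.
by move=> _ [chi hchi <-]; rewrite lerBlDl ler_pdivrMr // mulrC; exact: key.
Qed.

Lemma heat_lipschitz w1 phi1 f1 w2 phi2 f2 : heat w1 phi1 f1 -> heat w2 phi2 f2 ->
  dist Hp f1 f2 <= alphat^-1 * (c1 * (norm1 phi1 * dist Hp w1 w2 + norm1 w2 * dist Hp phi1 phi2)).
Proof.
move=> [tr1 h1] [tr2 h2]; rewrite {1}/dist /=.
have hpsi : inH1D GammaD (hlin (-1) f2 f1) := has_trace_sub oO bO mG tr2 tr1.
rewrite -(norm1E oO bO); set psi := hlin _ f2 f1 in hpsi *.
have [al _ _] := formC_bilinear oO bO hKinf hKdiag.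
have dw0 := dist_ge0 Hp w1 w2; have dp0 := dist_ge0 Hp phi1 phi2.
have n1 := norm1_ge0 phi1; have n2 := norm1_ge0 w2.
apply: cancel_norm; [exact: alphat_gt0|exact: norm1_ge0| |].
  by rewrite mulr_ge0 ?sqr_ge0 // addr_ge0 ?mulr_ge0.
apply: (le_trans (heat_coercive hpsi)).
rewrite {1}/psi al h1 // h2 //.
(* Change one argument at a time: first the velocity with [phi1] kept, then the temperature with
   [w2] kept. *)
have -> : -1 * funG w2 phi2 psi + funG w1 phi1 psi =
  funG (hlin (-1) w2 w1) phi1 psi + funG w2 (hlin (-1) phi2 phi1) psi.
  by rewrite (funG_linw oO bO i40 hi4) (funG_linphi oO bO i40 hi4); ring.
have g1 := le_trans (ler_norm _) (funG_bound oO i40 hi4 (hlin (-1) w2 w1) phi1 psi).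
have g2 := le_trans (ler_norm _) (funG_bound oO i40 hi4 w2 (hlin (-1) phi2 phi1) psi).
apply: (le_trans (lerD g1 g2)).
rewrite /dist /= -!(norm1E oO bO) -/c1; move: (norm1 _) (norm1 _) => x y.
by apply: le_of_eq; ring.
Qed.

Lemma funG_dist0 w phi phi' psi : dist Hp phi phi' = 0 -> funG w phi psi = funG w phi' psi.
Proof.
rewrite /dist /= -(norm1E oO bO) => d0.
have := funG_bound oO i40 hi4 w (hlin (-1) phi' phi) psi.
rewrite d0 mulr0 mul0r normr_le0 (funG_linphi oO bO i40 hi4) mulN1r addrC subr_eq0.
by move/eqP.
Qed.

End Heat.
End Solvers.

(** * The coupled problem *)

Section CoupledFixedPoint.
Context (R : realType) (X Y : Type) (HX : preip R X) (HY : preip R Y).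
Local Notation dX := (dist HX).
Local Notation dY := (dist HY).
Variables (D : X -> Prop) (x0 : X) (tr : Y -> X).
Variables (flow : X -> X -> Y -> Prop) (heat : X -> X -> X -> Prop).
Variables (r U CB N A1 A2 LB q : R).
Let W w phi := D w /\ nrm HX w + nrm HX phi <= r.
Hypotheses (Xcomplete : ip_complete HX (fun=> True))
  (Dx0 : D x0) (x00 : nrm HX x0 = 0)
  (Dclosed : forall (u : nat -> X) (v : X), (forall k, D (u k)) ->
     dX (u k) v @[k --> \oo] --> 0 -> D v)
  (Dtr : forall y, D (tr y)) (tr_le : forall y y', dX (tr y) (tr y') <= dY y y').
Hypotheses
  (flow_ex : forall w phi, W w phi -> exists y, flow w phi y)
  (flow_bd : forall w phi y, W w phi -> flow w phi y -> nrm HX (tr y) <= U)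
  (flow_lip : forall w phi y w' phi' y', W w phi -> flow w phi y ->
     W w' phi' -> flow w' phi' y' -> dY y y' <= A1 * dX w w' + A2 * dX phi phi')
  (flow_eq : forall w phi y y', flow w phi y -> dY y y' = 0 -> flow w phi y').
Hypotheses
  (heat_ex : forall w phi, exists f, heat w phi f)
  (heat_bd : forall w phi f, heat w phi f ->
     nrm HX f <= CB * (nrm HX w * nrm HX phi + N))
  (heat_lip : forall w phi f w' phi' f', heat w phi f -> heat w' phi' f' ->
     nrm HX phi <= r -> nrm HX w' <= r -> dX f f' <= LB * (dX w w' + dX phi phi'))
  (heat_eq : forall w phi phi' f, heat w phi f -> dX phi phi' = 0 -> heat w phi' f).
Hypotheses (r0 : 0 <= r) (CB0 : 0 <= CB)
  (A20 : 0 <= A2) (LB0 : 0 <= LB)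
  (small : U + CB * (U * r + N) <= r)
  (q1 : (1 + LB) * A1 <= q) (q2 : (1 + LB) * A2 + LB <= q) (q_lt1 : q < 1).

(** [U] bounds the new velocity and [CB * (U * r + N)] the new temperature; [small] says that
    together they stay within [r]. *)
Lemma coupled_step w phi y f : W w phi -> flow w phi y -> heat (tr y) phi f ->
  W (tr y) f.
Proof.
move=> Ww fl he; split; first exact: Dtr.
have n1 := nrm_ge0 HX w; have n2 := nrm_ge0 HX phi.
have h1 := flow_bd Ww fl; have h2 := heat_bd he.
have nr : nrm HX phi <= r by case: Ww => _; lra.
apply: le_trans small; apply: lerD => //; apply: (le_trans h2).
by rewrite ler_wpM2l // lerD2r; apply: ler_pM => //; exact: nrm_ge0.
Qed.

(** The heat problem receives the new velocity, so the flow difference counts [1 + LB] times, and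
    the old temperature, which adds another [LB]. This is the origin of [q1] and [q2]. *)
Lemma coupled_step_lip w phi y f w' phi' y' f' :
  W w phi -> flow w phi y -> heat (tr y) phi f ->
  W w' phi' -> flow w' phi' y' -> heat (tr y') phi' f' ->
  dX (tr y) (tr y') + dX f f' <= q * (dX w w' + dX phi phi').
Proof.
move=> Ww fl he Ww' fl' he'.
have [_ h1] := coupled_step Ww' fl' he'.
have n1 := nrm_ge0 HX f'; have n2 := nrm_ge0 HX w.
have [_ h2] := Ww.
have pr : nrm HX phi <= r by lra.
have yr : nrm HX (tr y') <= r by lra.
have hl := heat_lip he he' pr yr.
have fl1 := le_trans (tr_le y y') (flow_lip Ww fl Ww' fl').
have dw0 := dist_ge0 HX w w'; have dp0 := dist_ge0 HX phi phi'.
have LB1 : 0 <= 1 + LB by rewrite addr_ge0.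
have := ler_wpM2l LB1 fl1.
have := ler_wpM2r dw0 q1; have := ler_wpM2r dp0 q2.
by lra.
Qed.

Let d (a b : X * X) := dX a.1 b.1 + dX a.2 b.2.

Let d_ge0 a b : 0 <= d a b. Proof. by rewrite addr_ge0 ?dist_ge0. Qed.

Let dC a b : d a b = d b a. Proof. by rewrite /d distC [dX a.2 _]distC. Qed.

Let d_tri a b c : d a c <= d a b + d b c.
Proof. by have := dist_tri HX a.1 b.1 c.1; have := dist_tri HX a.2 b.2 c.2; rewrite /d; lra. Qed.

Lemma coupled_complete : complete_for d (fun a => W a.1 a.2).
Proof.
move=> u Wu cu.
have c1 : cauchy_for dX (fun k => (u k).1).
  move=> e e0; have [K HK] := cu e e0; exists K => a b Ka Kb.
  by apply: le_trans (HK a b Ka Kb); rewrite lerDl dist_ge0.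
have c2 : cauchy_for dX (fun k => (u k).2).
  move=> e e0; have [K HK] := cu e e0; exists K => a b Ka Kb.
  by apply: le_trans (HK a b Ka Kb); rewrite lerDr dist_ge0.
have [w _ hw] := Xcomplete (fun=> I) c1; have [phi _ hphi] := Xcomplete (fun=> I) c2.
have hs : d (u k) (w, phi) @[k --> \oo] --> 0.
  by have := cvgD hw hphi; rewrite addr0; exact.
exists (w, phi) => //; split => /=.
  by apply: Dclosed hw => k; case: (Wu k).
(* The excess of the limit over the radius is at most the distance to [u k], which tends to 0. *)
have hc k : nrm HX w + nrm HX phi - r <= d (u k) (w, phi).
  have [_ h] := Wu k.
  have := nrm_dist HX w (u k).1; have := nrm_dist HX phi (u k).2.
  by rewrite /d [dX (u k).1 _]distC [dX (u k).2 _]distC /=; lra.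
rewrite -subr_le0; apply: (ler_cvg_to (cvg_cst (nrm HX w + nrm HX phi - r)) hs).
by apply: nearW => k; exact: hc.
Qed.

Theorem coupled_fixpoint : exists y phi,
  [/\ W (tr y) phi, flow (tr y) phi y, heat (tr y) phi phi &
    forall y' phi', W (tr y') phi' -> flow (tr y') phi' y' ->
      heat (tr y') phi' phi' -> dY y' y = 0 /\ dX phi' phi = 0].
Proof.
have Wx0 : W x0 x0 by split; rewrite // x00 addr0.
have [y00 _] := flow_ex Wx0.
have /choice[Fy HFy] (a : X * X) : exists y, W a.1 a.2 -> flow a.1 a.2 y.
  have [Wa|nWa] := pselect (W a.1 a.2); first by have [y fy] := flow_ex Wa; exists y.
  by exists y00.
have /choice[Fh HFh] (a : X * X) := heat_ex (tr (Fy a)) a.2.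
pose S a := (tr (Fy a), Fh a).
have q0 : 0 <= q by apply: le_trans q2; rewrite addr_ge0 // mulr_ge0 // addr_ge0.
have hq : 0 <= q < 1 by rewrite q0.
have WS a : W a.1 a.2 -> W (S a).1 (S a).2.
  by move=> Wa; exact: coupled_step Wa (HFy _ Wa) (HFh a).
have hS a b : W a.1 a.2 -> W b.1 b.2 -> d (S a) (S b) <= q * d a b.
  by move=> Wa Wb; exact: coupled_step_lip Wa (HFy _ Wa) (HFh a) Wb (HFy _ Wb) (HFh b).
(* The fixed point is only at distance zero from its image: [y] solves the flow for [(w, phi)], not
   yet for [(tr y, f)]. *)
have [[w phi] /= Wa] := @contraction_fixpoint _ _ d d_ge0 dC d_tri
  (fun a => W a.1 a.2) S q (x0, x0) (@coupled_complete) Wx0 WS hq hS.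
rewrite /d /=; set y := Fy _; set f := Fh _ => d0.
have fl : flow w phi y := HFy (w, phi) Wa.
have he : heat (tr y) phi f := HFh (w, phi).
have Wf : W (tr y) f := coupled_step Wa fl he.
have dw := dist_ge0 HX w (tr y); have dp := dist_ge0 HX phi f.
have dw0 : dX w (tr y) = 0 by lra.
have dp0 : dX phi f = 0 by lra.
have [y2 fl2] := flow_ex Wf.
(* Data at distance zero have solutions at distance zero, and [flow_eq] carries the equation over to
   [y]. *)
have fly : flow (tr y) f y.
  apply: (flow_eq fl2); apply/eqP; rewrite eq_le dist_ge0 andbT distC.
  by have := flow_lip Wa fl Wf fl2; rewrite dw0 dp0 !mulr0 addr0.
have hef : heat (tr y) f f := heat_eq he dp0.
exists y, f; split=> // y' f' Wf' fly' hef'.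
have h1 := coupled_step_lip Wf' fly' hef' Wf fly hef.
have h2 := flow_lip Wf' fly' Wf fly.
have e1 := dist_ge0 HX (tr y') (tr y); have e2 := dist_ge0 HX f' f.
(* Every solution in the ball is a fixed point, so the contraction estimate with [q < 1] applies to
   the pair itself. *)
have s0 : dX (tr y') (tr y) + dX f' f = 0.
  apply/eqP; rewrite eq_le addr_ge0 // andbT leNgt; apply/negP => sp.
  have sq : q * (dX (tr y') (tr y) + dX f' f) < dX (tr y') (tr y) + dX f' f.
    by rewrite gtr_pMl.
  by have := lt_le_trans sq h1; rewrite ltxx.
have z1 : dX (tr y') (tr y) = 0 by lra.
have z2 : dX f' f = 0 by lra.
split=> //; apply/eqP; rewrite eq_le dist_ge0 andbT.
by move: h2; rewrite z1 z2 !mulr0 addr0.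
Qed.
End CoupledFixedPoint.

(** * From distance zero to equality almost everywhere *)

Section AlmostEverywhere.
Context (R : realType) (n : nat) (Omega : set 'rV[R]_n).
Hypotheses (oO : open Omega) (bO : bounded_set Omega).
Local Notation T := (caratheodory_type (leb_om R n)).
Local Notation mu := (lebR R n).
Let mO : measurable (Omega : set T) := measurable_domain oO.

Lemma dist_L2M_ae m p (A B : @L2M _ T R mu Omega m p) :
  dist (L2Mpreip mu mO m p) A B = 0 -> aeO Omega (fun x => sval A x = sval B x).
Proof.
move=> d0; have /= h : L2m mu Omega (sval (lin (L2Mpreip mu mO m p) (-1) B A)) := svalP _.
have a0 := proj1 (nrmm_eq0P mO h) d0; apply: ae_on_imp a0 _ => x _ /=.
by rewrite scaleN1r addrC => /eqP; rewrite subr_eq0 => /eqP.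
Qed.

Lemma dist1_ae (u v : H1 Omega) : dist (h1preip oO bO) u v = 0 ->
  aeO Omega (fun x => u x = v x).
Proof.
move=> d0; apply: (@dist_L2M_ae 1 n (h1v u) (h1v v)).
by apply/eqP; rewrite eq_le dist_ge0 andbT -d0; exact: dist1_h1v.
Qed.

Lemma distHH_ae (xi eta : HH Omega) : dist (hhpreip oO bO) xi eta = 0 ->
  [/\ aeO Omega (fun x => ht xi x = ht eta x),
      aeO Omega (fun x => hs xi x = hs eta x) &
      aeO Omega (fun x => hu xi x = hu eta x)].
Proof.
move=> d0; split.
- apply: (@dist_L2M_ae n n (l2trM (ht xi)) (l2trM (ht eta))).
  by apply/eqP; rewrite eq_le dist_ge0 andbT -d0; exact: distHH_ht.
- apply: (@dist_L2M_ae n n (hdM (hs xi)) (hdM (hs eta))).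
  by apply/eqP; rewrite eq_le dist_ge0 andbT -d0; exact: distHH_hs.
- apply: dist1_ae.
  by apply/eqP; rewrite eq_le dist_ge0 andbT -d0; exact: distHH_hu.
Qed.

End AlmostEverywhere.

(** For [n = 2] the two reciprocals are [1 - eps] and [eps]; for [n = 3] they are [1 - 2 eps / 3]
    and [2 eps / 3]. *)
Lemma embedding_exponents (R : realType) (n : nat) (eps : R) : n = 2%N \/ n = 3%N ->
  (if n == 2%N then 0 < eps < 1 else 2^-1 <= eps < 1) ->
  let p := if n == 2%N then 2 / (1 - eps) else 6 / (3 - 2 * eps) in
  let q := n%:R / eps in
  [/\ 0 < p, 0 < q & (p / 2)^-1 + (q / 2)^-1 = 1].
Proof.
case=> -> /= /andP[e0 e1].
  have h : 0 < 1 - eps by rewrite subr_gt0.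
  split; [by rewrite divr_gt0|by rewrite divr_gt0|].
  by field; rewrite !gt_eqF.
have e00 : 0 < eps by apply: lt_le_trans e0; rewrite invr_gt0.
have h : 0 < 3 - 2 * eps by lra.
split; [by rewrite divr_gt0|by rewrite divr_gt0|].
by field; rewrite !gt_eqF.
Qed.

Theorem theorem3p9 (R : realType) (n : nat) (hn : n = 2%N \/ n = 3%N)
  (* domain and boundary parts *)
  (Omega GammaD GammaN : set 'rV[R]_n)
  (hOmega : polyhedral_domain Omega)
  (hGammaD : GammaD `<=` bdry Omega) (hGammaN : GammaN `<=` bdry Omega)
  (hdisj : GammaD `&` GammaN = set0)
  (hGammaDm : measurable (GammaD : set (caratheodory_type (haus_om R n n.-1))))
  (hGammaDpos : (0 < hausR R n n.-1 GammaD)%E)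
  (hcover : bdry Omega = closure GammaD `|` closure GammaN)
  (* data *)
  (gamma : R) (hgamma : 0 < gamma)
  (alpha g : 'rV[R]_n)
  (K : tfield R n) (k0 : R) (hk0 : 0 < k0)
  (hKinf : Linft Omega K)
  (hKdiag : aeO Omega (fun x => is_diag_mx (K x)))
  (hKpos : aeO Omega (fun x => forall y : 'rV[R]_n,
             k0 * enorm y ^+ 2 <= vdot (mxapp (K x) y) y))
  (nu : R -> R -> R) (nu1 nu2 Lnu : R) (hnu1 : 0 < nu1)
  (hnu : forall a b, nu1 <= nu a b <= nu2)
  (hLnu : forall a b a' b', `|nu a b - nu a' b'| <=
            Lnu * Num.sqrt ((a - a') ^+ 2 + (b - b') ^+ 2))
  (phiD : vfield R n) (hphiD : inHhalf Omega GammaD phiD)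
  (* parameter conditions *)
  (delta1 delta2 delta3 k1 k2 k3 : R)
  (hdelta1 : 0 < delta1 < nu2^-1)
  (hdelta2 : 0 < delta2 < 2 / gamma)
  (hdelta3 : 0 < delta3 < 1)
  (hk3 : 0 < k3 < 2 * nu1 * delta1 / nu2)
  (hk2 : 0 < k2 < 2 * delta2)
  (hk1 : 0 < k1 < 2 * delta3 * (2 * nu1 - k3 * nu2 / delta1))
  (* constants of the domain *)
  (i4 : R)
  (hi4 : embedding_norm [set: H1 Omega] (fun v => (norm1 v)%:E)
           (fun v => normLpv Omega 4 v) i4)
  (alphaO : R) (halphaO : 0 < alphaO)
  (hellip : forall (phi : H1 Omega) (xi : HH Omega),
     alphaO * normHH xi ^+ 2 <= formA nu gamma k1 k2 k3 phi xi xi)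
  (cgp : R) (hcgp : 0 < cgp)
  (hpoincare : forall psi : H1 Omega, inH1D GammaD psi ->
     norm1 psi <= cgp * semi1 psi)
  (* radius, regularity assumption, and the related embedding constants *)
  (r eps Chat Ceps Cteps : R)
  (heps : if n == 2%N then 0 < eps < 1 else 2^-1 <= eps < 1)
  (hChat : 0 < Chat)
  (hreg : forall w phi : H1 Omega, inH10 w -> norm1 w + norm1 phi <= r ->
     forall xi : HH Omega, flow_sol nu gamma k1 k2 k3 alpha g w phi xi ->
       (normst Omega eps (ht xi) + normst Omega eps (hs xi) +
          norm1s eps (hu xi) <=
        (Chat * enorm alpha * enorm g * norm0v Omega phi)%:E)%E)
  (hCeps : embedding_norm
     [set A : tfield R n | L2t Omega A /\ (normst Omega eps A < +oo)%E]
     (normst Omega eps)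
     (normLpt Omega (if n == 2%N then 2 / (1 - eps) else 6 / (3 - 2 * eps)))
     Ceps)
  (hCteps : embedding_norm [set: H1 Omega] (fun v => (norm1 v)%:E)
     (fun v => normLpv Omega (n%:R / eps) v) Cteps) :
  let c1 := i4 ^+ 2 in
  let r0 := alphaO / (2 * c1 * Num.sqrt (2 + k3 ^+ 2)) in
  let CA := 2 * Num.sqrt 2 * Num.sqrt (2 + k2 ^+ 2) / alphaO in
  let alphat := k0 * cgp ^- 2 in
  let CB := Num.max (alphat^-1 * c1) (alphat^-1 * normInf Omega K + 1) in
  let LB := r * c1 / alphat in
  let LA := 2 / alphaO *
    Num.max (Num.max (c1 * Num.sqrt (2 + k3 ^+ 2))
                     (2 * Lnu * Num.sqrt (2 + k3 ^+ 2) * Ceps))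
            (Num.sqrt 2 * Num.sqrt (2 + k2 ^+ 2)) in
  let ag := enorm alpha * enorm g in
  let LLip := r * CA * (1 + LB) * LA * ag +
    (1 + LB) * LA * ag * (r * Cteps * Chat + 1) + LB in
  let normD := normHhalf Omega GammaD phiD in
  let sol (xi : HH Omega) (phi : H1 Omega) :=
    coupled_sol nu gamma k1 k2 k3 alpha g K GammaD phiD xi phi /\
    norm1 (hu xi) + norm1 phi <= r in
  0 < r < r0 ->
  r * CA * (1 + r * CB) * ag + CB * normD <= r ->
  LLip < 1 ->
  exists (xi : HH Omega) (phi : H1 Omega),
    [/\ sol xi phi,
        forall (xi' : HH Omega) (phi' : H1 Omega), sol xi' phi' ->
          [/\ aeO Omega (fun x => ht xi' x = ht xi x),
              aeO Omega (fun x => hs xi' x = hs xi x),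
              aeO Omega (fun x => hu xi' x = hu xi x) &
              aeO Omega (fun x => phi' x = phi x)],
        normHH xi <= CA * r * ag &
        norm1 phi <= CB * (r * norm1 (hu xi) + normD)].

Proof.
move=> c1 r0 CA alphat CB LB LA ag LLip normD sol /andP[rp rr0] hdata hLip.
have [oO _ _ bO _] := hOmega.
pose Hp := h1preip oO bO; pose HHp := hhpreip oO bO.
have [i40 hi4' _] := hi4.
have {}hi4' (v : H1 Omega) : (normLpv Omega 4 v <= i4%:E * (norm1 v)%:E)%E := hi4' v I.
have [Ct0 hCt' _] := hCteps.
have {}hCt' (v : H1 Omega) : (normLpv Omega (n%:R / eps)%R v <= Cteps%:E * (norm1 v)%:E)%E := hCt' v I.
have [Ce0 hCe' _] := hCeps.
have [p0 q0 pq] := embedding_exponents hn heps.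
have r00 : 0 <= r := ltW rp.
have c10 : 0 <= c1 by exact: sqr_ge0.
have hr : c1 * Num.sqrt (2 + k3 ^+ 2) * r <= alphaO / 2.
  have [c1p|] := ltP 0 (2 * c1 * Num.sqrt (2 + k3 ^+ 2)).
    move: (ltW rr0); rewrite /r0 ler_pdivlMr // => h.
    by move: h; lra.
  (* A nonpositive denominator, including 0 whose inverse is 0, makes [r0 <= 0], contrary to
     [0 < r < r0]. *)
  move=> h; have : r0 <= 0.
    rewrite /r0; apply: mulr_ge0_le0; first exact: ltW.
    by rewrite invr_le0.
  by move=> h'; have := lt_le_trans (lt_trans rp rr0) h'; rewrite ltxx.
(* Only the bound on [t] is kept from the regularity assumption; it also provides the finiteness
   required by the embedding. *)
have hreg' (w phi : H1 Omega) (xi : HH Omega) : inH10 w -> norm1 w + norm1 phi <= r ->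
    flow_sol nu gamma k1 k2 k3 alpha g w phi xi ->
    (normLpt Omega (if n == 2%N then 2 / (1 - eps) else 6 / (3 - 2 * eps))%R (ht xi) <=
      (Ceps * (Chat * ag * norm0v Omega phi))%:E)%E.
  move=> w0 wr fl.
  have h1 : (normst Omega eps (ht xi) <= (Chat * ag * norm0v Omega phi)%:E)%E.
    have := hreg w phi w0 wr xi fl.
    rewrite /ag mulrA; apply: le_trans.
    by rewrite -addeA leeDl // adde_ge0 // poweR_ge0.
  apply: (@le_trans _ _ (Ceps%:E * normst Omega eps (ht xi))%E).
    by apply: hCe'; split; [exact: l2_L2|exact: le_lt_trans h1 (ltry _)].
  by rewrite EFinM; apply: lee_wpmul2l; rewrite ?lee_fin.
have at0 : 0 < alphat by rewrite mulr_gt0 // invr_gt0 exprn_gt0.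
have LB0 : 0 <= LB by exact: mulr_ge0 (mulr_ge0 r00 c10) (ltW (etrans (invr_gt0 _) at0)).
have CB0 : 0 <= CB.
  by rewrite /CB le_max; apply/orP; left; exact: mulr_ge0 (ltW (etrans (invr_gt0 _) at0)) c10.
have CA0 : 0 <= CA by exact: mulr_ge0 (mulr_ge0 (mulr_ge0 _ (sqrtr_ge0 _)) (sqrtr_ge0 _)) (ltW (etrans (invr_gt0 _) halphaO)).
have ag0 : 0 <= ag by exact: mulr_ge0 (sqrtr_ge0 _) (sqrtr_ge0 _).
have LA0 : 0 <= LA.
  apply: mulr_ge0; first by rewrite divr_ge0 ?ltW.
  by rewrite !le_max; apply/orP; right; rewrite mulr_ge0 ?sqrtr_ge0.
(* The coefficients of the velocity and temperature distances in [flow_lipschitz]. *)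
pose A1 := LA * ag * (r * CA); pose A2 := LA * ag * (r * Cteps * Chat + 1).
have A10 : 0 <= A1 by exact: mulr_ge0 (mulr_ge0 LA0 ag0) (mulr_ge0 r00 CA0).
have A20 : 0 <= A2.
  apply: (mulr_ge0 (mulr_ge0 LA0 ag0)); apply: addr_ge0 => //.
  by rewrite !mulr_ge0 // ltW.
have LE : LLip = (1 + LB) * A1 + ((1 + LB) * A2 + LB).
  by rewrite /LLip /A1 /A2; ring.
have LB1 : 0 <= 1 + LB by exact: addr_ge0.
have q1 : (1 + LB) * A1 <= LLip by rewrite LE lerDl addr_ge0 // mulr_ge0.
have q2 : (1 + LB) * A2 + LB <= LLip by rewrite LE lerDr mulr_ge0.
(* The first data hypothesis, with [CA * r * ag] as the bound on the new velocity. *)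
have small : CA * r * ag + CB * (CA * r * ag * r + normD) <= r.
  apply: le_trans hdata; apply: le_of_eq.
  by ring.
pose flow (w phi : H1 Omega) (xi : HH Omega) := flow_sol nu gamma k1 k2 k3 alpha g w phi xi.
pose ht1 (w phi f : H1 Omega) := heat GammaD K phiD w phi f.
have fl_ex w phi : inH10 w /\ nrm Hp w + nrm Hp phi <= r -> exists xi, flow w phi xi.
  rewrite -!norm1E => -[w0 wr].
  apply: (flow_exists oO bO alpha g hnu1 hnu hLnu i40 hi4' halphaO hellip hr phi).
  by apply: le_trans wr; rewrite lerDl norm1_ge0.
have fl_bd w phi xi : inH10 w /\ nrm Hp w + nrm Hp phi <= r -> flow w phi xi ->
    normHH xi <= CA * r * ag.
  rewrite -!norm1E => -[w0 wr] fl.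
  exact: (flow_norm_CA oO bO i40 hi4' halphaO hellip hr w0 wr fl).
have fl_bd' w phi xi : inH10 w /\ nrm Hp w + nrm Hp phi <= r -> flow w phi xi ->
    nrm Hp (hu xi) <= CA * r * ag.
  move=> Ww fl; rewrite -norm1E; apply: le_trans (fl_bd _ _ _ Ww fl); exact: norm1_hu_le.
have fl_lip w phi xi w' phi' xi' : inH10 w /\ nrm Hp w + nrm Hp phi <= r ->
    flow w phi xi -> inH10 w' /\ nrm Hp w' + nrm Hp phi' <= r -> flow w' phi' xi' ->
    dist HHp xi xi' <= A1 * dist Hp w w' + A2 * dist Hp phi phi'.
  rewrite -!norm1E => -[w0 wr] fl [w0' wr'] fl'.
  rewrite /A1 /A2 -!(mulrA (LA * ag)) -mulrDr.
  exact: (flow_lipschitz oO bO hnu1 hnu hLnu i40 hi4' halphaO hellip hr p0 q0 pq Ce0 Ct0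
    (ltW hChat) hCt' hreg' w0 wr fl w0' wr' fl').
have fl_eq w phi xi xi' : flow w phi xi -> dist HHp xi xi' = 0 -> flow w phi xi'.
  exact: (flow_congr hnu1 hnu hLnu i40 hi4').
have he_ex w phi : exists f, ht1 w phi f.
  exact: (heat_exists oO bO hGammaDm i40 hi4' hk0 hKinf hKdiag hKpos hcgp hpoincare hphiD).
have he_bd w phi f : ht1 w phi f -> nrm Hp f <= CB * (nrm Hp w * nrm Hp phi + normD).
  rewrite -!norm1E.
  exact: (heat_norm oO bO hGammaDm i40 hi4' hk0 hKinf hKdiag hKpos hcgp hpoincare hphiD).
have he_lip w phi f w' phi' f' : ht1 w phi f -> ht1 w' phi' f' ->
    nrm Hp phi <= r -> nrm Hp w' <= r ->
    dist Hp f f' <= LB * (dist Hp w w' + dist Hp phi phi').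
  move=> he he' hp hw.
  apply: (le_trans (heat_lipschitz oO bO hGammaDm i40 hi4' hk0 hKinf hKdiag hKpos hcgp
    hpoincare he he')).
  have -> : LB * (dist Hp w w' + dist Hp phi phi') =
      alphat^-1 * (c1 * (r * dist Hp w w' + r * dist Hp phi phi')).
    by rewrite /LB; ring.
  rewrite -norm1E in hp; rewrite -norm1E in hw.
  rewrite ler_wpM2l ?invr_ge0 ?(ltW at0) // ler_wpM2l //.
  by apply: lerD; rewrite ler_wpM2r ?dist_ge0.
have he_eq w phi phi' f : ht1 w phi f -> dist Hp phi phi' = 0 -> ht1 w phi' f.
  move=> [tr1 h1] d0; split=> // psi hpsi; rewrite h1 //.
  exact: (funG_dist0 i40 hi4' w psi d0).
have z0 : nrm Hp (h1zero oO) = 0.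
  apply/eqP; rewrite -sqrf_eq0 sqr_nrm.
  by rewrite /= /h1ip !ipm0 ?addr0.
have [xi [phi [[u0 ur] fl he hun]]] := @coupled_fixpoint R (H1 Omega) (HH Omega) Hp HHp
  (@inH10 R n Omega) (h1zero oO) (@hu R n Omega) flow ht1 r (CA * r * ag) CB normD A1 A2 LB LLip
  (@h1_complete R n Omega oO bO) (inH10_zero oO) z0 (@inH10_closed R n Omega oO bO)
  (fun x => hu0 x) (distHH_hu oO bO) fl_ex fl_bd' fl_lip fl_eq he_ex he_bd he_lip he_eq
  r00 CB0 A20 LB0 small q1 q2 hLip.
exists xi, phi; split.
- by split; [case: he => h1 h2; split|rewrite !(norm1E oO bO)].
- move=> xi' phi' [[tr1 fl' he'] wr].
  have Ww : inH10 (hu xi') /\ nrm Hp (hu xi') + nrm Hp phi' <= r.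
    by split; [exact: hu0|rewrite -!norm1E].
  have [d1 d2] := hun xi' phi' Ww fl' (conj tr1 he').
  by have [a1 a2 a3] := distHH_ae d1; have a4 := dist1_ae d2; split.
- exact: fl_bd (conj u0 ur) fl.
(* [heat_norm] yields the product of the norms of velocity and temperature; the temperature factor
   is at most [r] in the ball. *)
- have := he_bd _ _ _ he; rewrite -!norm1E => /le_trans; apply.
  rewrite ler_wpM2l // lerD2r mulrC ler_wpM2r ?norm1_ge0 //.
  apply: le_trans ur; rewrite -!norm1E lerDr; exact: norm1_ge0.
Qed.
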